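(* Let $\gamma\ge1$ and $0<v_+<1$, and let $a$ and the normalized viscous shock profile $\hat v$ be as in the context. If $$(\gamma+1)v_+^{\gamma+2}+v_+^\gamma(\gamma-1)\big((\gamma+1)v_+-(a+1)\gamma\big)^2+a\gamma(\gamma^2-1)(\gamma+2)v_+-a(a+1)\gamma^2(\gamma^2-1)\ge 0,$$ then the viscous shock is spectrally stable.
   Context: The underlying equations are the isentropic compressible Navier--Stokes equations $v_t-u_x=0$, $u_t+p(v)_x=(u_x/v)_x$, with $p(v)=a_0v^{-\gamma}$, $a_0>0$, $\gamma\ge 1$. A viscous shock is a traveling wave $(\hat v,\hat u)(x-st)$ with asymptotically constant end-states $(v_\pm,u_\pm)$. After passing to the moving frame and rescaling $(x,t,v,u)\to(-\varepsilon s x,\varepsilon s^2t,v/\varepsilon,-u/(\varepsilon s))$, with $\varepsilon$ chosen so that $0<v_+<v_-=1$, the system becomes $v_t+v_x-u_x=0$, $u_t+u_x+(av^{-\gamma})_x=(u_x/v)_x$, and viscous shocks become stationary solutions $(\hat v,\hat u)$ of it, where $$a=v_+^\gamma\,\frac{1-v_+}{1-v_+^\gamma},\qquad \hat v'=\hat v\big(\hat v-1+a(\hat v^{-\gamma}-1)\big),\qquad \hat v(-\infty)=1,\quad \hat v(+\infty)=v_+,$$ and $\hat u-\hat v$ is constant. The profile $\hat v$ is unique up to translation and strictly decreasing. Define $$h(\hat v)=-\hat v^{\gamma+1}+a(\gamma-1)+(a+1)\hat v^\gamma .$$ Linearizing about $(\hat v,\hat u)$ gives the eigenvalue problem $$\lambda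 v+v'-u'=0,\qquad \lambda u+u'-\left(\frac{h(\hat v)}{\hat v^{\gamma+1}}\,v\right)'=\left(\frac{u'}{\hat v}\right)'.$$ The viscous shock is called spectrally stable if this linearized system has no spectrum in $\{\lambda\in\mathbb C:\operatorname{Re}\lambda\ge0\}\setminus\{0\}$. Here the spectrum is that of the operator $$L(v,u)=\Big(u'-v',\; -u'+\big(h(\hat v)\hat v^{-\gamma-1}v\big)'+(u'/\hat v)'\Big)$$ on $L^2(\mathbb R;\mathbb C)^2$ with domain $H^1(\mathbb R)\times H^2(\mathbb R)$. *)

(* Defs.v *)
From HB Require Import structures.
From mathcomp Require Import all_boot all_order all_algebra.
From mathcomp Require Import all_classical all_reals all_analysis.
From mathcomp Require Import complex.

Set Implicit Arguments.
Unset Strict Implicit.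
Unset Printing Implicit Defensive.

Import Order.TTheory GRing.Theory Num.Theory.
Import numFieldNormedType.Exports.

Local Open Scope classical_set_scope.
Local Open Scope complex_scope.
Local Open Scope ring_scope.

(** * The spaces L^2(R;C), H^1(R), H^2(R)

    Elements of L^2 are handled through representatives R -> R[i]; equality in
    L^2 is equality almost everywhere for Lebesgue measure. *)

Section SobolevSpaces.
Context {R : realType}.
Local Notation mu := (@lebesgue_measure R).
Implicit Types (f g : R -> R[i]) (phi : R -> R).

Definition L2 f : Prop :=
  (@complex.Re R \o f) \in Lfun mu 2%:E /\ (@complex.Im R \o f) \in Lfun mu 2%:E.

Definition complex_integral f : R[i] :=
  (\int[mu]_x @complex.Re R (f x))%R +i* (\int[mu]_x @complex.Im R (f x))%R.

Definition test_function phi : Prop :=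
  [/\ forall x, derivable phi x 1,
      continuous (derive1 phi)
    & exists M : R, forall x, M < `|x| -> phi x = 0].

(** Test functions are C^1 with compact support, as in Brezis, "Functional
    Analysis, Sobolev Spaces and PDE", section 8.2; for locally integrable f
    and g, C^oo test functions give the same notion. *)
Definition weak_derivative f g : Prop :=
  forall phi, test_function phi ->
    complex_integral (fun x => f x * (derive1 phi x)%:C) =
    - complex_integral (fun x => g x * (phi x)%:C).

(** The weak derivative in L^2 when there is one (it is then unique up to a
    null set), and 0 otherwise. *)
Definition wderiv f : R -> R[i] :=
  xget (fun=> 0) [set g | L2 g /\ weak_derivative f g].

Definition H1 f : Prop := L2 f /\ exists g, L2 g /\ weak_derivative f g.

Definition H2 f : Prop := H1 f /\ H1 (wderiv f).

(** * Spectrum of an unbounded operator on L^2(R;C)^2 *)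

Definition cpair : Type := ((R -> R[i]) * (R -> R[i]))%type.

Definition L2pair (w : cpair) : Prop := L2 w.1 /\ L2 w.2.

Definition L2eq (w z : cpair) : Prop :=
  {ae mu, forall x, w.1 x = z.1 x} /\ {ae mu, forall x, w.2 x = z.2 x}.

Definition L2norm (w : cpair) : R :=
  Num.sqrt (\int[mu]_x
    (ComplexField.Normc.normc (w.1 x) ^+ 2 +
     ComplexField.Normc.normc (w.2 x) ^+ 2))%R.

Definition shifted (T : cpair -> cpair) (lambda : R[i]) (w : cpair) : cpair :=
  (fun x => lambda * w.1 x - (T w).1 x, fun x => lambda * w.2 x - (T w).2 x).

(** [lambda - T] is a bijection from the domain [dom] onto L^2(R;C)^2, and its
    inverse is bounded on L^2(R;C)^2. *)
Definition in_resolvent_set (dom : cpair -> Prop) (T : cpair -> cpair)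
    (lambda : R[i]) : Prop :=
  [/\ forall w z, dom w -> dom z ->
        L2eq (shifted T lambda w) (shifted T lambda z) -> L2eq w z,
      forall F, L2pair F ->
        exists w, dom w /\ L2eq (shifted T lambda w) F
    & exists M : R, forall w, dom w ->
        L2norm w <= M * L2norm (shifted T lambda w)].

Definition in_spectrum dom T lambda : Prop := ~ in_resolvent_set dom T lambda.

End SobolevSpaces.
Arguments cpair : clear implicits.

(** * The viscous shock and its linearization *)

Section ViscousShock.
Context {R : realType}.
Implicit Types (gamma vp : R) (vh : R -> R).

Definition shock_a gamma vp : R :=
  vp `^ gamma * ((1 - vp) / (1 - vp `^ gamma)).

(** The profile is determined only up to translation: any translate is
    admitted. Since [û - v̂] is constant and [û] does not enter the linearized
    operator, only [v̂] is recorded. Positivity is part of the meaning of a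
    specific volume, and [`^] is a genuine real power only on positive bases. *)
Definition shock_profile gamma vp vh : Prop :=
  let a := shock_a gamma vp in
  [/\ forall x, 0 < vh x,
      forall x, is_derive x (1 : R) vh
        (vh x * (vh x - 1 + a * (vh x `^ (- gamma) - 1))),
      vh x @[x --> -oo%R] --> (1 : R)
    & vh x @[x --> +oo%R] --> vp].

Definition shock_h gamma a (v : R) : R :=
  - v `^ (gamma + 1) + a * (gamma - 1) + (a + 1) * v `^ gamma.

Definition linop_dom (w : cpair R) : Prop := H1 w.1 /\ H2 w.2.

(** [(v, u) |-> (u' - v', - u' + (h(v̂) v̂^(-gamma-1) v)' + (u' / v̂)')].
    On the domain every weak derivative below exists in L^2, so the default
    value of [wderiv] plays no role. *)
Definition linop gamma vp vh (w : cpair R) : cpair R :=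
  let v := w.1 in
  let u := w.2 in
  let q x := shock_h gamma (shock_a gamma vp) (vh x) * vh x `^ (- gamma - 1) in
  (fun x => wderiv u x - wderiv v x,
   fun x => - wderiv u x + wderiv (fun y => (q y)%:C * v y) x
            + wderiv (fun y => wderiv u y / (vh y)%:C) x).

Definition spectrally_stable gamma vp vh : Prop :=
  forall lambda : R[i],
    in_spectrum linop_dom (linop gamma vp vh) lambda ->
    ~ (0 <= @complex.Re R lambda /\ lambda <> 0).

End ViscousShock.

(* Main.v *)
(** Write [s] for the profile, [q = h(s) / s^(gamma + 1)], and for [lambda <> 0]
    put [V = (u - v) / lambda] and [U = (u' / s + q v - u) / lambda]. The
    resolvent equation [(lambda - L)(v, u) = (f, g)] is then the first-order system
      [U' = u - g / lambda],  [V' = u - lambda V - f / lambda],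
      [u' = s (lambda U + (1 - q) u + lambda q V)].
    With [b = 1 / q], [d = b / s] and [<x, y>] the real inner product of complex
    numbers, the form
      [Q = d <u, U> + <V, U> - |V|^2 / 2 - (d' + b) |U|^2 / 2]
    satisfies, along the homogeneous system,
      [Q' = Re lambda (b |U|^2 + |V|^2) + d |u|^2 - (b' + d'') |U|^2 / 2].
    The polynomial hypothesis says that [- (b' + d'')] is nonnegative where
    [s = v_+]; the polynomial increases with [s], so this holds along the whole
    profile. Adding lower-order corrections to a large multiple of [Q] gives a
    bounded form [S] with [S' >= c |(U, V, u)|^2 - K |(f, g)|^2] for every
    [lambda <> 0] with [Re lambda >= 0]. The sign of [S] under suitable boundary
    conditions makes the problem on [-N, N] solvable with bounds uniform in [N],
    and averaging the energy inequality over the endpoints shows that these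
    solutions converge, that the limit is the only square integrable solution,
    and that it is bounded by the data. So [lambda] is in the resolvent set: no
    Fredholm or Evans function argument is needed. *)
Require Import Defs.
From mathcomp Require Import all_boot all_order all_algebra.
From mathcomp Require Import all_classical all_reals all_analysis.
From mathcomp Require Import measurable_realfun complex ring lra.

Set Implicit Arguments.
Unset Strict Implicit.
Unset Printing Implicit Defensive.

Import Order.TTheory GRing.Theory Num.Theory.
Import numFieldNormedType.Exports.

Local Open Scope classical_set_scope.
Local Open Scope ring_scope.

(** * Absolutely continuous primitives *)

Section Primitive.
Context {R : realType}.
Local Notation mu := (@lebesgue_measure R).
Implicit Types (f g F G : R -> R) (a b c k : R).

(** The form is shaped by the imaginary axis. When [Re lambda = 0], [Q'] controls [u] but gives no
    uniform control of [U] or [V]. The corrections supply [|X|^2] and [|Y|^2] for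
    [X = lambda (U + q V) - q u = u' / s - u] and [Y = lambda V]; together with [u] these determine
    [U] and [V], because [lambda <> 0]. The weights in [Q] are forced: [d s q = 1] cancels the terms
    in [<lambda V, U>], and the coefficient [d' + b] cancels those in [<u, U>]. As [S] is
    indefinite, its sign is prescribed at each end of [[-N, N]] by conditions that match its
    signature: [V = 0] and [u = kap U] on the left, [U = 0] on the right, three complex conditions
    for three unknowns. Solvability then amounts to a nonzero determinant, and the energy inequality
    excludes a kernel. The data are merely square integrable, so derivatives exist only almost
    everywhere; all calculus is therefore done with absolutely continuous primitives, which Lebesgue
    differentiation ties to weak derivatives. *)

Definition intg f a b := mu.-integrable `[a, b] (EFin \o f).

(** Absolute continuity in integral form: [f] matters only up to null sets and no pointwise
    derivative of [F] is required. Integrability is demanded separately because the real-valued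
    integral takes a default value when it diverges. *)
Definition primitive_on a b F f : Prop :=
  intg f a b /\
  forall x y, a <= x -> x <= y -> y <= b ->
    F y - F x = \int[mu]_(t in `[x, y]) f t.

Lemma intg_sub f a b x y : a <= x -> y <= b -> intg f a b -> intg f x y.
Proof.
move=> ax yb; apply: integrableS => //=; apply/subset_itvP.
by apply: subset_itv; rewrite bnd_simp.
Qed.

Lemma primitive_on_sub a b x y F f : a <= x -> y <= b ->
  primitive_on a b F f -> primitive_on x y F f.
Proof.
move=> ax yb [fi Ff]; split; first exact: intg_sub fi.
by move=> s t xs st ty; apply: Ff => //; [exact: le_trans xs|exact: le_trans yb].
Qed.

Lemma eq_intg f g a b : (forall x, a <= x <= b -> f x = g x) ->
  intg f a b -> intg g a b.
Proof.
move=> fg; apply: eq_integrable => // x; rewrite inE/= in_itv/= => xab.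
by rewrite /= fg.
Qed.

Lemma eq_Rint f g a b : (forall x, a <= x <= b -> f x = g x) ->
  \int[mu]_(t in `[a, b]) f t = \int[mu]_(t in `[a, b]) g t.
Proof. by move=> fg; apply: eq_Rintegral => x; rewrite inE/= in_itv/= => /fg. Qed.

Lemma eq_primitive_on a b F G f g :
  (forall x, a <= x <= b -> F x = G x) -> (forall x, a <= x <= b -> f x = g x) ->
  primitive_on a b F f -> primitive_on a b G g.
Proof.
move=> FG fg [fi Ff]; split; first exact: eq_intg fi.
move=> x y ax xy yb; rewrite -!FG ?Ff//.
- apply: eq_Rint => z /andP[xz zy]; apply: fg.
  by rewrite (le_trans ax xz) (le_trans zy yb).
- by rewrite ax (le_trans xy).
- by rewrite yb (le_trans ax).
Qed.

Lemma primitive_on_continuous a b F f : a <= b -> primitive_on a b F f ->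
  {within `[a, b], continuous F}.
Proof.
move=> ab [fi Ff].
have := parameterized_integral_continuous ab fi => cI.
pose G x := F a + \int[mu]_(t in `[a, x]) f t.
have FG : {in `[a, b]%classic, G =1 F}.
  move=> x; rewrite inE/= in_itv/= => /andP[ax xb].
  by rewrite /G -Ff// addrC subrK.
apply: (subspace_eq_continuous FG).
move=> x; apply: (@continuousD _ _ (subspace `[a, b]) (cst (F a))).
  exact: cst_continuous.
exact: cI.
Qed.

Lemma continuous_on_bounded a b F : {within `[a, b], continuous F} ->
  exists M, 0 <= M /\ forall x, a <= x <= b -> `|F x| <= M.
Proof.
move=> cF.
have := compact_bounded (continuous_compact cF (@segment_compact R a b)).
move=> [M [Mr HM]]; exists (Num.max 0 (M + 1)); split; first by rewrite le_max lexx.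
move=> x xab; rewrite le_max; apply/orP; right; apply: (HM (M + 1)).
  by rewrite ltrDl.
by exists x => //; rewrite /= in_itv.
Qed.

Lemma continuous_on_measurable a b F : {within `[a, b], continuous F} ->
  measurable_fun `[a, b] F.
Proof. by move=> cF; exact: subspace_continuous_measurable_fun. Qed.

Lemma continuous_on_intg a b F : {within `[a, b], continuous F} -> intg F a b.
Proof. by move=> cF; apply: continuous_compact_integrable => //; exact: segment_compact. Qed.

Lemma intg_mulr a b f g : {within `[a, b], continuous g} -> intg f a b ->
  intg (fun x => f x * g x) a b.
Proof.
move=> cg fi.
have [M [M0 HM]] := continuous_on_bounded cg.
apply: (@eq_integrable _ _ _ mu _ _ ((EFin \o f) \* (EFin \o g))%E) => //.
apply: integrableMl => //; first exact: continuous_on_measurable.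
exists M; split; first by rewrite num_real.
move=> x Mx y /=; rewrite in_itv/= => /HM h; exact: le_trans h (ltW Mx).
Qed.

Lemma intgD a b f g : intg f a b -> intg g a b -> intg (fun x => f x + g x) a b.
Proof. by move=> fi gi; apply: (@eq_integrable _ _ _ mu _ _ ((EFin \o f) \+ (EFin \o g))%E) => //; exact: integrableD. Qed.

Lemma intgZ a b k f : intg f a b -> intg (fun x => k * f x) a b.
Proof. by move=> fi; apply: (@eq_integrable _ _ _ mu _ _ (fun x => k%:E * (EFin \o f) x)%E) => //; exact: integrableZl. Qed.

Lemma intg_norm a b f : intg f a b -> intg (fun x => `|f x|) a b.
Proof. exact: integrable_norm. Qed.

Lemma intg_cst a b k : intg (fun=> k) a b.
Proof. by apply: continuous_on_intg => x; exact: cst_continuous. Qed.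

Lemma primitive_onD a b F G f g : primitive_on a b F f -> primitive_on a b G g ->
  primitive_on a b (fun x => F x + G x) (fun x => f x + g x).
Proof.
move=> [fi Ff] [gi Gg]; split; first exact: intgD.
move=> x y ax xy yb; rewrite RintegralD ?(intg_sub ax yb fi) ?(intg_sub ax yb gi)//.
  by rewrite -Ff// -Gg//; ring.
all: exact: (intg_sub ax yb).
Qed.

Lemma primitive_onZ a b k F f : primitive_on a b F f ->
  primitive_on a b (fun x => k * F x) (fun x => k * f x).
Proof.
move=> [fi Ff]; split; first exact: intgZ.
move=> x y ax xy yb; rewrite RintegralZl// ?(intg_sub ax yb fi)//.
  by rewrite -Ff//; ring.
exact: (intg_sub ax yb).
Qed.

Lemma primitive_on_cst a b k : primitive_on a b (fun=> k) (fun=> 0).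
Proof.
split; first exact: intg_cst.
by move=> x y _ _ _; rewrite subrr Rintegral_cst// mul0r.
Qed.

Lemma Rint_split f a b c : a <= c -> c <= b -> intg f a b ->
  \int[mu]_(t in `[a, b]) f t =
  \int[mu]_(t in `[a, c]) f t + \int[mu]_(t in `[c, b]) f t.
Proof.
move=> ac cb fi.
have := @Rintegral_itvB _ f (BLeft a) (BRight b) c fi.
rewrite !bnd_simp => /(_ ac cb) h.
rewrite -(@Rintegral_itv_obnd_cbnd _ c); last first.
  by apply: (integrableS _ _ _ fi) => //; apply: subset_itv; rewrite bnd_simp.
by rewrite -h addrC subrK.
Qed.

Lemma primitive_on_integral a b f : intg f a b ->
  primitive_on a b (fun x => \int[mu]_(t in `[a, x]) f t) f.
Proof.
move=> fi; split=> // x y ax xy yb.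
rewrite (@Rint_split f a y x)//; last exact: intg_sub fi.
by rewrite addrAC subrr add0r.
Qed.

Lemma le_Rint f g a b : intg f a b -> intg g a b ->
  (forall x, a <= x <= b -> f x <= g x) ->
  \int[mu]_(t in `[a, b]) f t <= \int[mu]_(t in `[a, b]) g t.
Proof. by move=> fi gi fg; apply: le_Rintegral => // x /=; rewrite in_itv. Qed.

Lemma Rint_cst a b k : a <= b -> \int[mu]_(t in `[a, b]) k = k * (b - a).
Proof.
move=> ab; rewrite Rintegral_cst//= lebesgue_measure_itv/= lte_fin.
case: ltrP => // ba; have -> : a = b by apply/eqP; rewrite eq_le ab ba.
by rewrite subrr.
Qed.

End Primitive.

(** * Integration by parts for absolutely continuous functions *)

Section Product.
Context {R : realType}.
Local Notation mu := (@lebesgue_measure R).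
Implicit Types (f g F G : R -> R) (a b c k : R).

Lemma restrict_intg f a b : intg f a b ->
  mu.-integrable setT (EFin \o (f \_ `[a, b])).
Proof.
move=> fi; rewrite -restrict_EFin; exact: (integrable_mkcond _ _).1.
Qed.

Lemma restrictE f a b x : (f \_ `[a, b]) x = if a <= x <= b then f x else 0.
Proof. by rewrite patchE mem_setE in_itv. Qed.

(** The product [f x * g y] cut off to the triangle [x <= y]. Integrating it in the two possible
    orders is what proves the product rule for primitives. *)
Let k a b f g (p : R * R) : R :=
  (f \_ `[a, b]) p.1 * (g \_ `[a, b]) p.2 * (p.1 <= p.2)%R%:R.

Lemma triangle_integrable a b f g : intg f a b -> intg g a b ->
  (mu \x mu)%E.-integrable setT (EFin \o k a b f g).
Proof.
move=> /restrict_intg fi /restrict_intg gi.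
have mf := measurable_int _ fi; have mg := measurable_int _ gi.
have mk : measurable_fun setT (k a b f g).
  apply: measurable_funM.
    apply: measurable_funM.
    - apply: (measurableT_comp (f := f \_ `[a, b])) => //.
      exact/measurable_EFinP.
    - apply: (measurableT_comp (f := g \_ `[a, b])) => //.
      exact/measurable_EFinP.
  apply: (@measurableT_comp _ _ _ _ _ _ (fun b : bool => b%:R : R) _ (fun p : R * R => p.1 <= p.2)) => //.
  exact: measurable_fun_ler.
apply/integrable12ltyP.
  exact: measurableT_comp.
have ngi : mu.-integrable setT (fun y => `|(g \_ `[a, b]) y|%:E) by exact: (integrable_norm gi).
have nfi : mu.-integrable setT (fun y => `|(f \_ `[a, b]) y|%:E) by exact: (integrable_norm fi).
set I := (\int[mu]_y (`|(g \_ `[a, b]) y|%:E))%E.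
have Ifin : I \is a fin_num by exact: integrable_fin_num.
(* The indicator is at most 1, so each inner integral is bounded by [|f x|] times the finite
   constant [I]. *)
apply: (@le_lt_trans _ _ (\int[mu]_x (`|(f \_ `[a, b]) x|%:E * I)%E)%E).
  apply: ge0_le_integral => //.
  - by move=> x _; exact: integral_ge0.
  - have mak : measurable_fun setT (abse \o (EFin \o k a b f g)).
      by apply: measurableT_comp => //; exact: measurableT_comp.
    by apply: (measurable_fun_fubini_tonelli_F (m2 := mu) _ mak) => p; rewrite abse_ge0.
  - by apply: emeasurable_funM => //; exact: measurable_int nfi.
  - move=> x _; rewrite /I -integralZl//; apply: ge0_le_integral => //.
    + by apply: measurableT_comp => //; apply/measurable_EFinP; exact: (measurable_fun_pair2 x mk).
    + by apply: emeasurable_funM => //; exact: measurable_int ngi.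
    + move=> y _; rewrite /k/= -EFinM lee_fin -normrM [leLHS]normrM ler_piMr//.
      by rewrite ger0_norm ?ler0n// lern1 leq_b1.
rewrite -(fineK Ifin) integralZr// ltey_eq fin_numM//.
exact: integrable_fin_num.
Qed.

Lemma triangle_inner2 a b f g x : intg g a b -> a <= x <= b ->
  (\int[mu]_y (k a b f g (x, y))%:E)%E =
  (f x * \int[mu]_(t in `[x, b]) g t)%:E.
Proof.
move=> gi /[dup] /andP[ax xb] xab.
have gi' := intg_sub ax (lexx b) gi.
rewrite EFinM fineK; last by apply: integrable_fin_num.
rewrite -integralZl// [RHS]integral_mkcond; apply: eq_integral => y _.
rewrite /k /= !restrictE xab patchE mem_setE in_itv/=.
case: (leP x y) => xy /=; last by rewrite mulr0.
rewrite (le_trans ax xy)/=; case: ifP => _; by rewrite mulr1 ?mulr0.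
Qed.

Lemma triangle_inner1 a b f g y : intg f a b -> a <= y <= b ->
  (\int[mu]_x (k a b f g (x, y))%:E)%E =
  (g y * \int[mu]_(t in `[a, y]) f t)%:E.
Proof.
move=> fi /[dup] /andP[ay yb] yab.
have fi' := intg_sub (lexx a) yb fi.
rewrite EFinM fineK; last by apply: integrable_fin_num.
rewrite -integralZl// [RHS]integral_mkcond; apply: eq_integral => x _.
rewrite /k /= !restrictE yab patchE mem_setE in_itv/=.
case: (leP x y) => xy /=; last by rewrite mulr0 andbF.
rewrite (le_trans xy yb) !andbT mulr1; case: ifP => _; by rewrite ?mul0r// -EFinM mulrC.
Qed.

Lemma triangle_fubini a b f g : intg f a b -> intg g a b ->
  \int[mu]_(x in `[a, b]) (f x * \int[mu]_(t in `[x, b]) g t) =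
  \int[mu]_(y in `[a, b]) (g y * \int[mu]_(t in `[a, y]) f t).
Proof.
move=> fi gi; rewrite /Rintegral; congr fine.
have := Fubini (triangle_integrable fi gi) => /=.
rewrite [X in X = _ -> _](_ : _ = (\int[mu]_(x in `[a, b]) (f x * \int[mu]_(t in `[x, b]) g t)%:E)%E).
  rewrite [X in _ = X -> _](_ : _ = (\int[mu]_(y in `[a, b]) (g y * \int[mu]_(t in `[a, y]) f t)%:E)%E) //.
  rewrite [RHS]integral_mkcond; apply: eq_integral => y _.
  rewrite patchE mem_setE in_itv/=; case: ifPn => [yab|yab]; first exact: triangle_inner1.
  by apply: integral0_eq => x _; rewrite /k/= !restrictE (negbTE yab) mulr0 mul0r.
rewrite [RHS]integral_mkcond; apply: eq_integral => y _.
rewrite patchE mem_setE in_itv/=; case: ifPn => [yab|yab]; first exact: triangle_inner2.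
by apply: integral0_eq => x _; rewrite /k/= !restrictE (negbTE yab) !mul0r.
Qed.

Lemma primitive_onM a b F G f g : primitive_on a b F f -> primitive_on a b G g ->
  primitive_on a b (fun x => F x * G x) (fun x => f x * G x + F x * g x).
Proof.
(* For [b < a] the interval is empty and the claim is vacuous. *)
have [ba|ab] := ltP b a.
  move=> _ _; split; first by rewrite /intg set_itv_ge ?bnd_simp -?ltNge//; exact: integrable_set0.
  by move=> x y ax xy yb; move: (le_trans ax (le_trans xy yb)); rewrite leNgt ba.
move=> pF pG; have cF := primitive_on_continuous ab pF; have cG := primitive_on_continuous ab pG.
move: (pF) (pG) => [fi Ff] [gi Gg].
have i1 : intg (fun x => f x * G x) a b by exact: intg_mulr.
have i2 : intg (fun x => F x * g x) a b.
  by apply: (@eq_intg _ (fun x => g x * F x)) => [x _|]; [rewrite mulrC|exact: intg_mulr].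
split; first exact: intgD.
move=> x y ax xy yb.
have fi' := intg_sub ax yb fi; have gi' := intg_sub ax yb gi.
have i1' := intg_sub ax yb i1; have i2' := intg_sub ax yb i2.
rewrite RintegralD//.
(* The inner integrals are [G y - G t] and [F t - F x]; expanding both sides of the Fubini identity
   and rearranging leaves the product rule. *)
have := triangle_fubini fi' gi'.
rewrite (@eq_Rint _ _ (fun t => G y * f t + (-1) * (f t * G t))); last first.
  move=> t /andP[xt ty]; rewrite -Gg//; first by ring.
  exact: le_trans xt.
rewrite [in X in _ = X](@eq_Rint _ _ (fun t => F t * g t + (- F x) * g t)); last first.
  move=> t /andP[xt ty]; rewrite -Ff//; first by ring.
  exact: le_trans yb.
rewrite !RintegralD//; try by [exact: intgZ|].
rewrite !RintegralZl// -Ff// -Gg// => h.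
lra.
Qed.

End Product.

(** * Primitives on the whole line and their derivatives almost everywhere *)

Section Weak.
Context {R : realType}.
Local Notation mu := (@lebesgue_measure R).
Implicit Types (f g h F G phi : R -> R) (a b c k x y r : R).

Definition primitive F f := forall a b, primitive_on a b F f.

Definition locint f := forall a b, intg f a b.

Lemma primitive_locint F f : primitive F f -> locint f.
Proof. by move=> pF a b; case: (pF a b). Qed.

Lemma primitiveB F f a b : primitive F f -> a <= b ->
  F b - F a = \int[mu]_(t in `[a, b]) f t.
Proof. by move=> pF ab; case: (pF a b) => _; exact. Qed.

Lemma locint_measurable f : locint f -> measurable_fun setT f.
Proof.
move=> fi.
have -> : setT = \bigcup_n (`[- n%:R, n%:R]%classic : set R).
  apply/seteqP; split=> // x _; exists (Num.bound `|x|) => //=.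
  have h := ltW (archi_boundP (normr_ge0 x)).
  by rewrite in_itv/= -ler_norml.
apply/measurable_fun_bigcup => // n.
by have := measurable_int _ (fi (- n%:R) n%:R) => /measurable_EFinP.
Qed.

Lemma compact_sub_itv (K : set R) : compact K -> exists M, K `<=` `[- M, M]%classic.
Proof.
move=> /compact_bounded[M [Mr HM]]; exists (M + 1) => x Kx /=.
by rewrite in_itv/= -ler_norml; apply: (HM (M + 1)) => //; rewrite ltrDl.
Qed.

Lemma locint_locally_integrable f : locint f -> locally_integrable setT f.
Proof.
move=> fi; split; [exact: locint_measurable|exact: openT|].
move=> K _ cK; have [M KM] := compact_sub_itv cK.
have mK : measurable K by apply: closed_measurable; exact: compact_closed.
have /integrableP[_] := integrableS (mu := mu) (measurable_itv _) mK KM (fi (- M) M).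
by [].
Qed.

Lemma primitive_lebesgue_pt F f x : primitive F f -> lebesgue_pt f x ->
  is_derive x 1 F (f x).
Proof.
move=> pF lx; have fi := primitive_locint pF.
have xx : x < x + 1 by rewrite ltrDl.
have [|d1 d2] := FTC1_lebesgue_pt xx (fi (x - 1) (x + 1)) _ lx.
  by rewrite /= lte_fin ltrBlDr ltrDl.
(* Near [x], [F] is a constant plus the integral from the fixed base point [x - 1], to which the
   Lebesgue form of the fundamental theorem applies. *)
pose I y := \int[mu]_(t in `[x - 1, y]) f t.
have dI : is_derive x 1 I (f x) by apply: DeriveDef => //; rewrite -d2 derive1E.
apply: (@near_eq_is_derive _ _ _ (fun y => F (x - 1) + I y)).
  near=> y; rewrite /I -(primitiveB pF); first by rewrite addrC subrK.
  by near: y; apply: lt_le_nbhsr; rewrite gtrBl.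
rewrite -[f x]add0r; exact: is_deriveD.
Unshelve. all: by end_near. Qed.

Lemma primitive_derive F f : primitive F f ->
  {ae mu, forall x, is_derive x 1 F (f x)}.
Proof.
move=> pF; have := lebesgue_differentiation (locint_locally_integrable (primitive_locint pF)).
apply: filterS; first exact: (ae_filter_ringOfSetsType mu).
by move=> x; exact: primitive_lebesgue_pt.
Qed.

Lemma primitive_ae_unique F f g : primitive F f -> primitive F g ->
  {ae mu, forall x, f x = g x}.
Proof.
move=> /primitive_derive dF /primitive_derive; apply: (filterS2 _ _ dF).
  exact: (ae_filter_ringOfSetsType mu).
by move=> x [_ <-] [_ <-].
Qed.

Lemma primitive_C1 F f : (forall x, is_derive x 1 F (f x)) -> continuous f ->
  primitive F f.
Proof.
move=> dF cf a b; split.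
  by apply: continuous_on_intg; exact: continuous_subspaceT.
move=> x y _ + _; rewrite le_eqVlt => /predU1P[->|xy].
  by rewrite subrr set_itv1 Rintegral_set1.
have cF : continuous F.
  by move=> z; apply/differentiable_continuous/derivable1_diffP; case: (dF z).
rewrite /Rintegral (@continuous_FTC2 _ f F x y)//.
- exact: continuous_subspaceT.
- split=> [z _| |]; first by case: (dF z).
  + by apply: cvg_at_right_filter; exact: cF.
  + by apply: cvg_at_left_filter; exact: cF.
- by move=> z _; rewrite derive1E; case: (dF z).
Qed.

End Weak.

(** * The du Bois-Reymond lemma and H^1 *)

Section DuBoisReymond.
Context {R : realType}.
Local Notation mu := (@lebesgue_measure R).
Implicit Types (f g h F G phi : R -> R) (a b c k x y r : R).

(** The average that defines a Lebesgue point runs over a ball of measure [2 r], which turns the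
    threshold [e / 2] into [e * r]. *)
Lemma lebesgue_pt_Rint h x e : locint h -> 0 < e -> lebesgue_pt h x ->
  \forall r \near (0:R)^'+, \int[mu]_(t in `[x - r, x + r]) `|h t - h x| <= e * r.
Proof.
move=> hi e0 /fine_cvgP[_ /cvgrPdist_le/(_ (e / 2))].
rewrite divr_gt0// => /(_ isT) H.
near=> r.
have r0 : 0 < r by near: r; exact: nbhs_right_gt.
have : `|0 - fine (davg h x r)| <= e / 2 by near: r; exact: H.
rewrite sub0r normrN /davg /iavg.
rewrite -[X in (X^-1)%E](_ : (2 * r)%:E = _); last first.
  by rewrite lebesgue_measure_ball ?(ltW r0)// mulr_natl.
have hxi : intg (fun t => `|h t - h x|) (x - r) (x + r).
  by apply: intg_norm; apply: intgD => //; exact: intg_cst.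
have -> : (\int[mu]_(y in ball x r) `|((center (h x) \o h) y)%:E|)%E =
    (\int[mu]_(t in `[x - r, x + r]) `|h t - h x|)%:E.
  rewrite /Rintegral fineK; last exact: integrable_fin_num.
  have mh : measurable_fun setT (fun t => `|h t - h x|).
    by apply: measurableT_comp => //; apply: measurable_funB => //; exact: locint_measurable.
  rewrite ball_itv -integral_itv_obnd_cbnd; last by apply: measurable_funTS; exact: measurableT_comp.
  by rewrite -integral_itv_bndo_bndc//; apply: measurable_funTS; exact: measurableT_comp.
rewrite inver mulf_eq0 pnatr_eq0/= gt_eqF//.
rewrite -EFinM/= normrM ger0_norm ?invr_ge0 ?mulr_ge0 ?(ltW r0)//.
rewrite ger0_norm ?Rintegral_ge0// ler_pdivrMl ?mulr_gt0// => /le_trans; apply.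
by rewrite le_eqVlt; apply/orP; left; apply/eqP; field.
Unshelve. all: by end_near. Qed.

(** This is [max 0 (1 - |t|)], written through absolute values so that it has an explicit
    primitive. *)
Definition tent (t : R) : R := (`|t + 1| - 2 * `|t| + `|t - 1|) / 2.

(** The odd primitive of [tent], obtained from [(t |t|)' = 2 |t|]. It is [C^1] and constant, equal
    to [-1/2] and [1/2], outside [[-1, 1]], so a difference of two translates is a test function. *)
Definition step (t : R) : R :=
  ((t + 1) * `|t + 1| - 2 * (t * `|t|) + (t - 1) * `|t - 1|) / 4.

Lemma is_derive_mul_norm (t : R) : is_derive t 1 (fun s : R => s * `|s|) (2 * `|t|).
Proof.
have [t0|t0|->] := ltgtP t 0.
- apply: (@near_eq_is_derive R R R (fun s : R => - (s ^+ 2))).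
    near=> s; rewrite ltr0_norm; first by rewrite mulrN expr2.
    by near: s; exact: lt_nbhsl.
  rewrite ltr0_norm// mulrN; apply: is_derive_eq.
  by rewrite /GRing.scale/= mulr1 mulr_natl mulr2n.
- apply: (@near_eq_is_derive R R R (fun s : R => s ^+ 2)).
    near=> s; rewrite gtr0_norm; first by rewrite expr2.
    by near: s; exact: lt_nbhsr.
  rewrite gtr0_norm//; apply: is_derive_eq.
  by rewrite /GRing.scale/= mulr1 mulr_natl mulr2n.
- rewrite normr0 mulr0.
  have H : h^-1 *: ((fun s : R => s * `|s|) (h *: 1 + 0) - 0 * `|0 : R|) @[h --> (0:R)^'] --> (0:R).
    apply: (@cvg_trans _ (`|h| @[h --> (0:R)^'])).
      apply: near_eq_cvg; near=> h.
      rewrite mul0r subr0 addr0 /GRing.scale/= mulr1 mulrA mulVf ?mul1r//.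
      by near: h; exact: nbhs_dnbhs_neq.
    have : `|h| @[h --> (0:R)^'] --> `|0 : R|.
      by apply: cvg_norm; apply: cvg_within_filter; exact: cvg_id.
    by rewrite normr0.
  apply: DeriveDef; first by apply/cvg_ex; exists 0.
  exact: (cvg_lim _ H).
Unshelve. all: by end_near. Qed.

Lemma is_derive_step (t : R) : is_derive t 1 step (tent t).
Proof.
have shift c : is_derive t 1 (fun s : R => s + c) 1.
  by have := is_deriveD (is_derive_id t 1) (is_derive_cst c t 1); rewrite addr0.
have d c : is_derive t 1 (fun s : R => (s + c) * `|s + c|) (2 * `|t + c|).
  have := @is_derive1_comp R (fun s => s * `|s|) (fun s => s + c) t _ _ (is_derive_mul_norm (t + c)) (shift c).
  by rewrite mulr1.
have Z k f df : is_derive t 1 f df -> is_derive t 1 (fun s : R => k * f s) (k * df).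
  by move=> hf; have := is_deriveZ k hf.
have -> : tent t = 4^-1 * (2 * `|t + 1| + (-2) * (2 * `|t|) + 2 * `|t - 1|).
  by rewrite /tent; field.
have -> : step = fun t => 4^-1 * ((t + 1) * `|t + 1| + (-2) * (t * `|t|) + (t - 1) * `|t - 1|).
  by apply/funext => s; rewrite /step; field.
exact: (Z _ _ _ (is_deriveD (is_deriveD (d 1) (Z _ _ _ (is_derive_mul_norm t))) (d (-1)))).
Qed.

Lemma tent_out (t : R) : 1 <= `|t| -> tent t = 0.
Proof.
rewrite ler_normr /tent => /orP[h|h].
- by rewrite !ger0_norm; lra.
- by rewrite !ler0_norm; lra.
Qed.

Lemma tent_ge0 (t : R) : 0 <= tent t.
Proof.
rewrite /tent; have := ler_normD (t + 1) (t - 1).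
have -> : t + 1 + (t - 1) = 2 * t by ring.
rewrite normrM ger0_norm//; lra.
Qed.

Lemma tent_le1 (t : R) : tent t <= 1.
Proof.
rewrite /tent; have := ler_normD t 1; have := ler_normB t 1; rewrite normr1; lra.
Qed.

Lemma stepN (t : R) : t <= -1 -> step t = -2^-1.
Proof. by move=> h; rewrite /step !ler0_norm; try lra; field. Qed.

Lemma stepP (t : R) : 1 <= t -> step t = 2^-1.
Proof. by move=> h; rewrite /step !ger0_norm; try lra; field. Qed.

Lemma continuous_tent : continuous tent.
Proof.
move=> t; rewrite /tent; apply: cvgMl; apply: cvgD; first apply: cvgB.
- by apply: cvg_norm; apply: cvgD; [exact: cvg_id|exact: cvg_cst].
- by apply: cvgMr; apply: cvg_norm; exact: cvg_id.
- by apply: cvg_norm; apply: cvgB; [exact: cvg_id|exact: cvg_cst].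
Qed.


Definition rweak f g := forall phi, test_function phi ->
  \int[mu]_x (f x * derive1 phi x) = - \int[mu]_x (g x * phi x).

Lemma Rint_support f a b : (forall x, ~~ (a <= x <= b) -> f x = 0) ->
  \int[mu]_x f x = \int[mu]_(x in `[a, b]) f x.
Proof.
move=> f0; rewrite [RHS]Rintegral_mkcond; apply: eq_Rintegral => x _.
by rewrite patchE mem_setE in_itv/=; case: ifPn => // /f0.
Qed.

Lemma test_function_support phi : test_function phi ->
  exists M, 0 <= M /\ forall x, ~~ (- M <= x <= M) -> phi x = 0 /\ derive1 phi x = 0.
Proof.
move=> [d c [M HM]]; exists (Num.max 0 M); split; first by rewrite le_max lexx.
move=> x; rewrite -ler_norml -ltNge gt_max => /andP[_ Mx]; split; first exact: HM.
have : is_derive x 1 phi 0.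
  apply: (@near_eq_is_derive R R R (cst 0)).
  have cn : `|y| @[y --> x] --> `|x| by apply: cvg_norm; exact: cvg_id.
  by near=> y; rewrite HM//; near: y; move/cvgr_gt : cn; apply.
by move=> [_]; rewrite derive1E.
Unshelve. all: by end_near. Qed.

Lemma test_function_continuous phi : test_function phi -> continuous phi.
Proof.
by move=> [d _ _] x; apply/differentiable_continuous/derivable1_diffP.
Qed.

Lemma test_function_primitive phi : test_function phi -> primitive phi (derive1 phi).
Proof.
move=> [d c _]; apply: primitive_C1 => // x; rewrite derive1E; exact/derivableP.
Qed.

Lemma primitive_rweak F g : primitive F g -> rweak F g.
Proof.
move=> pF phi tphi; have [M [M0 HM]] := test_function_support tphi.
have NM : - (M + 1) <= M + 1 by lra.
have out x : ~~ (- (M + 1) <= x <= M + 1) -> ~~ (- M <= x <= M).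
  by apply: contra => /andP[? ?]; apply/andP; split; lra.
rewrite (@Rint_support _ (- (M + 1)) (M + 1)); last by move=> x /out/HM[_ ->]; rewrite mulr0.
rewrite [in RHS](@Rint_support _ (- (M + 1)) (M + 1)); last by move=> x /out/HM[-> _]; rewrite mulr0.
have pp := test_function_primitive tphi.
have [] := primitive_onM (pF (- (M + 1)) (M + 1)) (pp (- (M + 1)) (M + 1)).
move=> _ /(_ _ _ (lexx _) NM (lexx _)).
have [-> _] : phi (M + 1) = 0 /\ derive1 phi (M + 1) = 0 by apply: HM; apply/negP => /andP[? ?]; lra.
have [-> _] : phi (- (M + 1)) = 0 /\ derive1 phi (- (M + 1)) = 0 by apply: HM; apply/negP => /andP[? ?]; lra.
rewrite !mulr0 subrr RintegralD//.
- by move=> /eqP; rewrite eq_sym addrC addr_eq0 => /eqP.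
- apply: intg_mulr; last exact: (primitive_locint pF).
  by apply: continuous_subspaceT; exact: test_function_continuous.
- have cF := primitive_on_continuous NM (pF _ _).
  by apply: continuous_on_intg => x; apply: continuousM; [exact: cF|apply: continuous_subspaceT; case: tphi].
Qed.

Lemma ae_exists (P : R -> Prop) : {ae mu, forall x, P x} -> exists x, P x.
Proof.
move=> aeP; apply: contrapT => nP.
have : mu.-negligible setT.
  apply: negligibleS aeP => x _ /= Px; apply: nP; by exists x.
move=> nT; have : mu.-negligible (`[0, 1]%classic : set R) by exact: negligibleS nT.
move=> /negligibleP => /(_ (measurable_itv _)) /=.
by rewrite lebesgue_measure_itv/= lte_fin ltr01 oppr0 adde0 => /eqP; rewrite eqe oner_eq0.
Qed.

Definition bump x r (t : R) := tent ((t - x) / r) / r.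

Lemma is_derive_scaled_step x r (t : R) :
  is_derive t 1 (fun s : R => step ((s - x) / r)) (bump x r t).
Proof.
have aff : is_derive t 1 (fun s : R => (s - x) / r) (r^-1).
  have := is_deriveZ r^-1 (is_deriveB (is_derive_id t (1:R)) (is_derive_cst x t 1)).
  rewrite subr0 /GRing.scale/= mulr1; apply: near_eq_is_derive.
  by near=> s; rewrite mulrC.
exact: (@is_derive1_comp R step (fun s => (s - x) / r) t _ _ (is_derive_step _) aff).
Unshelve. all: by end_near. Qed.

Lemma continuous_bump x r : continuous (bump x r).
Proof.
move=> t; apply: cvgMl.
apply: (@continuous_comp _ _ _ (fun t => (t - x) / r) tent); last exact: continuous_tent.
by apply: cvgMl; apply: cvgB; [exact: cvg_id|exact: cvg_cst].
Qed.

Lemma bump_out x r (t : R) : 0 < r -> ~~ (x - r <= t <= x + r) -> bump x r t = 0.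
Proof.
move=> r0 h; rewrite /bump tent_out ?mul0r// normf_div (gtr0_norm r0).
rewrite ler_pdivlMr// mul1r leNgt; apply: contra h.
by rewrite ltr_distl => /andP[/ltW -> /ltW ->].
Qed.

Lemma bump_ge0 x r (t : R) : 0 < r -> 0 <= bump x r t.
Proof. by move=> r0; rewrite divr_ge0 ?tent_ge0// ltW. Qed.

Lemma bump_le x r (t : R) : 0 < r -> bump x r t <= r^-1.
Proof. by move=> r0; rewrite ler_piMl ?tent_le1// invr_ge0 ltW. Qed.

Lemma bump_mass x r : 0 < r -> \int[mu]_(t in `[x - r, x + r]) bump x r t = 1.
Proof.
move=> r0; have pS := primitive_C1 (is_derive_scaled_step x r) (@continuous_bump x r).
rewrite -(primitiveB pS); last lra.
have -> : (x + r - x) / r = 1 by field; rewrite gt_eqF.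
have -> : (x - r - x) / r = -1 by field; rewrite gt_eqF.
by rewrite stepP// stepN//; field.
Qed.

(** Two bumps of equal mass differ by a function of mean zero, whose primitive is compactly
    supported. The same width [r] is used at [x] and [y]. *)
Lemma bump_test x y r : 0 < r ->
  let phi t := step ((t - x) / r) - step ((t - y) / r) in
  test_function phi /\ derive1 phi = fun t => bump x r t - bump y r t.
Proof.
move=> r0 phi.
have dd (t : R) : is_derive t 1 phi (bump x r t - bump y r t).
  exact: (is_deriveB (is_derive_scaled_step x r t) (is_derive_scaled_step y r t)).
have dE : derive1 phi = fun t => bump x r t - bump y r t.
  by apply/funext => t; rewrite derive1E; case: (dd t).
split=> //; split.
- by move=> t; case: (dd t).
- by rewrite dE => t; apply: cvgB; exact: continuous_bump.
- exists (`|x| + `|y| + r) => t; rewrite ltr_normr /phi.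
  have := ler_norm x; have := ler_norm y; have := ler_norm (- x); have := ler_norm (- y); rewrite !normrN.
  have := normr_ge0 x; have := normr_ge0 y.
  move=> ? ? ? ? ? ? /orP[h|h].
  + by rewrite !stepP ?subrr// ler_pdivlMr ?mul1r//; lra.
  + by rewrite !stepN ?subrr// ler_pdivrMr ?mulN1r//; lra.
Qed.

(** The bump has mass 1 and height at most [1 / r], so the weighted mean differs from [h x] by at
    most [1 / r] times the integral of [|h - h x|]. *)
Lemma bump_mean_near h x r e : locint h -> 0 < r ->
  \int[mu]_(t in `[x - r, x + r]) `|h t - h x| <= e * r ->
  `| \int[mu]_t (h t * bump x r t) - h x | <= e.
Proof.
move=> hi r0 he.
rewrite (@Rint_support _ (x - r) (x + r)); last by move=> t /(bump_out r0) ->; rewrite mulr0.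
have cb : {within `[x - r, x + r], continuous (bump x r)}.
  by apply: continuous_subspaceT; exact: continuous_bump.
have -> : h x = h x * \int[mu]_(t in `[x - r, x + r]) bump x r t by rewrite bump_mass// mulr1.
have bi := continuous_on_intg cb.
rewrite -RintegralZl// -RintegralB//; [|exact: intg_mulr|exact: intgZ].
have hxi : intg (fun t => h t - h x) (x - r) (x + r).
  by apply: intgD => //; exact: intg_cst.
rewrite (@eq_Rint _ _ (fun t => (h t - h x) * bump x r t)); last by move=> t _; ring.
have hbi := intg_mulr cb hxi.
apply: le_trans (le_normr_Rintegral _ hbi) _ => //.
apply: (@le_trans _ _ (\int[mu]_(t in `[x - r, x + r]) (r^-1 * `|h t - h x|))).
  apply: le_Rint; [exact: intg_norm|by apply: intgZ; exact: intg_norm|].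
  move=> t _; rewrite normrM mulrC ler_wpM2r//.
  by rewrite ger0_norm ?bump_ge0// bump_le.
rewrite RintegralZl//; last exact: intg_norm.
by rewrite mulrC ler_pdivrMr.
Qed.

(** Testing against the primitive of a difference of bumps shows that the means of [h] near any two
    points agree. At Lebesgue points [x] and [y] these means approximate [h x] and [h y], so one
    fixed Lebesgue point [y] supplies the constant. *)
Lemma weak_derivative0_cst h : locint h ->
  (forall phi, test_function phi -> \int[mu]_x (h x * derive1 phi x) = 0) ->
  exists c, {ae mu, forall x, h x = c}.
Proof.
move=> hi H; have aeL := lebesgue_differentiation (locint_locally_integrable hi).
have [y Ly] := ae_exists aeL; exists (h y).
apply: filterS aeL; first exact: (ae_filter_ringOfSetsType mu).
move=> x Lx; apply/eqP; rewrite -subr_eq0 -normr_le0; apply/ler_addgt0Pl => e e0.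
rewrite addr0.
have e20 : 0 < e / 2 by rewrite divr_gt0.
have Fr : ProperFilter ((0:R)^'+) by exact: at_right_proper_filter.
have [r [[r0 hx] hy]] := filter_ex (filterI (filterI (nbhs_right_gt (0:R))
  (lebesgue_pt_Rint hi e20 Lx)) (lebesgue_pt_Rint hi e20 Ly)).
have [tphi dphi] := bump_test x y r0.
have := H _ tphi; rewrite dphi => H0.
have mean0 : \int[mu]_t (h t * bump x r t) = \int[mu]_t (h t * bump y r t).
  pose N := `|x| + `|y| + r.
  have out z t : `|z| + r <= N -> ~~ (- N <= t <= N) -> bump z r t = 0.
    move=> zN tN; apply: bump_out => //; apply: contra tN => /andP[h1 h2].
    by have := ler_norm z; have := ler_norm (- z); rewrite normrN => ? ?; apply/andP; split; lra.
  have xN : `|x| + r <= N by rewrite /N; have := normr_ge0 y; lra.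
  have yN : `|y| + r <= N by rewrite /N; have := normr_ge0 x; lra.
  rewrite (@Rint_support _ (- N) N); last by move=> t tN; rewrite (out x)// mulr0.
  rewrite [RHS](@Rint_support _ (- N) N); last by move=> t tN; rewrite (out y)// mulr0.
  apply/eqP; rewrite -subr_eq0 -RintegralB//; last 2 first.
  - by apply: intg_mulr => //; apply: continuous_subspaceT; exact: continuous_bump.
  - by apply: intg_mulr => //; apply: continuous_subspaceT; exact: continuous_bump.
  apply/eqP; rewrite -[RHS]H0 [RHS](@Rint_support _ (- N) N).
    by apply: eq_Rint => t _; ring.
  by move=> t tN; rewrite (out x)// (out y)// subrr mulr0.
have := bump_mean_near hi r0 hx; have := bump_mean_near hi r0 hy.
rewrite mean0 distrC => A1 A2; have := ler_normD (h x - \int[mu]_t (h t * bump y r t)) (\int[mu]_t (h t * bump y r t) - h y).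
rewrite addrA subrK; rewrite distrC in A2; rewrite distrC in A1; lra.
Qed.

End DuBoisReymond.

(** * Weak derivatives in L^2 and continuous representatives *)

Section Sobolev.
Local Open Scope complex_scope.
Context {R : realType}.
Local Notation mu := (@lebesgue_measure R).
Local Notation Re := (@complex.Re R).
Local Notation Im := (@complex.Im R).
Implicit Types (f g h F G phi : R -> R) (a b c k x y r : R).
Implicit Types (p q P Q : R -> R[i]).

Lemma Lfun2P f : f \in Lfun mu 2%:E <->
  measurable_fun setT f /\ mu.-integrable setT (EFin \o (fun x => f x ^+ 2)).
Proof.
split=> [lf|[mf fi]].
  split; last exact: Lfun2_integrable_sqr.
  by move: lf; rewrite inE => /andP[/[!inE]].
rewrite inE; apply/andP; split; rewrite inE//= /finite_norm.
rewrite unlock /Lnorm poweR_lty//=.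
move: fi => /integrableP[_]; apply: le_lt_trans.
rewrite le_eqVlt; apply/orP; left; apply/eqP; apply: eq_integral => x _ /=.
by rewrite powR_mulrn// normrX.
Qed.

Lemma Lfun2_locint f : f \in Lfun mu 2%:E -> locint f.
Proof.
move=> /Lfun2P[mf fi] a b.
apply: (@le_integrable _ _ _ mu _ _ _ (EFin \o (fun x => 1 + f x ^+ 2))) => //.
- by apply/measurable_EFinP; exact: measurable_funTS.
- move=> x _ /=; rewrite lee_fin [leRHS]ger0_norm; last by rewrite addr_ge0// sqr_ge0.
  have := sqr_ge0 (`|f x| - 1); rewrite sqrrB1 real_normK ?num_real//.
  have := sqr_ge0 (f x); lra.
- apply: intgD; first exact: intg_cst.
  exact: integrableS fi.
Qed.

Lemma Rint_ae f g a b : locint f -> locint g -> {ae mu, forall x, f x = g x} ->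
  \int[mu]_(t in `[a, b]) f t = \int[mu]_(t in `[a, b]) g t.
Proof.
move=> /(_ a b) fi /(_ a b) gi fg; rewrite /Rintegral; congr fine; apply: ae_eq_integral => //.
- exact: measurable_int fi.
- exact: measurable_int gi.
- apply: filterS fg; first exact: (ae_filter_ringOfSetsType mu).
  by move=> x -> _.
Qed.

Lemma primitive_ae F f g : locint g -> {ae mu, forall x, f x = g x} ->
  primitive F f -> primitive F g.
Proof.
move=> gi fg pF a b; split; first exact: gi.
move=> x y _ xy _; rewrite (primitiveB pF xy); apply: Rint_ae => //.
exact: primitive_locint pF.
Qed.

Lemma primitiveD F G f g : primitive F f -> primitive G g ->
  primitive (fun x => F x + G x) (fun x => f x + g x).
Proof. by move=> pF pG a b; exact: primitive_onD. Qed.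

Lemma primitiveZ k F f : primitive F f ->
  primitive (fun x => k * F x) (fun x => k * f x).
Proof. by move=> pF a b; exact: primitive_onZ. Qed.

Lemma primitiveM F G f g : primitive F f -> primitive G g ->
  primitive (fun x => F x * G x) (fun x => f x * G x + F x * g x).
Proof. by move=> pF pG a b; exact: primitive_onM. Qed.

Lemma primitive_cst k : primitive (fun=> k) (fun=> 0).
Proof. by move=> a b; exact: primitive_on_cst. Qed.

Lemma primitive_continuous F f : primitive F f -> continuous F.
Proof.
move=> pF x; have h : x - 1 < x + 1 by lra.
have := primitive_on_continuous (ltW h) (pF (x - 1) (x + 1)).
move=> /(continuous_within_itvP _ h)[+ _ _]; apply.
by rewrite in_itv/=; apply/andP; split; lra.
Qed.

Lemma continuous_locint F : continuous F -> locint F.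
Proof. by move=> cF a b; apply: continuous_on_intg; exact: continuous_subspaceT. Qed.

Lemma primitive_exists f : locint f -> exists F, primitive F f.
Proof.
move=> fi.
pose F x : R := if 0 <= x then \int[mu]_(t in `[0, x]) f t
                else - \int[mu]_(t in `[x, 0]) f t.
exists F => a b; split; first exact: fi.
move=> x y _ xy _; rewrite /F; case: ifPn => [y0|]; last rewrite -ltNge => y0.
  case: ifPn => [x0|]; last rewrite -ltNge => x0.
    by rewrite (Rint_split x0 xy (fi 0 y)) addrAC subrr add0r.
  by rewrite opprK (Rint_split (ltW x0) y0 (fi x y)) addrC.
rewrite leNgt (le_lt_trans xy y0)/=.
by rewrite (Rint_split xy (ltW y0) (fi x 0)); ring.
Qed.

Lemma Rint_test_ae f g phi : locint f -> locint g -> {ae mu, forall x, f x = g x} ->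
  continuous phi -> (exists M, forall x, ~~ (- M <= x <= M) -> phi x = 0) ->
  \int[mu]_x (f x * phi x) = \int[mu]_x (g x * phi x).
Proof.
move=> fi gi fg cphi [M HM].
have cs a b : {within `[a, b], continuous phi} by exact: continuous_subspaceT.
rewrite (@Rint_support _ _ (- M) M); last by move=> x /HM ->; rewrite mulr0.
rewrite [RHS](@Rint_support _ _ (- M) M); last by move=> x /HM ->; rewrite mulr0.
apply: Rint_ae; try by move=> a b; apply: intg_mulr.
by apply: filterS fg; [exact: (ae_filter_ringOfSetsType mu)|move=> x ->].
Qed.

Lemma rweak_ae f1 f2 g1 g2 : locint f1 -> locint f2 -> locint g1 -> locint g2 ->
  {ae mu, forall x, f1 x = f2 x} -> {ae mu, forall x, g1 x = g2 x} ->
  rweak f1 g1 -> rweak f2 g2.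
Proof.
move=> if1 if2 ig1 ig2 f12 g12 w phi tphi; have [M [M0 HM]] := test_function_support tphi.
rewrite -(Rint_test_ae if1 if2 f12); first last.
- by exists M => x /HM[].
- by case: tphi.
rewrite w//; congr (- _); apply: Rint_test_ae => //.
- exact: test_function_continuous.
- by exists M => x /HM[].
Qed.

(** If [G] is any primitive of [g], then [f - G] has weak derivative zero and is constant almost
    everywhere; adding this constant to [G] gives [F]. *)
Lemma rweak_primitive f g : locint f -> locint g -> rweak f g ->
  exists F, primitive F g /\ {ae mu, forall x, f x = F x}.
Proof.
move=> fi gi w; have [G pG] := primitive_exists gi.
have cG := primitive_continuous pG.
have Gi := continuous_locint cG.
have hi : locint (fun x => f x + (-1) * G x) by move=> a b; apply: intgD => //; exact: intgZ.
have [phi tphi|c hc] := weak_derivative0_cst hi.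
  have [M [M0 HM]] := test_function_support tphi.
  have := w _ tphi; rewrite -(primitive_rweak pG tphi).
  rewrite (@Rint_support _ _ (- M) M); last by move=> x /HM[_ ->]; rewrite mulr0.
  rewrite (@Rint_support _ (fun x => G x * _) (- M) M); last by move=> x /HM[_ ->]; rewrite mulr0.
  rewrite (@Rint_support _ (fun x => (f x + _) * _) (- M) M); last by move=> x /HM[_ ->]; rewrite mulr0.
  have cd a b : {within `[a, b], continuous (derive1 phi)}.
    by apply: continuous_subspaceT; case: tphi.
  move=> /eqP; rewrite -subr_eq0 -RintegralB//; try exact: intg_mulr.
  by move=> /eqP h; rewrite -[RHS]h; apply: eq_Rint => x _; ring.
exists (fun x => c + G x); split.
  apply: (@primitive_ae _ (fun x => 0 + g x)) => //.
    by apply: aeW => x; rewrite add0r.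
  by apply: primitiveD => //; exact: primitive_cst.
apply: filterS hc; first exact: (ae_filter_ringOfSetsType mu).
by move=> x <-; ring.
Qed.

Lemma weak_derivativeE p q : weak_derivative p q <->
  rweak (Re \o p) (Re \o q) /\ rweak (Im \o p) (Im \o q).
Proof.
have E (s : R -> R[i]) (phi : R -> R) : complex_integral (fun x => s x * (phi x)%:C) =
  (\int[mu]_x (Re (s x) * phi x)) +i* (\int[mu]_x (Im (s x) * phi x)).
  rewrite /complex_integral; congr (_ +i* _); apply: eq_Rintegral => x _;
    by case: (s x) => u v /=; rewrite mulr0 ?subr0 ?add0r.
split=> [w|[w1 w2] phi tphi].
  by split=> phi tphi; have := w phi tphi; rewrite !E => -[].
by rewrite !E; have := w1 phi tphi; have := w2 phi tphi => /= -> ->.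
Qed.

Definition cprimitive P q := primitive (Re \o P) (Re \o q) /\ primitive (Im \o P) (Im \o q).

Lemma L2_locint p : L2 p -> locint (Re \o p) /\ locint (Im \o p).
Proof. by move=> [h1 h2]; split; exact: Lfun2_locint. Qed.

Lemma complex_ae p q : {ae mu, forall x, p x = q x} ->
  {ae mu, forall x, (Re \o p) x = (Re \o q) x} /\ {ae mu, forall x, (Im \o p) x = (Im \o q) x}.
Proof.
by move=> pq; split; apply: filterS pq; try exact: (ae_filter_ringOfSetsType mu);
  move=> x /= ->.
Qed.

Lemma ae_complex p q :
  {ae mu, forall x, (Re \o p) x = (Re \o q) x} -> {ae mu, forall x, (Im \o p) x = (Im \o q) x} ->
  {ae mu, forall x, p x = q x}.
Proof.
move=> h; apply: filterS2 h; first exact: (ae_filter_ringOfSetsType mu).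
by move=> x /=; case: (p x) (q x) => [? ?] [? ?] /= -> ->.
Qed.

Lemma weak_derivative_cprimitive p q : L2 p -> L2 q -> weak_derivative p q ->
  exists P, cprimitive P q /\ {ae mu, forall x, p x = P x}.
Proof.
move=> /L2_locint[p1 p2] /L2_locint[q1 q2] /weak_derivativeE[w1 w2].
have [F [pF aF]] := rweak_primitive p1 q1 w1.
have [G [pG aG]] := rweak_primitive p2 q2 w2.
exists (fun x => F x +i* G x); split=> //.
exact: ae_complex.
Qed.

Lemma cprimitive_weak_derivative p q P : L2 p -> L2 q -> cprimitive P q ->
  {ae mu, forall x, p x = P x} -> weak_derivative p q.
Proof.
move=> /L2_locint[p1 p2] /L2_locint[q1 q2] [P1 P2] /complex_ae[a1 a2].
have aeC (f g : R -> R) : {ae mu, forall x, f x = g x} -> {ae mu, forall x, g x = f x}.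
  by apply: filterS => [|x ->//]; exact: (ae_filter_ringOfSetsType mu).
by apply/weak_derivativeE; split; [apply: rweak_ae (primitive_rweak P1)|apply: rweak_ae (primitive_rweak P2)] => //;
  try exact: aeC; try (by apply: aeW); apply: continuous_locint; apply: primitive_continuous; eassumption.
Qed.

Lemma wderivP p : H1 p -> L2 (wderiv p) /\ weak_derivative p (wderiv p).
Proof.
by move=> [_ e]; exact: (xgetPex (fun=> 0) (P := [set g | L2 g /\ weak_derivative p g]) e).
Qed.

Lemma H1_cprimitive p : H1 p -> exists P, cprimitive P (wderiv p) /\ {ae mu, forall x, p x = P x}.
Proof.
by move=> hp; have [l w] := wderivP hp; apply: weak_derivative_cprimitive => //; case: hp.
Qed.

Lemma cprimitive_ae_unique P p q : cprimitive P p -> cprimitive P q -> {ae mu, forall x, p x = q x}.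
Proof. by move=> [h1 h2] [k1 k2]; apply: ae_complex; apply: primitive_ae_unique; eassumption. Qed.

(** A function that is null almost everywhere has the constant 0 as a primitive, and every point is
    a Lebesgue point of a continuous function; hence [F x] is the derivative of a constant. *)
Lemma continuous_ae0 F : continuous F -> {ae mu, forall x, F x = 0} -> forall x, F x = 0.
Proof.
move=> cF F0 x; have Fi := continuous_locint cF.
have p0 : primitive (fun=> 0 : R) F.
  apply: (primitive_ae _ _ (primitive_cst 0)) => //.
  by apply: filterS F0 => [|y ->//]; exact: (ae_filter_ringOfSetsType mu).
have Lx : lebesgue_pt F x.
  apply: (@continuous_lebesgue_pt _ _ _ setT) => //; last exact: cF.
    by split => //; exact: openT.
  exact: locint_measurable.
have [_ <-] := primitive_lebesgue_pt p0 Lx.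
exact: derive_cst.
Qed.

Lemma continuous_ae_eq F G : continuous F -> continuous G ->
  {ae mu, forall x, F x = G x} -> F =1 G.
Proof.
move=> cF cG FG x; apply/eqP; rewrite -subr_eq0; apply/eqP.
apply: (@continuous_ae0 (fun x => F x - G x)) => [y|].
  by apply: cvgB; [exact: cF|exact: cG].
by apply: filterS FG; [exact: (ae_filter_ringOfSetsType mu)|move=> y ->; rewrite subrr].
Qed.

(** [wderiv] is a choice and has to be identified. Its primitive and [P] are continuous and both
    agree with [p] almost everywhere, so they coincide, and derivatives of one primitive are unique
    up to a null set. *)
Lemma cprimitive_wderiv p q P : L2 p -> L2 q -> cprimitive P q ->
  {ae mu, forall x, p x = P x} -> H1 p /\ {ae mu, forall x, wderiv p x = q x}.
Proof.
move=> lp lq pP aP; have hp : H1 p.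
  by split=> //; exists q; split=> //; exact: cprimitive_weak_derivative pP aP.
split=> //.
have [P' [pP' aP']] := H1_cprimitive hp.
have [a1 a2] : {ae mu, forall x, (Re \o P) x = (Re \o P') x} /\ {ae mu, forall x, (Im \o P) x = (Im \o P') x}.
  apply: complex_ae; apply: (filterS2 (ae_filter_ringOfSetsType mu) _ aP aP').
  by move=> x ->.
have PP' : P = P'.
  move: pP pP' => [h1 h2] [k1 k2]; apply/funext => x.
  have := continuous_ae_eq (primitive_continuous h1) (primitive_continuous k1) a1 x.
  have := continuous_ae_eq (primitive_continuous h2) (primitive_continuous k2) a2 x.
  by move=> /=; case: (P x) (P' x) => [? ?] [? ?] /= -> ->.
by apply: (cprimitive_ae_unique pP'); rewrite -PP'.
Qed.

End Sobolev.

(** * Linear differential equations *)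

Section LinearODE.
Context {R : realType}.
Local Notation mu := (@lebesgue_measure R).
Implicit Types (f g h F G : R -> R) (a b c k x y r : R).

Lemma Rint_dominated (u : nat -> R -> R) (v g : R -> R) a b :
  (forall n, intg (u n) a b) -> intg g a b ->
  (forall n x, a <= x <= b -> `|u n x| <= g x) ->
  (forall x, a <= x <= b -> u n x @[n --> \oo] --> v x) ->
  intg v a b /\ \int[mu]_(t in `[a, b]) u n t @[n --> \oo] --> \int[mu]_(t in `[a, b]) v t.
Proof.
move=> ui gi ug uv.
have mu_ n : measurable_fun `[a, b] (u n) by have /measurable_EFinP := measurable_int _ (ui n).
have mv : measurable_fun `[a, b] v.
  by apply: (measurable_fun_cvg mu_) => x; rewrite /= in_itv/= => /uv.
have [||||vi _ C] := @dominated_convergence _ _ _ mu _ (measurable_itv `[a, b])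
  (fun n => EFin \o u n) (EFin \o v) (EFin \o g) _ _ _ gi _.
- by move=> n; apply/measurable_EFinP; exact: mu_.
- exact/measurable_EFinP.
- apply: aeW => x; rewrite /= in_itv/= => /uv h; apply: cvg_EFin => //; exact: nearW.
- by apply: aeW => x n /=; rewrite in_itv/= => /ug; rewrite lee_fin.
split=> //; apply: (@fine_cvg R _ \oo) => /=.
by rewrite fineK//; exact: integrable_fin_num.
Qed.

Lemma geometric_cvg (u : nat -> R) (C : R) :
  (forall n, `|u n.+1 - u n| <= C / 2 ^+ n) -> cvgn u.
Proof.
move=> uC.
have -> : u = (fun n => u 0%N + series (telescope u) n) by apply/funext => n; exact: eq_sum_telescope.
apply: is_cvgD; first exact: is_cvg_cst.
apply: normed_cvg; apply: (@series_le_cvg _ _ (geometric C (2^-1))) => //.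
- by move=> n /=.
- by move=> n; rewrite /geometric /= exprVn; apply: le_trans (uC n).
- by move=> n; rewrite /geometric /= exprVn; exact: uC.
- by apply: is_cvg_geometric_series; rewrite ger0_norm// invf_lt1// ltr1n.
Qed.

Lemma intg_sum (I : finType) (f : I -> R -> R) a b :
  (forall i, intg (f i) a b) -> intg (fun x => \sum_i f i x) a b.
Proof.
move=> fi; elim: (index_enum I) => [|i s IH].
  by apply: (eq_intg _ (intg_cst a b 0)) => x _; rewrite big_nil.
by apply: (eq_intg _ (intgD (fi i) IH)) => x _; rewrite big_cons.
Qed.

Lemma cvgn_sum (I : finType) (u : I -> nat -> R) (l : I -> R) :
  (forall i, u i n @[n --> \oo] --> l i) ->
  \sum_i u i n @[n --> \oo] --> \sum_i l i.
Proof.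
move=> ul; elim: (index_enum I) => [|i s IH].
  by rewrite big_nil; under eq_fun do rewrite big_nil; exact: cvg_cst.
by rewrite big_cons; under eq_fun do rewrite big_cons; exact: cvgD.
Qed.

Lemma Rint_expR a x (L : R) : 0 < L -> a <= x ->
  \int[mu]_(t in `[a, x]) expR (L * (t - a)) <= expR (L * (x - a)) / L.
Proof.
move=> L0 ax.
have d (t : R) : is_derive t 1 (fun s : R => L^-1 * expR (L * (s - a))) (expR (L * (t - a))).
  have d1 : is_derive t 1 (fun s : R => L * (s - a)) L.
    have := is_deriveZ L (is_deriveB (is_derive_id t (1:R)) (is_derive_cst a t 1)).
    by rewrite subr0 /GRing.scale/= mulr1.
  have := is_deriveZ L^-1 (@is_derive1_comp R expR (fun s => L * (s - a)) t _ _ (is_derive_expR (L * (t - a))) d1).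
  by rewrite /GRing.scale/= mulrCA mulVf ?gt_eqF// mulr1.
have c : continuous (fun s : R => expR (L * (s - a))).
  move=> t; apply: continuous_comp; last exact: continuous_expR.
  by apply: cvgMr; apply: cvgB; [exact: cvg_id|exact: cvg_cst].
rewrite -(primitiveB (primitive_C1 d c) ax) [leRHS]mulrC.
by rewrite lerBlDr lerDl mulr_ge0 ?invr_ge0 ?expR_ge0// ltW.
Qed.

(** * Picard iteration in an exponentially weighted norm *)

Section Picard.
Variables (I : finType) (A : I -> I -> R -> R) (K a b : R) (w0 : I -> R) (f : I -> R -> R).
Hypotheses (ab : a <= b) (K0 : 0 <= K).
Hypothesis cA : forall i j, {within `[a, b], continuous (A i j)}.
Hypothesis AK : forall i j x, a <= x <= b -> `|A i j x| <= K.
Hypothesis fi : forall i, intg (f i) a b.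

Let g i x := w0 i + \int[mu]_(t in `[a, x]) f i t.

Fixpoint picard n i x : R :=
  if n is m.+1 then g i x + \int[mu]_(t in `[a, x]) \sum_j A i j t * picard m j t
  else g i x.

Let gP i : primitive_on a b (g i) (f i).
Proof.
have := primitive_onD (primitive_on_cst a b (w0 i)) (primitive_on_integral (fi i)).
by apply: eq_primitive_on => x _ //; rewrite add0r.
Qed.

Let intg_Asum (w : I -> R -> R) i : (forall j, {within `[a, b], continuous (w j)}) ->
  intg (fun t => \sum_j A i j t * w j t) a b.
Proof.
by move=> cw; apply: intg_sum => j; apply: intg_mulr => //; exact: continuous_on_intg.
Qed.

Let picard_cont n : forall i, {within `[a, b], continuous (picard n i)}.
Proof.
elim: n => [|n IH] i; first exact: primitive_on_continuous (gP i).
apply: (primitive_on_continuous ab).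
exact: primitive_onD (gP i) (primitive_on_integral (intg_Asum i IH)).
Qed.

Let N := #|I|%:R * K.
(** The weight [E] grows at rate [L], so its integral from [a] to [x] is at most [E x / L]; since
    [N / L <= 1 / 2], the integral operator halves the weighted norm on all of [[a, b]], whatever
    its length. *)
Let L := 2 * (N + 1).
Let E x := expR (L * (x - a)).

Let N0 : 0 <= N. Proof. by rewrite mulr_ge0. Qed.
Let L0 : 0 < L. Proof. rewrite /L; move: N0; lra. Qed.

Let Ei x y : intg E x y.
Proof.
apply: continuous_on_intg; apply: continuous_subspaceT => t.
apply: continuous_comp; last exact: continuous_expR.
by apply: cvgMr; apply: cvgB; [exact: cvg_id|exact: cvg_cst].
Qed.

Let Asum_bound (w : I -> R -> R) C i x : 0 <= C -> a <= x <= b ->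
  (forall j, intg (fun t => A i j t * w j t) a b) ->
  (forall j t, a <= t <= b -> `|w j t| <= C * E t) ->
  `|\int[mu]_(t in `[a, x]) \sum_j A i j t * w j t| <= C / 2 * E x.
Proof.
move=> C0 /andP[ax xb] wi wC.
have si := intg_sub (lexx a) xb (intg_sum wi).
apply: le_trans (le_normr_Rintegral _ si) _ => //.
apply: (@le_trans _ _ (\int[mu]_(t in `[a, x]) (N * C * E t))).
  apply: le_Rint; [exact: intg_norm|exact: intgZ|].
  move=> t /andP[at_ tx]; have tab : a <= t <= b by rewrite at_ (le_trans tx).
  apply: le_trans (ler_norm_sum _ _ _) _.
  apply: (@le_trans _ _ (\sum_(j : I) K * (C * E t))).
    by apply: ler_sum => j _; rewrite normrM ler_pM ?AK ?wC.
  by rewrite sumr_const -[_ *+ _]mulr_natl /N !mulrA.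
rewrite RintegralZl//; last exact: Ei.
apply: (@le_trans _ _ (N * C * (E x / L))).
  by rewrite ler_wpM2l ?mulr_ge0// Rint_expR.
have E0 : 0 <= E x by exact: expR_ge0.
have -> : N * C * (E x / L) = (C * E x) * (N / L) by ring.
have -> : C / 2 * E x = (C * E x) * 2^-1 by ring.
rewrite ler_wpM2l ?mulr_ge0// ler_pdivrMr// /L; lra.
Qed.

Let gbound : exists C, 0 <= C /\ forall i x, a <= x <= b -> `|g i x| <= C.
Proof.
have /choice[C HC] : forall i, exists c : R, 0 <= c /\ forall x, a <= x <= b -> `|g i x| <= c.
  by move=> i; apply: continuous_on_bounded; exact: primitive_on_continuous (gP i).
exists (\sum_i C i); split; first by apply: sumr_ge0 => i _; case: (HC i).
move=> i x xab; apply: (@le_trans _ _ (C i)); first by case: (HC i) => _; exact.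
by rewrite (bigD1 i)//= lerDl sumr_ge0// => j _; case: (HC j).
Qed.

Let E1 x : a <= x -> 1 <= E x.
Proof. by move=> ax; rewrite /E -expR0 ler_expR mulr_ge0 ?subr_ge0// ltW. Qed.

Lemma linear_ivp : exists W : I -> R -> R, (forall i, W i a = w0 i) /\
  forall i, primitive_on a b (W i) (fun x => \sum_j A i j x * W j x + f i x).
Proof.
have [C [C0 HC]] := gbound.
have Aw n i j : intg (fun t => A i j t * picard n j t) a b.
  by apply: intg_mulr; [exact: picard_cont|apply: continuous_on_intg; exact: cA].
(* The bound [2 C] reproduces itself: [g] contributes [C <= C * E x], and the operator halves
   [2 C * E]. *)
have bd n : forall i x, a <= x <= b -> `|picard n i x| <= 2 * C * E x.
  elim: n => [|n IH] i x xab.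
    apply: le_trans (HC _ _ xab) _; have := @E1 x; case/andP: xab => ax _ /(_ ax).
    by move: C0 => ? ?; nra.
  apply: le_trans (ler_normD _ _) _.
  have := Asum_bound (mulr_ge0 (ler0n _ 2) C0) xab (Aw n i) IH.
  have := HC i _ xab; have := @E1 x; case/andP: xab => ax _ /(_ ax) ? ? ?.
  have ? : C <= C * E x by rewrite ler_peMr.
  lra.
have df n : forall i x, a <= x <= b -> `|picard n.+1 i x - picard n i x| <= C * E x / 2 ^+ n.
  elim: n => [|n IH] i x xab.
    rewrite expr0 divr1 /= addrAC subrr add0r.
    have := Asum_bound (mulr_ge0 (ler0n _ 2) C0) xab (Aw 0%N i) (bd 0%N).
    by rewrite [2 * C]mulrC mulfK.
  have -> : picard n.+2 i x - picard n.+1 i x =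
      \int[mu]_(t in `[a, x]) \sum_j A i j t * (picard n.+1 j t - picard n j t).
    case/andP: xab => ax xb.
    transitivity ((\int[mu]_(t in `[a, x]) \sum_j A i j t * picard n.+1 j t) -
                  (\int[mu]_(t in `[a, x]) \sum_j A i j t * picard n j t)).
      by rewrite /=; ring.
    rewrite -RintegralB//; try by apply: (intg_sub (lexx a) xb); exact: intg_sum.
    by apply: eq_Rint => t _; rewrite -sumrB; apply: eq_bigr => j _; rewrite mulrBr.
  have C'0 : 0 <= C / 2 ^+ n by rewrite divr_ge0 ?exprn_ge0.
  have := @Asum_bound (fun j t => picard n.+1 j t - picard n j t) _ i x C'0 xab.
  have -> : C / 2 ^+ n / 2 * E x = C * E x / 2 ^+ n.+1.
    by rewrite exprS invfM; ring.
  apply.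
    move=> j; apply: (eq_intg _ (intgD (Aw n.+1 i j) (intgZ (-1) (Aw n i j)))) => t _; ring.
  by move=> j t tab; rewrite mulrAC; exact: IH.
pose W i x := limn (fun n => picard n i x).
have cvW i x : a <= x <= b -> picard n i x @[n --> \oo] --> W i x.
  by move=> xab; apply: (@geometric_cvg _ (C * E x)) => n; exact: df.
(* The uniform bound on the iterates provides the dominating function that lets the limit pass under
   the integral. *)
have cvI i x : a <= x <= b -> intg (fun t => \sum_j A i j t * W j t) a x /\
   \int[mu]_(t in `[a, x]) (\sum_j A i j t * picard n j t) @[n --> \oo] -->
   \int[mu]_(t in `[a, x]) (\sum_j A i j t * W j t).
  move=> /andP[ax xb]; apply: (@Rint_dominated _ _ (fun t => N * (2 * C) * E t)).
  - by move=> n; apply: (intg_sub (lexx a) xb); exact: intg_sum.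
  - exact: intgZ.
  - move=> n t /andP[at_ tx]; have tab : a <= t <= b by rewrite at_ (le_trans tx).
    apply: le_trans (ler_norm_sum _ _ _) _.
    apply: (@le_trans _ _ (\sum_(j : I) K * (2 * C * E t))).
      by apply: ler_sum => j _; rewrite normrM ler_pM ?AK ?bd.
    by rewrite sumr_const -[_ *+ _]mulr_natl /N !mulrA.
  - move=> t /andP[at_ tx]; apply: cvgn_sum => j.
    by apply: cvgMr; apply: cvW; rewrite at_ (le_trans tx).
have WE i x : a <= x <= b -> W i x = g i x + \int[mu]_(t in `[a, x]) (\sum_j A i j t * W j t).
  move=> xab; apply: (@cvg_unique _ (@Rhausdorff R) (picard n.+1 i x @[n --> \oo])).
    by have := cvW i x xab; rewrite -(cvg_shiftS (fun n => picard n i x)).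
  by apply: cvgD; [exact: cvg_cst|exact: (cvI i x xab).2].
exists W; split.
  by move=> i; rewrite WE ?lexx// /g set_itv1 !Rintegral_set1 !addr0.
move=> i; have [bi _] := cvI i b (introT andP (conj ab (lexx b))).
apply: (eq_primitive_on _ _ (primitive_onD (gP i) (primitive_on_integral bi))) => x xab.
  by rewrite -WE.
by rewrite addrC.
Qed.

End Picard.
End LinearODE.

(** * The Lyapunov form *)

Section Lyapunov.
Context {R : realType}.
Implicit Types (s q d b r dq db dr : R).

Definition ip (x1 x2 y1 y2 : R) : R := x1 * y1 + x2 * y2.

Lemma young (k B t x1 x2 y1 y2 : R) : `|k| <= B -> 0 < t ->
  - (t * ip x1 x2 x1 x2 + B ^+ 2 / (4 * t) * ip y1 y2 y1 y2) <= k * ip x1 x2 y1 y2.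
Proof.
move=> kB t0; have t4 : 0 < 4 * t by lra.
have k2 : k ^+ 2 <= B ^+ 2 by rewrite -[k ^+ 2]real_normK ?num_real// lerXn2r ?nnegrE// (le_trans _ kB).
have y0 : 0 <= ip y1 y2 y1 y2 by rewrite addr_ge0// -expr2 sqr_ge0.
rewrite -subr_ge0.
have -> : k * ip x1 x2 y1 y2 - - (t * ip x1 x2 x1 x2 + B ^+ 2 / (4 * t) * ip y1 y2 y1 y2) =
  ((2 * t * x1 + k * y1) ^+ 2 + (2 * t * x2 + k * y2) ^+ 2 + (B ^+ 2 - k ^+ 2) * ip y1 y2 y1 y2) / (4 * t).
  by rewrite /ip; field; rewrite gt_eqF.
by rewrite divr_ge0 ?(ltW t4)// addr_ge0// ?addr_ge0 ?sqr_ge0// mulr_ge0// subr_ge0.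
Qed.

Lemma young_up (k B t x1 x2 y1 y2 : R) : `|k| <= B -> 0 < t ->
  k * ip x1 x2 y1 y2 <= t * ip x1 x2 x1 x2 + B ^+ 2 / (4 * t) * ip y1 y2 y1 y2.
Proof.
move=> kB t0; have := @young (- k) B t x1 x2 y1 y2; rewrite normrN => /(_ kB t0).
by rewrite mulNr lerN2.
Qed.

(** With [lambda = al + i be] and [r] standing for [d'], this is
    [M^3 Q + M <u, lambda (U + q V) - q u> + <lambda U, V>]. *)
Definition Sform (M al be q d b r U1 U2 V1 V2 u1 u2 : R) : R :=
  M ^+ 3 * (d * ip u1 u2 U1 U2 + ip V1 V2 U1 U2 - ip V1 V2 V1 V2 / 2 - (r + b) / 2 * ip U1 U2 U1 U2)
  + M * ip u1 u2 (al * (U1 + q * V1) - be * (U2 + q * V2) - q * u1)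
                 (al * (U2 + q * V2) + be * (U1 + q * V1) - q * u2)
  + ip (al * U1 - be * U2) (al * U2 + be * U1) V1 V2.

(** The derivative of [Sform]; [dq], [dd], [dr], [db] are the derivatives of the
    coefficients. *)
Definition DSform (M al be q d b r dq dd db dr U1 U2 V1 V2 u1 u2 U1' U2' V1' V2' u1' u2' : R) : R :=
  M ^+ 3 * (dd * ip u1 u2 U1 U2 + d * (ip u1' u2' U1 U2 + ip u1 u2 U1' U2')
            + (ip V1' V2' U1 U2 + ip V1 V2 U1' U2') - ip V1 V2 V1' V2'
            - (dr + db) / 2 * ip U1 U2 U1 U2 - (r + b) * ip U1 U2 U1' U2')
  + M * (ip u1' u2' (al * (U1 + q * V1) - be * (U2 + q * V2) - q * u1)
                    (al * (U2 + q * V2) + be * (U1 + q * V1) - q * u2)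
         + ip u1 u2 (al * (U1' + dq * V1 + q * V1') - be * (U2' + dq * V2 + q * V2') - dq * u1 - q * u1')
                    (al * (U2' + dq * V2 + q * V2') + be * (U1' + dq * V1 + q * V1') - dq * u2 - q * u2'))
  + (ip (al * U1' - be * U2') (al * U2' + be * U1') V1 V2 + ip (al * U1 - be * U2) (al * U2 + be * U1) V1' V2').

(** The values of the coefficients at a single point, so that the estimates below are pure algebra
    and their constants depend only on [s0], [q0], [d0], [B] and [lambda]. The polynomial hypothesis
    of the theorem enters through [cb_G] alone. *)
Record coef_bounds (s0 q0 d0 B s q d b r dq db dr : R) : Prop := CoefBounds {
  cb_s : s0 <= s <= B;
  cb_q : q0 <= q <= B;
  cb_d : d0 <= d <= B;
  cb_b : 0 <= b <= B;
  cb_r : `|r| <= B;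
  cb_dq : `|dq| <= B;
  cb_ds : d * s = b;
  cb_bq : b * q = 1;
  cb_G : dr + db <= 0 }.

(** Here [u' = s (u + X)] and [Y = lambda V]. The correction of weight [M] creates the term
    [M * s * |X|^2], and [<lambda U, V>] creates [q * |Y|^2] because [lambda U = X + q u - q Y]. The
    last five terms are the indefinite ones still to be absorbed. *)
Lemma DSform_identity (M al be s q d b r dq db dr U1 U2 V1 V2 u1 u2 : R) :
  d * s = b -> b * q = 1 ->
  let X1 := al * (U1 + q * V1) - be * (U2 + q * V2) - q * u1 in
  let X2 := al * (U2 + q * V2) + be * (U1 + q * V1) - q * u2 in
  let Y1 := al * V1 - be * V2 in let Y2 := al * V2 + be * V1 in
  DSform M al be q d b r dq r db dr U1 U2 V1 V2 u1 u2
    u1 u2 (u1 - Y1) (u2 - Y2) (s * (u1 + X1)) (s * (u2 + X2)) =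
  M ^+ 3 * (al * (b * ip U1 U2 U1 U2 + ip V1 V2 V1 V2) - (dr + db) / 2 * ip U1 U2 U1 U2)
   + M * al * (1 + q) * ip u1 u2 u1 u2 + q * ip u1 u2 u1 u2
   + (M ^+ 3 * d - M * (dq + q * s)) * ip u1 u2 u1 u2 + M * s * ip X1 X2 X1 X2 + q * ip Y1 Y2 Y1 Y2
   + (M * s * (1 - q) + 1) * ip X1 X2 u1 u2 + (M * dq - 2 * q) * ip Y1 Y2 u1 u2
   + (- (M * q)) * ip Y1 Y2 (al * u1 + be * u2) (al * u2 - be * u1)
   + 1 * ip (al * V1 + be * V2) (al * V2 - be * V1) u1 u2 + (-1) * ip Y1 Y2 X1 X2.
Proof.
move=> hds hbq X1 X2 Y1 Y2.
(* The products of [Y] and [u] with [U] cancel only through [b * q = 1]; adding this vanishing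
   expression reduces the claim to a ring identity. *)
have E : (b * q - 1) * (ip Y1 Y2 U1 U2 - ip u1 u2 U1 U2) = 0 by rewrite hbq subrr mul0r.
rewrite -[RHS]addr0 -[in RHS](mulr0 (M ^+ 3)) -[in RHS]E.
rewrite /DSform /ip /X1 /X2 /Y1 /Y2 -hds; ring.
Qed.

(** The indefinite terms are paid for by Young's inequality. On [nu] the gain is [M ^+ 3 * d] and
    the losses sum to at most [M ^+ 2 * C0]: the summands of [C0] come from [dq + q * s], [T1],
    [T2], [T3] and [T4], in this order. Hence [M * d0 >= C0 + 1] leaves [M ^+ 2]. Out of [M * s0] on
    [nX], a quarter goes to [T1] and at most half to [T5]. Out of [q0] on [nY], four shares of
    [q0 / 8] are spent. *)
Lemma absorption (M s0 q0 d0 B m C0 c1 al s q d b dq db dr DS nu nX nY nU nV T1 T2 T3 T4 T5 : R) :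
  0 < s0 -> 0 < q0 -> 1 <= B -> 0 < m -> 1 <= M -> 0 <= C0 -> 0 <= al -> 0 <= b ->
  C0 = 2 * B ^+ 2 + 9 * B ^+ 4 / s0 + 18 * B ^+ 2 / q0 + 2 * B ^+ 2 * m / q0 + 2 / q0 ->
  C0 + 1 <= M * d0 -> 4 / q0 <= M * s0 ->
  c1 <= 1 -> c1 <= s0 / 4 -> c1 <= q0 / 2 ->
  s0 <= s <= B -> q0 <= q <= B -> d0 <= d -> dq <= B -> dr + db <= 0 ->
  0 <= nu -> 0 <= nX -> 0 <= nY -> 0 <= nU -> 0 <= nV ->
  - (M * s0 / 4 * nX + (3 * M * B ^+ 2) ^+ 2 / (4 * (M * s0 / 4)) * nu) <= T1 ->
  - (q0 / 8 * nY + (3 * M * B) ^+ 2 / (4 * (q0 / 8)) * nu) <= T2 ->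
  - (q0 / 8 * nY + (M * B) ^+ 2 / (4 * (q0 / 8)) * (m * nu)) <= T3 ->
  - (q0 / 8 * nY + 1 ^+ 2 / (4 * (q0 / 8)) * nu) <= T4 ->
  - (q0 / 8 * nY + 1 ^+ 2 / (4 * (q0 / 8)) * nX) <= T5 ->
  DS = M ^+ 3 * (al * (b * nU + nV) - (dr + db) / 2 * nU)
   + M * al * (1 + q) * nu + q * nu
   + (M ^+ 3 * d - M * (dq + q * s)) * nu + M * s * nX + q * nY + T1 + T2 + T3 + T4 + T5 ->
  c1 * (nu + nX + nY) <= DS.
Proof.
move=> s00 q00 B1 m0 M1 C00 al0 b0 C0E Md Ms c11 c12 c13 /andP[hs1 hs2] /andP[hq1 hq2] hd1 hdq hG.
move=> nu0 nX0 nY0 nU0 nV0 I1 I2 I3 I4 I5 DSE.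
have M0' : 0 <= M by lra.
have B0' : 0 <= B by lra.
have q0' : 0 <= q by lra.
have s0' : 0 <= s by lra.
have P1 : 0 <= M ^+ 3 * (al * (b * nU + nV) - (dr + db) / 2 * nU).
  rewrite mulr_ge0 ?exprn_ge0// addr_ge0//; first by rewrite mulr_ge0// addr_ge0// mulr_ge0.
  by rewrite -mulNr mulr_ge0//; lra.
have P2 : 0 <= M * al * (1 + q) * nu by rewrite !mulr_ge0// addr_ge0.
have P3 : 0 <= q * nu by rewrite mulr_ge0.
have MM : M <= M ^+ 2 by rewrite expr2 ler_peMl.
have M20 : 0 <= M ^+ 2 by rewrite exprn_ge0.
have M21 : 1 <= M ^+ 2 by rewrite expr_ge1.
have P4 : M ^+ 2 * (C0 + 1) * nu <= M ^+ 3 * d * nu.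
  rewrite ler_wpM2r// [M ^+ 3]exprSr -mulrA ler_wpM2l// (le_trans Md)//.
  by rewrite ler_wpM2l.
have qs : q * s <= B ^+ 2 by rewrite expr2 ler_pM.
have BB : B <= B ^+ 2 by rewrite expr2 ler_peMl.
have B20 : 0 <= B ^+ 2 by rewrite exprn_ge0.
have P5 : M * (dq + q * s) * nu <= M ^+ 2 * (2 * B ^+ 2) * nu.
  rewrite ler_wpM2r//; apply: (@le_trans _ _ (M * (2 * B ^+ 2))).
    by rewrite ler_wpM2l//; lra.
  by rewrite ler_wpM2r// mulr_ge0.
have P6 : M * s0 * nX <= M * s * nX by rewrite ler_wpM2r// ler_wpM2l.
have P7 : q0 * nY <= q * nY by rewrite ler_wpM2r.
have k1 : (3 * M * B ^+ 2) ^+ 2 / (4 * (M * s0 / 4)) * nu <= M ^+ 2 * (9 * B ^+ 4 / s0) * nu.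
  have -> : (3 * M * B ^+ 2) ^+ 2 / (4 * (M * s0 / 4)) = M * (9 * B ^+ 4 / s0).
    by field; rewrite !gt_eqF//; lra.
  rewrite ler_wpM2r// ler_wpM2r//.
  by apply: divr_ge0; [rewrite mulr_ge0 ?exprn_ge0|exact: ltW].
have k2 : (3 * M * B) ^+ 2 / (4 * (q0 / 8)) * nu = M ^+ 2 * (18 * B ^+ 2 / q0) * nu.
  by field; rewrite gt_eqF.
have k3 : (M * B) ^+ 2 / (4 * (q0 / 8)) * (m * nu) = M ^+ 2 * (2 * B ^+ 2 * m / q0) * nu.
  by field; rewrite gt_eqF.
have i0 : 0 <= 2 / q0 by rewrite divr_ge0// ltW.
have k0 : 1 ^+ 2 / (4 * (q0 / 8)) = 2 / q0 by field; rewrite gt_eqF.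
have k4 : 2 / q0 * nu <= M ^+ 2 * (2 / q0) * nu by rewrite ler_wpM2r// ler_peMl.
have k5 : 2 / q0 * nX <= M * s0 / 2 * nX.
  have -> : 2 / q0 = 4 / q0 / 2 by field; rewrite gt_eqF.
  by rewrite ler_wpM2r// ler_wpM2r.
have k6 : s0 * nX <= M * s0 * nX by rewrite ler_wpM2r// ler_peMl// ltW.
rewrite k0 in I4 I5; rewrite k2 in I2; rewrite k3 in I3.
have D1 : M ^+ 2 * nu + s0 / 4 * nX + q0 / 2 * nY <= DS.
  rewrite C0E in P4.
  move: P4 k1 I2 I3 k4 I1 I4 I5 k5 P5.
  have -> : M ^+ 2 * (2 * B ^+ 2 + 9 * B ^+ 4 / s0 + 18 * B ^+ 2 / q0 + 2 * B ^+ 2 * m / q0 + 2 / q0 + 1) * nu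
   = M ^+ 2 * (2 * B ^+ 2) * nu + M ^+ 2 * (9 * B ^+ 4 / s0) * nu + M ^+ 2 * (18 * B ^+ 2 / q0) * nu + M ^+ 2 * (2 * B ^+ 2 * m / q0) * nu + M ^+ 2 * (2 / q0) * nu + M ^+ 2 * nu by ring.
  have -> : M * s0 / 4 * nX = (M * s0 * nX) / 4 by ring.
  have -> : M * s0 / 2 * nX = (M * s0 * nX) / 2 by ring.
  rewrite mulrBl in DSE.
  set a1 := M ^+ 2 * (2 * B ^+ 2) * nu; set a2 := M ^+ 2 * (9 * B ^+ 4 / s0) * nu.
  set a3 := M ^+ 2 * (18 * B ^+ 2 / q0) * nu; set a4 := M ^+ 2 * (2 * B ^+ 2 * m / q0) * nu.
  set a5 := M ^+ 2 * (2 / q0) * nu; set a6 := 2 / q0 * nu; set a7 := 2 / q0 * nX.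
  set a8 := (_ / _ * nu); clearbody a1 a2 a3 a4 a5 a6 a7 a8.
  move: P1 P2 P3 P6 P7 k6 DSE.
  set b1 := M ^+ 3 * (_ - _); set b2 := M * al * _ * nu; set b3 := M ^+ 3 * d * nu; set b4 := M * s * nX.
  set b5 := M * (dq + _) * nu.
  clearbody b1 b2 b3 b4 b5 => *; lra.
apply: le_trans D1; rewrite !mulrDr; apply: lerD; first apply: lerD.
- by rewrite ler_wpM2r// (le_trans c11).
- by rewrite ler_wpM2r.
- by rewrite ler_wpM2r.
Qed.

Lemma coefficient_bounds (M B s q dq : R) : 1 <= M -> 1 <= B -> 0 <= s <= B ->
  0 <= q <= B -> `|dq| <= B ->
  [/\ `|M * s * (1 - q) + 1| <= 3 * M * B ^+ 2, `|M * dq - 2 * q| <= 3 * M * B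
    & `|- (M * q)| <= M * B].
Proof.
move=> M1 B1 /andP[s0 sB] /andP[q0 qB]; rewrite ler_norml => /andP[h1 h2].
have M0 : 0 <= M by lra.
have B0 : 0 <= B by lra.
have BB : B <= B ^+ 2 by rewrite expr2 ler_peMl.
split.
- have g1 : M * (s * q) <= M * B ^+ 2 by rewrite ler_wpM2l// expr2 ler_pM.
  have g2 : M * s <= M * B ^+ 2 by rewrite ler_wpM2l// (le_trans sB).
  have g3 : 0 <= M * s by rewrite mulr_ge0.
  have g4 : 0 <= M * (s * q) by rewrite !mulr_ge0.
  have g5 : 1 * 1 <= M * B ^+ 2 by apply: ler_pM => //; lra.
  have -> : M * s * (1 - q) + 1 = M * s - M * (s * q) + 1 by ring.
  have -> : 3 * M * B ^+ 2 = 3 * (M * B ^+ 2) by ring.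
  rewrite ler_norml.
  move: g1 g2 g3 g4 g5; set x1 := M * (s * q); set x2 := M * s; set x3 := M * B ^+ 2.
  clearbody x1 x2 x3 => *; apply/andP; split; lra.
- have g1 : M * dq <= M * B by rewrite ler_wpM2l.
  have g2 : M * (- B) <= M * dq by rewrite ler_wpM2l.
  have g3 : B <= M * B by rewrite ler_peMl.
  rewrite -mulrA ler_norml; apply/andP; split; lra.
- by rewrite normrN ger0_norm ?mulr_ge0// ler_wpM2l.
Qed.

Lemma sqr_tri (x y z : R) : (x + y - z) ^+ 2 <= 3 * (x ^+ 2 + y ^+ 2 + z ^+ 2).
Proof.
have := sqr_ge0 (x - y); have := sqr_ge0 (x + z); have := sqr_ge0 (y + z); rewrite !expr2; nra.
Qed.

Lemma ip_ge0 (x y : R) : 0 <= ip x y x y.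
Proof. by rewrite addr_ge0// -expr2 sqr_ge0. Qed.

(** Because [lambda U = X + q u - q Y]. For [m = |lambda|^2 > 0] this recovers [U] even when
    [al = 0]. *)
Lemma ip_recover (al be m q B U1 U2 V1 V2 u1 u2 : R) : m = al ^+ 2 + be ^+ 2 ->
  0 <= q <= B ->
  let X1 := al * (U1 + q * V1) - be * (U2 + q * V2) - q * u1 in
  let X2 := al * (U2 + q * V2) + be * (U1 + q * V1) - q * u2 in
  let Y1 := al * V1 - be * V2 in let Y2 := al * V2 + be * V1 in
  is_true (m * ip U1 U2 U1 U2 <=
    3 * (ip X1 X2 X1 X2 + B ^+ 2 * ip u1 u2 u1 u2 + B ^+ 2 * ip Y1 Y2 Y1 Y2)).
Proof.
move=> mE /andP[q0 qB] X1 X2 Y1 Y2.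
have q2 : q ^+ 2 <= B ^+ 2 by rewrite lerXn2r ?nnegrE// (le_trans q0).
apply: (@le_trans _ _ (3 * (ip X1 X2 X1 X2 + q ^+ 2 * ip u1 u2 u1 u2 + q ^+ 2 * ip Y1 Y2 Y1 Y2))).
  have -> : m * ip U1 U2 U1 U2 = (X1 + q * u1 - q * Y1) ^+ 2 + (X2 + q * u2 - q * Y2) ^+ 2.
    by rewrite mE /ip /X1 /X2 /Y1 /Y2; ring.
  apply: le_trans (lerD (sqr_tri _ _ _) (sqr_tri _ _ _)) _.
  by rewrite le_eqVlt; apply/orP; left; apply/eqP; rewrite /ip; ring.
by rewrite ler_pM2l// !lerD// ler_wpM2r// ip_ge0.
Qed.

(** [M] is only bounded from below, so that it can still be enlarged for the boundary signs. [M0]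
    adds the thresholds of [absorption] instead of taking their maximum. *)
Lemma DSform_homogeneous (s0 q0 d0 B al be m : R) :
  0 < s0 -> 0 < q0 -> 0 < d0 -> 1 <= B -> 0 <= al -> m = al ^+ 2 + be ^+ 2 -> 0 < m ->
  exists2 M0, 1 <= M0 & forall M, M0 <= M -> exists c, 0 < c /\
  forall s q d b r dq db dr, coef_bounds s0 q0 d0 B s q d b r dq db dr ->
  forall U1 U2 V1 V2 u1 u2,
  let X1 := al * (U1 + q * V1) - be * (U2 + q * V2) - q * u1 in
  let X2 := al * (U2 + q * V2) + be * (U1 + q * V1) - q * u2 in
  let Y1 := al * V1 - be * V2 in let Y2 := al * V2 + be * V1 in
  is_true (c * (ip U1 U2 U1 U2 + ip V1 V2 V1 V2 + ip u1 u2 u1 u2) <=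
  DSform M al be q d b r dq r db dr U1 U2 V1 V2 u1 u2
    u1 u2 (u1 - Y1) (u2 - Y2) (s * (u1 + X1)) (s * (u2 + X2))).
Proof.
move=> s00 q00 d00 B1 al0 mE m0.
have [C0 C0E] : exists C0, C0 = 2 * B ^+ 2 + 9 * B ^+ 4 / s0 + 18 * B ^+ 2 / q0 + 2 * B ^+ 2 * m / q0 + 2 / q0 by eexists.
have B0 : 0 < B := lt_le_trans ltr01 B1.
have C00 : 0 <= C0.
  by rewrite C0E !addr_ge0// ?divr_ge0 ?mulr_ge0 ?exprn_ge0 ?(ltW m0) ?(ltW s00) ?(ltW q00)// ltW.
have e1 : 0 <= (C0 + 1) / d0 by apply: divr_ge0; [exact: addr_ge0|exact: ltW].
have e2 : 0 <= 4 / (q0 * s0) by apply: divr_ge0 => //; apply: mulr_ge0; exact: ltW.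
exists (1 + (C0 + 1) / d0 + 4 / (q0 * s0)); first by rewrite -addrA lerDl addr_ge0.
move=> M M0.
have M1 : 1 <= M by apply: le_trans M0; rewrite -addrA lerDl addr_ge0.
have Md : C0 + 1 <= M * d0.
  by rewrite -ler_pdivrMr//; apply: le_trans M0; rewrite addrAC addrC lerDl addr_ge0.
have Ms : 4 / q0 <= M * s0.
  by rewrite -ler_pdivrMr// -mulrA -invfM; apply: le_trans M0; rewrite addrC lerDl addr_ge0.
have [c1 c1E] : exists c1, c1 = Num.min 1 (Num.min (s0 / 4) (q0 / 2)) by eexists.
have c10 : 0 < c1 by rewrite c1E !lt_min ltr01 !divr_gt0.
have [c11 c12 c13] : [/\ c1 <= 1, c1 <= s0 / 4 & c1 <= q0 / 2].
  by split; rewrite c1E !ge_min lexx ?orbT.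
have den0 : 0 < 1 + (1 + 3 * B ^+ 2) / m.
  by rewrite addr_gt0// divr_gt0// addr_gt0// mulr_gt0// exprn_gt0.
(* The denominator converts norms: [|V|^2 = |Y|^2 / m], and [ip_recover] with [B >= 1] bounds
   [|U|^2] by [3 B^2 / m] times [|u|^2 + |X|^2 + |Y|^2]. *)
exists (c1 / (1 + (1 + 3 * B ^+ 2) / m)); split; first by rewrite divr_gt0.
move=> s q d b r dq db dr [/andP[hs1 hs2] /andP[hq1 hq2] /andP[hd1 hd2] /andP[hb1 hb2] hr hdq hds hbq hG].
move=> U1 U2 V1 V2 u1 u2 X1 X2 Y1 Y2.
rewrite DSform_identity// -/X1 -/X2 -/Y1 -/Y2.
have q0' : 0 <= q <= B by rewrite hq2 andbT (le_trans _ hq1)// ltW.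
have s0' : 0 <= s <= B by rewrite hs2 andbT (le_trans _ hs1)// ltW.
have [k1 k2 k3] := coefficient_bounds M1 B1 s0' q0' hdq.
have EY : ip Y1 Y2 Y1 Y2 = m * ip V1 V2 V1 V2 by rewrite mE /ip /Y1 /Y2; ring.
have EY' : ip (al * V1 + be * V2) (al * V2 - be * V1) (al * V1 + be * V2) (al * V2 - be * V1) =
  ip Y1 Y2 Y1 Y2 by rewrite /ip /Y1 /Y2; ring.
have EZ : ip (al * u1 + be * u2) (al * u2 - be * u1) (al * u1 + be * u2) (al * u2 - be * u1) =
  m * ip u1 u2 u1 u2 by rewrite mE /ip; ring.
have EU : m * ip U1 U2 U1 U2 <= 3 * (ip X1 X2 X1 X2 + B ^+ 2 * ip u1 u2 u1 u2 + B ^+ 2 * ip Y1 Y2 Y1 Y2) :=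
  ip_recover U1 U2 V1 V2 u1 u2 mE q0'.
have t1 : 0 < M * s0 / 4 by rewrite divr_gt0// mulr_gt0// (lt_le_trans ltr01).
have t2 : 0 < q0 / 8 by rewrite divr_gt0.
have one1 : `|1 : R| <= 1 by rewrite normr1.
have one2 : `|-1 : R| <= 1 by rewrite normrN normr1.
have I3 := young Y1 Y2 (al * u1 + be * u2) (al * u2 - be * u1) k3 t2; rewrite EZ in I3.
have I4 := young (al * V1 + be * V2) (al * V2 - be * V1) u1 u2 one1 t2; rewrite EY' in I4.
have hdq2 : dq <= B by apply: le_trans hdq; exact: ler_norm.
have nu0 := ip_ge0 u1 u2; have nX0 := ip_ge0 X1 X2; have nY0 := ip_ge0 Y1 Y2.
have nU0 := ip_ge0 U1 U2; have nV0 := ip_ge0 V1 V2.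
apply: le_trans (absorption s00 q00 B1 m0 M1 C00 al0 hb1 C0E Md Ms c11 c12 c13
  (introT andP (conj hs1 hs2)) (introT andP (conj hq1 hq2)) hd1 hdq2 hG nu0 nX0 nY0 nU0 nV0
  (young X1 X2 u1 u2 k1 t1) (young Y1 Y2 u1 u2 k2 t2) I3 I4 (young Y1 Y2 X1 X2 one2 t2) erefl).
rewrite mulrAC ler_pdivrMr// -mulrA ler_wpM2l ?(ltW c10)//.
move: EU EY nu0 nX0 nY0 nU0 nV0.
move: (ip u1 u2 u1 u2) (ip X1 X2 X1 X2) (ip Y1 Y2 Y1 Y2) (ip U1 U2 U1 U2) (ip V1 V2 V1 V2).
clear - B1 m0 => nu nX nY nU nV EU EY nu0 nX0 nY0 nU0 nV0.
have h1 : nV = nY / m by rewrite EY mulrC mulKf// gt_eqF.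
have BB : 1 <= B ^+ 2 by rewrite expr_ge1// (le_trans ler01).
have h2 : nU <= 3 * B ^+ 2 * (nu + nX + nY) / m.
  rewrite ler_pdivlMr// mulrC (le_trans EU)// -mulrA ler_wpM2l// !mulrDr.
  have : nX <= B ^+ 2 * nX by rewrite ler_peMl.
  lra.
have h3 : nY / m <= (nu + nX + nY) / m by rewrite ler_wpM2r ?invr_ge0 ?(ltW m0)//; lra.
have -> : (nu + nX + nY) * (1 + (1 + 3 * B ^+ 2) / m) =
   (nu + nX + nY) + (nu + nX + nY) / m + 3 * B ^+ 2 * (nu + nX + nY) / m by ring.
rewrite h1; lra.
Qed.

End Lyapunov.

(** * Forcing terms, size and boundary signs of the form *)

Section Lyapunov2.
Context {R : realType}.

Lemma DSform_forcing (M al be s q d b r dq db dr U1 U2 V1 V2 u1 u2 F1 F2 G1 G2 w1 w2 x1 x2 : R) :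
  DSform M al be q d b r dq r db dr U1 U2 V1 V2 u1 u2
    (u1 + F1) (u2 + F2) (w1 + G1) (w2 + G2) x1 x2 =
  DSform M al be q d b r dq r db dr U1 U2 V1 V2 u1 u2 u1 u2 w1 w2 x1 x2
  + (M ^+ 3 * d * ip u1 u2 F1 F2 + M ^+ 3 * ip U1 U2 G1 G2 + M ^+ 3 * ip V1 V2 F1 F2
     + (- M ^+ 3) * ip V1 V2 G1 G2 + (- (M ^+ 3 * (r + b))) * ip U1 U2 F1 F2
     + M * ip u1 u2 (al * F1 - be * F2) (al * F2 + be * F1)
     + M * q * ip u1 u2 (al * G1 - be * G2) (al * G2 + be * G1)
     + 1 * ip V1 V2 (al * F1 - be * F2) (al * F2 + be * F1)
     + 1 * ip U1 U2 (al * G1 + be * G2) (al * G2 - be * G1)).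
Proof. rewrite /DSform /ip; ring. Qed.

Lemma form_coefficients (M B d q b r : R) : 1 <= M -> 1 <= B -> 0 <= d <= B -> 0 <= q <= B ->
  0 <= b <= B -> `|r| <= B ->
  [/\ `|M ^+ 3 * d| <= 2 * M ^+ 3 * B, `|M ^+ 3| <= 2 * M ^+ 3 * B,
      `|M ^+ 3 * (r + b)| <= 2 * M ^+ 3 * B, `|M| <= 2 * M ^+ 3 * B &
      `|M * q| <= 2 * M ^+ 3 * B /\ `|1 : R| <= 2 * M ^+ 3 * B].
Proof.
move=> M1 B1 /andP[d0 dB] /andP[q0 qB] /andP[b0 bB] hr.
have M0 : 0 <= M by lra.
have B0 : 0 <= B by lra.
have M30 : 0 <= M ^+ 3 by rewrite exprn_ge0.
have MM : M <= M ^+ 3 by rewrite exprS ler_peMr// expr_ge1.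
have MB : 0 <= M ^+ 3 * B by rewrite mulr_ge0.
have M3B : M ^+ 3 <= M ^+ 3 * B by rewrite ler_peMr.
have -> : 2 * M ^+ 3 * B = 2 * (M ^+ 3 * B) by rewrite mulrA.
split.
- by rewrite ger0_norm ?mulr_ge0//; apply: le_trans (ler_wpM2l M30 dB) _; rewrite ler_peMl// ler1n.
- by rewrite ger0_norm// (le_trans M3B)// ler_peMl// ler1n.
- rewrite normrM (ger0_norm M30) mulrCA ler_wpM2l//.
  by apply: le_trans (ler_normD _ _) _; rewrite (ger0_norm b0); lra.
- by rewrite ger0_norm// (le_trans MM)// (le_trans M3B)// ler_peMl// ler1n.
- split; last by rewrite normr1; lra.
  rewrite ger0_norm ?mulr_ge0//; apply: (@le_trans _ _ (M ^+ 3 * B)); first exact: ler_pM.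
  by rewrite ler_peMl// ler1n.
Qed.

Lemma forcing_bound (M al be m B q d b r t U1 U2 V1 V2 u1 u2 F1 F2 G1 G2 : R) :
  m = al ^+ 2 + be ^+ 2 -> 1 <= M -> 1 <= B -> 0 <= d <= B -> 0 <= q <= B ->
  0 <= b <= B -> `|r| <= B -> 0 < t ->
  - (3 * t * (ip U1 U2 U1 U2 + ip V1 V2 V1 V2 + ip u1 u2 u1 u2) +
     (2 * M ^+ 3 * B) ^+ 2 / (4 * t) * (3 + 2 * m) * (ip F1 F2 F1 F2 + ip G1 G2 G1 G2)) <=
  M ^+ 3 * d * ip u1 u2 F1 F2 + M ^+ 3 * ip U1 U2 G1 G2 + M ^+ 3 * ip V1 V2 F1 F2
     + (- M ^+ 3) * ip V1 V2 G1 G2 + (- (M ^+ 3 * (r + b))) * ip U1 U2 F1 F2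
     + M * ip u1 u2 (al * F1 - be * F2) (al * F2 + be * F1)
     + M * q * ip u1 u2 (al * G1 - be * G2) (al * G2 + be * G1)
     + 1 * ip V1 V2 (al * F1 - be * F2) (al * F2 + be * F1)
     + 1 * ip U1 U2 (al * G1 + be * G2) (al * G2 - be * G1).
Proof.
move=> mE M1 B1 hd hq hb hr t0.
have [k1 k2 k3 k4 [k5 k6]] := form_coefficients M1 B1 hd hq hb hr.
move: k1 k2 k3 k4 k5 k6; set kap := 2 * M ^+ 3 * B; move=> k1 k2 k3 k4 k5 k6.
have k2' : `|- M ^+ 3| <= kap by rewrite normrN.
have k3' : `|- (M ^+ 3 * (r + b))| <= kap by rewrite normrN.
have EF : ip (al * F1 - be * F2) (al * F2 + be * F1) (al * F1 - be * F2) (al * F2 + be * F1) = m * ip F1 F2 F1 F2 by rewrite mE /ip; ring.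
have EG : ip (al * G1 - be * G2) (al * G2 + be * G1) (al * G1 - be * G2) (al * G2 + be * G1) = m * ip G1 G2 G1 G2 by rewrite mE /ip; ring.
have EG' : ip (al * G1 + be * G2) (al * G2 - be * G1) (al * G1 + be * G2) (al * G2 - be * G1) = m * ip G1 G2 G1 G2 by rewrite mE /ip; ring.
have I1 := young u1 u2 F1 F2 k1 t0; have I2 := young U1 U2 G1 G2 k2 t0.
have I3 := young V1 V2 F1 F2 k2 t0; have I4 := young V1 V2 G1 G2 k2' t0.
have I5 := young U1 U2 F1 F2 k3' t0.
have I6 := young u1 u2 (al * F1 - be * F2) (al * F2 + be * F1) k4 t0; rewrite EF in I6.
have I7 := young u1 u2 (al * G1 - be * G2) (al * G2 + be * G1) k5 t0; rewrite EG in I7.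
have I8 := young V1 V2 (al * F1 - be * F2) (al * F2 + be * F1) k6 t0; rewrite EF in I8.
have I9 := young U1 U2 (al * G1 + be * G2) (al * G2 - be * G1) k6 t0; rewrite EG' in I9.
apply: le_trans (lerD (lerD (lerD (lerD (lerD (lerD (lerD (lerD I1 I2) I3) I4) I5) I6) I7) I8) I9).
(* Each of [U], [V], [u] occurs in three of the nine products. The factor of [|F|^2] adds up to
   [3 + 2 m], that of [|G|^2] only to [2 + 2 m]; this term is the slack. *)
have z0 : 0 <= kap ^+ 2 / (4 * t) * ip G1 G2 G1 G2.
  by rewrite mulr_ge0 ?ip_ge0// divr_ge0 ?sqr_ge0// mulr_ge0// ltW.
rewrite -subr_ge0; apply: le_trans z0 _; rewrite le_eqVlt; apply/orP; left; apply/eqP.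
clearbody kap; rewrite !opprD !opprK; ring.
Qed.

Lemma young_abs (k K x1 x2 y1 y2 : R) : `|k| <= K -> 0 < K ->
  `|k * ip x1 x2 y1 y2| <= K * (ip x1 x2 x1 x2 + ip y1 y2 y1 y2).
Proof.
move=> kK K0; have t0 : 0 < K / 2 by rewrite divr_gt0.
have E : K ^+ 2 / (4 * (K / 2)) = K / 2 by field; rewrite gt_eqF.
have := young x1 x2 y1 y2 kK t0; have := young_up x1 x2 y1 y2 kK t0; rewrite E -mulrDr => h1 h2.
have := ip_ge0 x1 x2; have := ip_ge0 y1 y2 => h3 h4.
have h5 : 0 <= K * (ip x1 x2 x1 x2 + ip y1 y2 y1 y2) by apply: mulr_ge0; [exact: ltW|exact: addr_ge0].
have E2 : K / 2 * (ip x1 x2 x1 x2 + ip y1 y2 y1 y2) = K * (ip x1 x2 x1 x2 + ip y1 y2 y1 y2) / 2.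
  by rewrite mulrAC.
rewrite ler_norml; move: h1 h2 h5; rewrite E2; move: (K * _) (k * _) => z w h1 h2 h5.
by apply/andP; split; lra.
Qed.

Lemma Sform_bound (M al be m B q d b r U1 U2 V1 V2 u1 u2 : R) :
  m = al ^+ 2 + be ^+ 2 -> 1 <= M -> 1 <= B -> 0 <= d <= B -> 0 <= q <= B ->
  0 <= b <= B -> `|r| <= B ->
  `|Sform M al be q d b r U1 U2 V1 V2 u1 u2| <=
    2 * M ^+ 3 * B * (10 + 3 * m) * (ip U1 U2 U1 U2 + ip V1 V2 V1 V2 + ip u1 u2 u1 u2).
Proof.
move=> mE M1 B1 hd hq hb hr.
have [k1 k2 k3 k4 [k5 k6]] := form_coefficients M1 B1 hd hq hb hr.
move: k1 k2 k3 k4 k5 k6; set kap := 2 * M ^+ 3 * B; move=> k1 k2 k3 k4 k5 k6.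
have kap0 : 0 < kap by rewrite normr1 in k6; exact: lt_le_trans k6.
have EU : ip (al * U1 - be * U2) (al * U2 + be * U1) (al * U1 - be * U2) (al * U2 + be * U1) = m * ip U1 U2 U1 U2 by rewrite mE /ip; ring.
have EV : ip (al * V1 - be * V2) (al * V2 + be * V1) (al * V1 - be * V2) (al * V2 + be * V1) = m * ip V1 V2 V1 V2 by rewrite mE /ip; ring.
have half (k : R) : `|k| <= kap -> `|- (k / 2)| <= kap.
  by move=> h; rewrite normrN normf_div (@ger0_norm _ 2)// ler_pdivrMr//; have := normr_ge0 k; lra.
have -> : Sform M al be q d b r U1 U2 V1 V2 u1 u2 =
  M ^+ 3 * d * ip u1 u2 U1 U2 + M ^+ 3 * ip V1 V2 U1 U2 + (- (M ^+ 3 / 2)) * ip V1 V2 V1 V2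
  + (- (M ^+ 3 * (r + b) / 2)) * ip U1 U2 U1 U2
  + M * ip u1 u2 (al * U1 - be * U2) (al * U2 + be * U1)
  + M * q * ip u1 u2 (al * V1 - be * V2) (al * V2 + be * V1)
  + (- (M * q)) * ip u1 u2 u1 u2
  + 1 * ip (al * U1 - be * U2) (al * U2 + be * U1) V1 V2.
  by rewrite /Sform /ip; field.
have k5' : `|- (M * q)| <= kap by rewrite normrN.
have I1 := young_abs u1 u2 U1 U2 k1 kap0; have I2 := young_abs V1 V2 U1 U2 k2 kap0.
have I3 := young_abs V1 V2 V1 V2 (half _ k2) kap0; have I4 := young_abs U1 U2 U1 U2 (half _ k3) kap0.
have I5 := young_abs u1 u2 (al * U1 - be * U2) (al * U2 + be * U1) k4 kap0; rewrite EU in I5.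
have I6 := young_abs u1 u2 (al * V1 - be * V2) (al * V2 + be * V1) k5 kap0; rewrite EV in I6.
have I7 := young_abs u1 u2 u1 u2 k5' kap0.
have I8 := young_abs (al * U1 - be * U2) (al * U2 + be * U1) V1 V2 k6 kap0; rewrite EU in I8.
have nD (x y a c : R) : `|x| <= a -> `|y| <= c -> `|x + y| <= a + c.
  by move=> h1 h2; apply: le_trans (ler_normD _ _) (lerD h1 h2).
apply: le_trans (nD _ _ _ _ (nD _ _ _ _ (nD _ _ _ _ (nD _ _ _ _ (nD _ _ _ _ (nD _ _ _ _ (nD _ _ _ _ I1 I2) I3) I4) I5) I6) I7) I8) _.
rewrite -!mulrDr -mulrA ler_wpM2l ?(ltW kap0)//.
have m0 : 0 <= m by rewrite mE addr_ge0 ?sqr_ge0.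
have := ip_ge0 U1 U2; have := ip_ge0 V1 V2; have := ip_ge0 u1 u2.
move: (ip U1 U2 U1 U2) (ip V1 V2 V1 V2) (ip u1 u2 u1 u2) => nU nV nu n1 n2 n3.
have := mulr_ge0 m0 n1; have := mulr_ge0 m0 n2; have := mulr_ge0 m0 n3; clear - n1 n2 n3 => h1 h2 h3; lra.
Qed.

(** For [U = 0] the form is [- M^3 |V|^2 / 2 + M q <u, Y - u>] with [Y = lambda V]. Completing the
    square in [u] leaves [M q m |V|^2 / 4], which the first term absorbs once [B * m <= M]. *)
Lemma Sform_right (M al be m B q d b r V1 V2 u1 u2 : R) :
  m = al ^+ 2 + be ^+ 2 -> 1 <= M -> B * m <= M -> 0 <= q <= B ->
  Sform M al be q d b r 0 0 V1 V2 u1 u2 <= 0.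
Proof.
move=> mE M1 BM /andP[q0 qB].
pose Y1 := al * V1 - be * V2; pose Y2 := al * V2 + be * V1.
have M0 : 0 <= M by lra.
have -> : Sform M al be q d b r 0 0 V1 V2 u1 u2 =
  - (M * q * ((u1 - Y1 / 2) ^+ 2 + (u2 - Y2 / 2) ^+ 2)) - M * (M ^+ 2 / 2 - q * m / 4) * ip V1 V2 V1 V2.
  by rewrite /Sform /ip mE /Y1 /Y2; field.
have n0 := ip_ge0 V1 V2.
have m0 : 0 <= m by rewrite mE addr_ge0 ?sqr_ge0.
have h1 : q * m <= B * m by rewrite ler_wpM2r.
have h2 : M <= M ^+ 2 by rewrite expr2 ler_peMl.
have h3 : 0 <= q * m by rewrite mulr_ge0.
have h4 : 0 <= M ^+ 2 / 2 - q * m / 4 by lra.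
have h5 : 0 <= (u1 - Y1 / 2) ^+ 2 + (u2 - Y2 / 2) ^+ 2 by rewrite addr_ge0 ?sqr_ge0.
have h6 : 0 <= M * q * ((u1 - Y1 / 2) ^+ 2 + (u2 - Y2 / 2) ^+ 2).
  by apply: mulr_ge0 => //; exact: mulr_ge0.
have h7 : 0 <= M * (M ^+ 2 / 2 - q * m / 4) * ip V1 V2 V1 V2.
  by apply: mulr_ge0 => //; exact: mulr_ge0.
by rewrite -opprD oppr_le0 addr_ge0.
Qed.

(** Everything is a multiple of [|U|^2]. The choice of [kap] gives [d * kap >= B + 1], which exceeds
    [(r + b) / 2 <= B] by at least 1; the bound on [M] then beats [q * kap ^+ 2], and [M * kap * al]
    is nonnegative because [Re lambda >= 0]. *)
Lemma Sform_left (M al be B q d0 d b r kap U1 U2 : R) :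
  0 < d0 -> 0 <= al -> 1 <= M -> 1 <= B -> 0 <= q <= B -> d0 <= d -> 0 <= b <= B -> `|r| <= B ->
  kap = (B + 1) / d0 -> B * kap ^+ 2 + 1 <= M ->
  ip U1 U2 U1 U2 <= Sform M al be q d b r U1 U2 0 0 (kap * U1) (kap * U2).
Proof.
move=> d00 al0 M1 B1 /andP[q0 qB] hd /andP[b0 bB] hr kE hM.
have n0 := ip_ge0 U1 U2.
have M0 : 0 <= M by lra.
have -> : Sform M al be q d b r U1 U2 0 0 (kap * U1) (kap * U2) =
  (M * (M ^+ 2 * (d * kap - (r + b) / 2) - q * kap ^+ 2) + M * kap * al) * ip U1 U2 U1 U2.
  by rewrite /Sform /ip; field.
have k0 : 0 <= kap by rewrite kE; apply: divr_ge0; [lra|exact: ltW].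
rewrite -[leLHS]mul1r ler_wpM2r//.
have h1 : q * kap ^+ 2 <= B * kap ^+ 2 by rewrite ler_wpM2r// sqr_ge0.
have h2 : M <= M ^+ 2 by rewrite expr2 ler_peMl.
have h3 : B + 1 <= d * kap by rewrite kE mulrA ler_pdivlMr// mulrC ler_wpM2r//; lra.
have h4 : r <= B by apply: le_trans hr; exact: ler_norm.
have h5 : 1 <= d * kap - (r + b) / 2 by lra.
have h6 : M ^+ 2 <= M ^+ 2 * (d * kap - (r + b) / 2) by rewrite ler_peMr// exprn_ge0.
have h7 : 1 <= M ^+ 2 * (d * kap - (r + b) / 2) - q * kap ^+ 2 by lra.
have h8 : 1 * 1 <= M * (M ^+ 2 * (d * kap - (r + b) / 2) - q * kap ^+ 2) by apply: ler_pM.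
rewrite mulr1 in h8; apply: le_trans h8 _; rewrite lerDl.
by apply: mulr_ge0 => //; exact: mulr_ge0.
Qed.

Theorem lyapunov_form (s0 q0 d0 B al be : R) :
  0 < s0 -> 0 < q0 -> 0 < d0 -> 1 <= B -> 0 <= al -> 0 < al ^+ 2 + be ^+ 2 ->
  exists M kap c K : R, [/\ 0 < c, 0 < K &
  forall s q d b r dq db dr, coef_bounds s0 q0 d0 B s q d b r dq db dr ->
  [/\ forall U1 U2 V1 V2 u1 u2 F1 F2 G1 G2,
    c * (ip U1 U2 U1 U2 + ip V1 V2 V1 V2 + ip u1 u2 u1 u2)
      - K * (ip F1 F2 F1 F2 + ip G1 G2 G1 G2) <=
    DSform M al be q d b r dq r db dr U1 U2 V1 V2 u1 u2
      (u1 + F1) (u2 + F2)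
      (u1 - (al * V1 - be * V2) + G1) (u2 - (al * V2 + be * V1) + G2)
      (s * (u1 + (al * (U1 + q * V1) - be * (U2 + q * V2) - q * u1)))
      (s * (u2 + (al * (U2 + q * V2) + be * (U1 + q * V1) - q * u2))),
   forall U1 U2 V1 V2 u1 u2, `|Sform M al be q d b r U1 U2 V1 V2 u1 u2| <=
     K * (ip U1 U2 U1 U2 + ip V1 V2 V1 V2 + ip u1 u2 u1 u2),
   forall V1 V2 u1 u2, Sform M al be q d b r 0 0 V1 V2 u1 u2 <= 0 &
   forall U1 U2, ip U1 U2 U1 U2 <= Sform M al be q d b r U1 U2 0 0 (kap * U1) (kap * U2)]].
Proof.
move=> s00 q00 d00 B1 al0; set m := al ^+ 2 + be ^+ 2 => m0.
have mE : m = al ^+ 2 + be ^+ 2 by [].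
have [M0 M01 HM] := DSform_homogeneous s00 q00 d00 B1 al0 mE m0.
have B0 : 0 <= B by apply: le_trans B1.
clearbody m.
have [kap kE] : exists kap, kap = (B + 1) / d0 by eexists.
(* One [M] for three demands: coercivity, the sign at the right end and the sign at the left end. *)
have [M ME] : exists M, M = M0 + B * m + (B * kap ^+ 2 + 1) by eexists.
have h1 : 0 <= B * m by rewrite mulr_ge0// ltW.
have h2 : 0 <= B * kap ^+ 2 by rewrite mulr_ge0// sqr_ge0.
have MM0 : M0 <= M by lra.
have M1 : 1 <= M by lra.
have MB : B * m <= M by lra.
have Mk : B * kap ^+ 2 + 1 <= M by lra.
have [c [c0 Hc]] := HM M MM0.
(* With [t = c / 6] in [forcing_bound] the forcing uses up [3 t = c / 2], half of the coercivity. *)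
have t0 : 0 < c / 6 by rewrite divr_gt0.
pose K1 := (2 * M ^+ 3 * B) ^+ 2 / (4 * (c / 6)) * (3 + 2 * m).
pose K2 := 2 * M ^+ 3 * B * (10 + 3 * m).
have K10 : 0 <= K1.
  rewrite /K1 mulr_ge0 ?divr_ge0 ?sqr_ge0//; first by rewrite mulr_ge0// ltW.
  by rewrite addr_ge0// mulr_ge0// ltW.
have K20 : 0 < K2.
  have Mp : 0 < M by exact: lt_le_trans M1.
  have Bp : 0 < B by exact: lt_le_trans B1.
  apply: mulr_gt0; last by apply: addr_gt0 => //; exact: mulr_gt0.
  by apply: mulr_gt0 => //; apply: mulr_gt0 => //; exact: exprn_gt0.
exists M, kap, (c / 2), (K1 + K2); split; [by rewrite divr_gt0|by rewrite ltr_wpDl|].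
move=> s q d b r dq db dr hcb; have := Hc _ _ _ _ _ _ _ _ hcb => H.
case: hcb => /andP[hs1 hs2] /andP[hq1 hq2] /andP[hd1 hd2] hb hr hdq hds hbq hG.
have q0' : 0 <= q <= B by rewrite hq2 andbT (le_trans _ hq1)// ltW.
have d0' : 0 <= d <= B by rewrite hd2 andbT (le_trans _ hd1)// ltW.
split.
- move=> U1 U2 V1 V2 u1 u2 F1 F2 G1 G2; rewrite DSform_forcing//.
  have := forcing_bound U1 U2 V1 V2 u1 u2 F1 F2 G1 G2 mE M1 B1 d0' q0' hb hr t0; rewrite -/K1.
  have := H U1 U2 V1 V2 u1 u2 => /=.
  have := ip_ge0 F1 F2; have := ip_ge0 G1 G2.
  move: (DSform _ _ _ _ _ _ _ _ _ _ _ _ _ _ _ _ _ _ _ _ _ _ _) => D.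
  move=> g1 g2; have h5 : 0 <= K2 * (ip F1 F2 F1 F2 + ip G1 G2 G1 G2).
    by apply: mulr_ge0; [exact: ltW|exact: addr_ge0].
  move: h5; move: (_ + ip G1 G2 G1 G2) (_ + _ + ip u1 u2 u1 u2) => nF nW h5 h3 h4.
  apply: le_trans (lerD h3 h4); rewrite mulrDl; clearbody K1 K2; lra.
- move=> U1 U2 V1 V2 u1 u2; apply: le_trans (Sform_bound U1 U2 V1 V2 u1 u2 mE M1 B1 d0' q0' hb hr) _.
  rewrite -/K2; apply: ler_wpM2r; last by rewrite lerDr.
  by apply: addr_ge0; [apply: addr_ge0|]; exact: ip_ge0.
- by move=> V1 V2 u1 u2; exact: Sform_right mE M1 MB q0'.
- by move=> U1 U2; exact: (Sform_left be U1 U2 d00 al0 M1 B1 q0' hd1 hb hr kE Mk).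
Qed.

End Lyapunov2.

(** * The shock profile *)

Section Profile.
Context {R : realType}.
Implicit Types (gamma vp a v : R).

Lemma MVT_at (f df : R -> R) (x y : R) : x < y ->
  (forall c, x <= c <= y -> is_derive c 1 f (df c)) ->
  exists2 c, x < c < y & f y - f x = df c * (y - x).
Proof.
move=> xy d.
have [c|c|c] := @MVT R f df x y xy.
- by rewrite in_itv/= => /andP[/ltW h1 /ltW h2]; apply: d; rewrite h1.
- apply: continuous_subspace_itv => z; rewrite in_itv/= => zxy.
  by apply/differentiable_continuous/derivable1_diffP; case: (d z zxy).
- by rewrite in_itv/= => cxy E; exists c.
Qed.

Lemma powR_pos_lt1 gamma v : 1 <= gamma -> 0 < v -> v < 1 -> v `^ gamma < 1.
Proof.
move=> g1 v0 v1; rewrite -[ltRHS](_ : 1 `^ gamma = 1); last by rewrite powR1.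
apply: gt0_ltr_powR; rewrite ?nnegrE ?(ltW v0)//.
exact: lt_le_trans g1.
Qed.

Lemma shock_a_gt0 gamma vp : 1 <= gamma -> 0 < vp -> vp < 1 -> 0 < shock_a gamma vp.
Proof.
move=> g1 v0 v1; rewrite /shock_a mulr_gt0 ?powR_gt0// divr_gt0 ?subr_gt0//.
exact: powR_pos_lt1.
Qed.

Lemma shock_aE gamma vp : 1 <= gamma -> 0 < vp -> vp < 1 ->
  shock_a gamma vp * (1 - vp `^ gamma) = vp `^ gamma * (1 - vp).
Proof.
move=> g1 v0 v1; rewrite /shock_a -mulrA divfK// subr_eq0 eq_sym lt_eqF//.
exact: powR_pos_lt1.
Qed.

(* The profile equation reads [v' = v * shock_slope v]. *)
Definition shock_slope gamma a v : R := v - 1 + a * (v `^ (- gamma) - 1).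

Lemma is_derive_shock_slope gamma a v : 0 < v ->
  is_derive v 1 (shock_slope gamma a) (1 - a * gamma * v `^ (- gamma - 1)).
Proof.
move=> v0.
have d1 := is_deriveB (is_derive_id v (1:R)) (is_derive_cst (1:R) v 1).
have d2 := is_deriveZ a (is_deriveB (is_derive1_powR (- gamma) v0) (is_derive_cst (1:R) v 1)).
apply: (@is_derive_eq _ _ _ _ _ _ _ _ (is_deriveD d1 d2)).
by rewrite /GRing.scale/=; ring.
Qed.

Lemma shock_slope1 gamma a : shock_slope gamma a 1 = 0.
Proof. by rewrite /shock_slope powR1; ring. Qed.

Lemma shock_slope_vp gamma vp : 1 <= gamma -> 0 < vp -> vp < 1 ->
  shock_slope gamma (shock_a gamma vp) vp = 0.
Proof.
move=> g1 v0 v1; have P0 : vp `^ gamma != 0 by rewrite gt_eqF// powR_gt0.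
apply: (mulIf P0); rewrite mul0r /shock_slope powRN.
have := shock_aE g1 v0 v1; set a := shock_a _ _ => aE.
have -> : (vp - 1 + a * ((vp `^ gamma)^-1 - 1)) * vp `^ gamma =
  (vp - 1) * vp `^ gamma + a * (1 - vp `^ gamma) by field.
rewrite aE; ring.
Qed.

(** The slope is strictly convex, as its derivative [D] increases, and it vanishes at [vp] and at
    [1]. By Rolle [D] has a zero [xi] in between; applying the mean value theorem between [v] and
    the zero of the slope on the same side of [xi] yields each sign. *)
Lemma shock_slope_signs gamma vp : 1 <= gamma -> 0 < vp -> vp < 1 ->
  let a := shock_a gamma vp in
  [/\ forall v, 1 < v -> 0 < shock_slope gamma a v,
      forall v, 0 < v -> v < vp -> 0 < shock_slope gamma a v &
      forall v, vp <= v <= 1 -> shock_slope gamma a v <= 0].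
Proof.
move=> g1 v0 v1 a; have a0 : 0 < a by exact: shock_a_gt0.
have [D DE] : exists D : R -> R, forall v, D v = 1 - a * gamma * v `^ (- gamma - 1) by eexists.
have d v : 0 < v -> is_derive v 1 (shock_slope gamma a) (D v) by rewrite DE; exact: is_derive_shock_slope.
have Dmono x y : 0 < x -> x < y -> D x < D y.
  move=> x0 xy; rewrite !DE ltrD2l ltrN2 ltr_pM2l; last by rewrite mulr_gt0// (lt_le_trans ltr01).
  have -> : - gamma - 1 = - (gamma + 1) by ring.
  rewrite !powRN ltf_pV2 ?posrE ?powR_gt0//; last exact: lt_trans xy.
  by apply: gt0_ltr_powR; rewrite ?nnegrE ?(ltW x0) ?(ltW (lt_trans x0 xy))//; lra.
have [xi /andP[xi1 xi2] E] := @MVT_at _ D vp 1 v1 (fun c h => d c (lt_le_trans v0 (proj1 (andP h)))).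
have Dxi : D xi = 0.
  move/eqP: E; rewrite shock_slope1 shock_slope_vp// subrr eq_sym mulf_eq0 => /orP[/eqP//|].
  by rewrite gt_eqF// subr_gt0.
have xi0 : 0 < xi by exact: lt_trans xi1.
split.
- move=> v hv; have [c /andP[c1 c2] Ec] := @MVT_at _ D 1 v hv (fun c h => d c (lt_le_trans ltr01 (proj1 (andP h)))).
  rewrite shock_slope1 subr0 in Ec; rewrite Ec mulr_gt0 ?subr_gt0// -Dxi Dmono//.
  exact: lt_trans xi2 c1.
- move=> v hv0 hv; have [c /andP[c1 c2] Ec] := @MVT_at _ D v vp hv (fun c h => d c (lt_le_trans hv0 (proj1 (andP h)))).
  rewrite shock_slope_vp// sub0r in Ec.
  rewrite -oppr_lt0 Ec pmulr_llt0 ?subr_gt0// -Dxi Dmono//; first exact: lt_trans c1.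
  exact: lt_trans xi1.
- move=> v /andP[vpv vle1]; have v0' : 0 < v by exact: lt_le_trans vpv.
  have [vxi|xiv] := leP v xi.
    move: vpv; rewrite le_eqVlt => /predU1P[<-|vpv]; first by rewrite shock_slope_vp.
    have [c /andP[c1 c2] Ec] := @MVT_at _ D vp v vpv (fun c h => d c (lt_le_trans v0 (proj1 (andP h)))).
    rewrite shock_slope_vp// subr0 in Ec; rewrite Ec pmulr_lle0 ?subr_gt0//.
    by rewrite -Dxi ltW// Dmono//; [exact: lt_trans c1|exact: lt_le_trans vxi].
  move: vle1; rewrite le_eqVlt => /predU1P[->|vlt1]; first by rewrite shock_slope1.
  have [c /andP[c1 c2] Ec] := @MVT_at _ D v 1 vlt1 (fun c h => d c (lt_le_trans v0' (proj1 (andP h)))).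
  rewrite shock_slope1 sub0r in Ec; rewrite -oppr_ge0 Ec mulr_ge0//; last by rewrite subr_ge0 ltW.
  by rewrite -Dxi ltW// Dmono//; exact: lt_trans c1.
Qed.

(** * Range of the profile *)

Section Range.
Variables (gamma vp : R) (vh : R -> R).
Hypotheses (g1 : 1 <= gamma) (v0 : 0 < vp) (v1 : vp < 1).
Hypothesis hp : shock_profile gamma vp vh.
Let a := shock_a gamma vp.

Let dv (x : R) : is_derive x 1 vh (vh x * shock_slope gamma a (vh x)).
Proof. by case: hp => _ + _ _; exact. Qed.

Let vpos x : 0 < vh x. Proof. by case: hp. Qed.

Lemma profile_continuous : continuous vh.
Proof. by move=> x; apply/differentiable_continuous/derivable1_diffP; case: (dv x). Qed.

Let vhW A B : {within `[A, B], continuous vh}.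
Proof. by apply: continuous_subspaceT; exact: profile_continuous. Qed.

(** Wherever the profile exceeds [1] it increases. If [vh x > 1], choose [X > x] with [vh X < 1]:
    the maximum over [[x, X]] is above [1] and is not attained at [X], yet just to the right of a
    maximum point [vh] would still grow. *)
Lemma profile_le1 x : vh x <= 1.
Proof.
rewrite leNgt; apply/negP => vx1.
have [X [xX X1]] : exists X, x < X /\ vh X < 1.
  case: hp => _ _ _ /cvgr_lt/(_ _ v1) H.
  exact: (filter_ex (filterI (nbhs_pinfty_gt (num_real x)) H)).
have [c] := EVT_max (ltW xX) (vhW (A := x) (B := X)).
rewrite in_itv/= => /andP[xc cX] cmax.
have vc1 : 1 < vh c by apply: lt_le_trans vx1 _; apply: cmax; rewrite in_itv/= lexx ltW.
have cX' : c < X.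
  by rewrite lt_neqAle cX andbT; apply: contraTneq X1 => <-; rewrite -leNgt ltW.
have [e e0 He] : exists2 e, 0 < e & forall y, `|c - y| < e -> 1 < vh y.
  have cc : vh y @[y --> c] --> vh c by exact: profile_continuous.
  by move/cvgr_gt: cc => /(_ _ vc1)/nbhs_ballP[e /= e0 He]; exists e.
pose y := Num.min (c + e / 2) X.
have cy : c < y by rewrite lt_min cX' andbT ltrDl divr_gt0.
have yX : y <= X by rewrite ge_min lexx orbT.
have ye : y <= c + e / 2 by rewrite ge_min lexx.
have [z /andP[z1 z2] E] := @MVT_at vh _ c y cy (fun z _ => dv z).
have vz : 1 < vh z by apply: He; rewrite distrC gtr0_norm ?subr_gt0//; lra.
have [+ _ _] := shock_slope_signs g1 v0 v1 => /(_ _ vz) sz.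
have : 0 < vh y - vh c by rewrite E mulr_gt0 ?subr_gt0// mulr_gt0.
by rewrite subr_gt0 ltNge cmax// in_itv/= yX andbT (le_trans xc)// ltW.
Qed.

(** The mirror argument: below [vp] the profile increases too, so a minimum over an interval
    reaching left to a value above [vp] would be undercut just to its left. *)
Lemma profile_ge x : vp <= vh x.
Proof.
rewrite leNgt; apply/negP => vx1.
have [X [xX X1]] : exists X, X < x /\ vp < vh X.
  case: hp => _ _ /cvgr_gt/(_ _ v1) H _.
  exact: (filter_ex (filterI (nbhs_ninfty_lt (num_real x)) H)).
have [c] := EVT_min (ltW xX) (vhW (A := X) (B := x)).
rewrite in_itv/= => /andP[xc cX] cmax.
have vc1 : vh c < vp by apply: le_lt_trans vx1; apply: cmax; rewrite in_itv/= lexx ltW.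
have cX' : X < c.
  by rewrite lt_neqAle xc andbT; apply: contraTneq X1 => ->; rewrite -leNgt ltW.
have [e e0 He] : exists2 e, 0 < e & forall y, `|c - y| < e -> vh y < vp.
  have cc : vh y @[y --> c] --> vh c by exact: profile_continuous.
  by move/cvgr_lt: cc => /(_ _ vc1)/nbhs_ballP[e /= e0 He]; exists e.
pose y := Num.max (c - e / 2) X.
have cy : y < c by rewrite gt_max cX' andbT gtrBl divr_gt0.
have yX : X <= y by rewrite le_max lexx orbT.
have ye : c - e / 2 <= y by rewrite le_max lexx.
have [z /andP[z1 z2] E] := @MVT_at vh _ y c cy (fun z _ => dv z).
have vz : vh z < vp by apply: He; rewrite gtr0_norm ?subr_gt0//; lra.
have [_ + _] := shock_slope_signs g1 v0 v1 => /(_ _ (vpos z) vz) sz.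
have : 0 < vh c - vh y by rewrite E mulr_gt0 ?subr_gt0// mulr_gt0.
by rewrite subr_gt0 ltNge cmax// in_itv/= yX/= (le_trans _ cX)// ltW.
Qed.

Lemma profile_slope_le0 x : shock_slope gamma a (vh x) <= 0.
Proof.
by have [_ _] := shock_slope_signs g1 v0 v1; apply; rewrite profile_ge profile_le1.
Qed.

End Range.
End Profile.

(** * Coefficients along the profile and the stability polynomial *)

Section Coefficients.
Context {R : realType}.

(** [q = h(vh) / vh^(gamma + 1)], [b = 1 / q], [d = b / vh] and [r = d']. *)
Record shock_coefficients (gamma vp : R) (vh : R -> R) (s0 q0 d0 B : R)
    (q d b r ds dq db dr : R -> R) : Prop := ShockCoefficients {
  sc_pos : [/\ 0 < s0, 0 < q0, 0 < d0 & 1 <= B];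
  sc_bounds : forall x, coef_bounds s0 q0 d0 B (vh x) (q x) (d x) (b x) (r x) (dq x) (db x) (dr x);
  sc_s : primitive vh ds;
  sc_q : primitive q dq;
  sc_d : primitive d r;
  sc_b : primitive b db;
  sc_r : primitive r dr;
  sc_ds : continuous ds /\ forall x, `|ds x| <= B;
  sc_dq : continuous dq;
  sc_qE : forall x, q x = shock_h gamma (shock_a gamma vp) (vh x) * vh x `^ (- gamma - 1) }.

Lemma is_derive_mul (f g : R -> R) (x df dg : R) :
  is_derive x 1 f df -> is_derive x 1 g dg ->
  is_derive x 1 (fun y => f y * g y) (df * g x + f x * dg).
Proof.
move=> hf hg; apply: (is_derive_eq (is_deriveM hf hg)).
rewrite /GRing.scale/=; ring.
Qed.

Lemma is_derive_add (f g : R -> R) (x df dg : R) :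
  is_derive x 1 f df -> is_derive x 1 g dg ->
  is_derive x 1 (fun y => f y + g y) (df + dg).
Proof. by move=> hf hg; exact: is_deriveD. Qed.

Lemma is_derive_sub (f g : R -> R) (x df dg : R) :
  is_derive x 1 f df -> is_derive x 1 g dg ->
  is_derive x 1 (fun y => f y - g y) (df - dg).
Proof. by move=> hf hg; exact: is_deriveB. Qed.

Lemma is_derive_const (k x : R) : is_derive x 1 (fun=> k : R) 0.
Proof. exact: is_derive_cst. Qed.

Lemma is_derive_div (f g : R -> R) (x df dg : R) : g x != 0 ->
  is_derive x 1 f df -> is_derive x 1 g dg ->
  is_derive x 1 (fun y => f y / g y) ((df * g x - f x * dg) / g x ^+ 2).
Proof.
move=> g0 hf hg.
have := is_deriveM hf (is_deriveV g0 hg) => H.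
apply: (is_derive_eq H).
by rewrite /GRing.scale/=; field.
Qed.

(** The polynomial of the hypothesis at a general [s], with [P] standing for [s ^ gamma]. Keeping
    [P] free makes [bracket_identity] a purely polynomial statement. *)
Definition stability_bracket (gamma a s P : R) : R :=
  (gamma + 1) * s ^+ 2 * P + P * (gamma - 1) * ((gamma + 1) * s - (a + 1) * gamma) ^+ 2
  + a * gamma * (gamma ^+ 2 - 1) * (gamma + 2) * s - a * (a + 1) * gamma ^+ 2 * (gamma ^+ 2 - 1).

(* The derivative of the bracket along [P = s ^ gamma] is [P / s] times this
   quadratic, whose discriminant is nonpositive, plus a nonnegative constant. *)
Lemma bracket_quadratic_ge0 (gamma a s : R) : 1 <= gamma ->
  0 <= gamma * (gamma ^+ 2 * (gamma + 1) * s ^+ 2 - 2 * (a + 1) * gamma * (gamma ^+ 2 - 1) * s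
       + (a + 1) ^+ 2 * gamma ^+ 2 * (gamma - 1))
     + (2 * gamma ^+ 2 * (gamma + 1) * s ^+ 2 - 2 * (a + 1) * gamma * (gamma ^+ 2 - 1) * s).
Proof.
move=> g1; have g0 : 0 < gamma by lra.
(* The expression is [gamma] times [A s^2 - 2 Bq s + (a + 1)^2 gamma^2 (gamma - 1)]; multiplying by
   [A] completes the square. *)
pose A := gamma * (gamma + 1) * (gamma + 2).
pose Bq := (a + 1) * (gamma ^+ 2 - 1) * (gamma + 1).
have A0 : 0 < A by rewrite /A !mulr_gt0//; lra.
rewrite -(pmulr_rge0 _ A0).
have -> : A * (gamma * (gamma ^+ 2 * (gamma + 1) * s ^+ 2 - 2 * (a + 1) * gamma * (gamma ^+ 2 - 1) * s
       + (a + 1) ^+ 2 * gamma ^+ 2 * (gamma - 1))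
     + (2 * gamma ^+ 2 * (gamma + 1) * s ^+ 2 - 2 * (a + 1) * gamma * (gamma ^+ 2 - 1) * s))
  = gamma * ((A * s - Bq) ^+ 2 + (a + 1) ^+ 2 * ((gamma - 1) * (gamma + 1)) * (2 * gamma + 1)).
  by rewrite /A /Bq; ring.
rewrite mulr_ge0 ?(ltW g0)// addr_ge0 ?sqr_ge0// mulr_ge0//; last lra.
by rewrite mulr_ge0 ?sqr_ge0// mulr_ge0//; lra.
Qed.

Lemma stability_bracket_mono (gamma a vp s : R) : 1 <= gamma -> 0 < a -> 0 < vp -> vp <= s ->
  stability_bracket gamma a vp (vp `^ gamma) <= stability_bracket gamma a s (s `^ gamma).
Proof.
move=> g1 a0 v0; rewrite le_eqVlt => /predU1P[->//|vs].
pose q2 c : R := gamma * (gamma ^+ 2 * (gamma + 1) * c ^+ 2 - 2 * (a + 1) * gamma * (gamma ^+ 2 - 1) * c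
       + (a + 1) ^+ 2 * gamma ^+ 2 * (gamma - 1))
     + (2 * gamma ^+ 2 * (gamma + 1) * c ^+ 2 - 2 * (a + 1) * gamma * (gamma ^+ 2 - 1) * c).
pose D c := c `^ (gamma - 1) * q2 c + a * gamma * (gamma ^+ 2 - 1) * (gamma + 2).
have [c /andP[c1 c2] E] : exists2 c, vp < c < s & stability_bracket gamma a s (s `^ gamma) - stability_bracket gamma a vp (vp `^ gamma) = D c * (s - vp).
  apply: (@MVT_at _ (fun c => stability_bracket gamma a c (c `^ gamma)) D) => // c /andP[c1 _].
  have c0 : 0 < c by exact: lt_le_trans c1.
  have dP := is_derive1_powR gamma c0.
  have dc := is_derive_id c (1 : R).
  have PE : c `^ gamma = c `^ (gamma - 1) * c.
    by rewrite -[X in _ * X](powRr1 (ltW c0)) -powRD ?subrK// (gt_eqF c0) implybT.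
  have k t := is_derive_const t c.
  have d1 := is_derive_mul (is_derive_mul (k (gamma + 1)) (is_derive_mul dc dc)) dP.
  have dl := is_derive_sub (is_derive_mul (k (gamma + 1)) dc) (k ((a + 1) * gamma)).
  have d2 := is_derive_mul (is_derive_mul dP (k (gamma - 1))) (is_derive_mul dl dl).
  have d3 := is_derive_mul (k (a * gamma * (gamma ^+ 2 - 1) * (gamma + 2))) dc.
  have := is_derive_sub (is_derive_add (is_derive_add d1 d2) d3) (k (a * (a + 1) * gamma ^+ 2 * (gamma ^+ 2 - 1))).
  by move=> /= H; apply: (is_derive_eq H); rewrite /D /q2 /= PE; ring.
rewrite -subr_ge0 E mulr_ge0//; last by rewrite subr_ge0 ltW.
have g0 : 0 <= gamma by lra.
have a0' := ltW a0.
rewrite /D addr_ge0//; first by rewrite mulr_ge0 ?powR_ge0// bracket_quadratic_ge0.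
rewrite !mulr_ge0//; last lra.
by rewrite subr_ge0 expr_ge1.
Qed.

(** The origin of the polynomial. With the rules [s' = s e / P], [P' = gamma e], [h' = e k], the
    left side is [h^3 (d'' + b') / e] for [d = P / h] and [b = s P / h]. As [e <= 0] along the
    profile, a nonnegative bracket gives [d'' + b' <= 0]. *)
Lemma bracket_identity (gamma a s P : R) :
  let h := - (s * P) + a * (gamma - 1) + (a + 1) * P in
  let k := (a + 1) * gamma - (gamma + 1) * s in
  let e := a * gamma - h in
  - k * (gamma * h - P * k) * h + (gamma + 1) * s * e * h - 2 * e * k * (gamma * h - P * k)
  + s * ((gamma + 1) * h - P * k) * h = a * stability_bracket gamma a s P.
Proof. by rewrite /= /stability_bracket; ring. Qed.

Lemma derive_continuous (f df : R -> R) : (forall x : R, is_derive x 1 f (df x)) -> continuous f.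
Proof. by move=> d x; apply/differentiable_continuous/derivable1_diffP; case: (d x). Qed.

Lemma continuous_mul (f g : R -> R) : continuous f -> continuous g -> continuous (fun x => f x * g x).
Proof. by move=> cf cg x; apply: cvgM; [exact: cf|exact: cg]. Qed.

Lemma continuous_add (f g : R -> R) : continuous f -> continuous g -> continuous (fun x => f x + g x).
Proof. by move=> cf cg x; apply: cvgD; [exact: cf|exact: cg]. Qed.

Lemma continuous_sub (f g : R -> R) : continuous f -> continuous g -> continuous (fun x => f x - g x).
Proof. by move=> cf cg x; apply: cvgB; [exact: cf|exact: cg]. Qed.

Lemma continuous_const (k : R) : continuous (fun _ : R => k).
Proof. by move=> x; exact: cvg_cst. Qed.

Lemma continuous_div (f g : R -> R) : (forall x, g x != 0) ->
  continuous f -> continuous g -> continuous (fun x => f x / g x).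
Proof. by move=> g0 cf cg x; apply: cvgM; [exact: cf|apply: cvgV => //; exact: cg]. Qed.

Lemma norm_le_mul (x y X Y : R) : `|x| <= X -> `|y| <= Y -> `|x * y| <= X * Y.
Proof. by move=> hx hy; rewrite normrM ler_pM. Qed.

Lemma norm_le_sub (x y X Y : R) : `|x| <= X -> `|y| <= Y -> `|x - y| <= X + Y.
Proof. by move=> hx hy; apply: le_trans (ler_normB _ _) (lerD hx hy). Qed.

Lemma norm_le_div (x y X Y : R) : `|x| <= X -> 0 < Y -> Y <= y -> `|x / y| <= X / Y.
Proof.
move=> hx Y0 hy; have y0 : 0 < y by exact: lt_le_trans hy.
rewrite normf_div (gtr0_norm y0) ler_pM ?invr_ge0 ?(ltW y0)// lef_pV2 ?posrE//.
Qed.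

(** * Explicit coefficients and their uniform bounds *)

Section Existence.
Variables (gamma vp : R) (vh : R -> R).
Hypotheses (g1 : 1 <= gamma) (v0 : 0 < vp) (v1 : vp < 1).
Hypothesis hp : shock_profile gamma vp vh.

(** [e] equals [P * shock_slope], so the profile equation reads [vh' = vh * e / P]. In the atoms
    [vh], [P], [h], [e], [k], differentiation along the profile becomes rational, and [e] inherits
    the sign of the slope. *)
Lemma profile_derivatives (a := shock_a gamma vp) :
  let P x := vh x `^ gamma in
  let h x := - (vh x * P x) + a * (gamma - 1) + (a + 1) * P x in
  let e x := a * gamma - h x in
  let k x := (a + 1) * gamma - (gamma + 1) * vh x in
  forall x : R, [/\ is_derive x 1 vh (vh x * e x / P x), is_derive x 1 P (gamma * e x),
    is_derive x 1 h (e x * k x) & e x <= 0].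
Proof.
move=> P h e k x; have s0 : 0 < vh x by case: hp.
have P0 : 0 < P x by exact: powR_gt0.
have sl : shock_slope gamma a (vh x) = e x / P x.
  rewrite /shock_slope powRN -/(P x) /e /h; field; exact: lt0r_neq0.
have dv : is_derive x 1 vh (vh x * e x / P x).
  by rewrite -mulrA -sl; case: hp => _ + _ _; exact.
have dP : is_derive x 1 P (gamma * e x).
  have := @is_derive1_comp R (fun y : R => y `^ gamma) vh x _ _ (is_derive1_powR gamma s0) dv.
  have -> : gamma * vh x `^ (gamma - 1) * (vh x * e x / P x) = gamma * e x; last by [].
  have -> : P x = vh x `^ (gamma - 1) * vh x.
    by rewrite -[X in _ * X](powRr1 (ltW s0)) -powRD ?subrK// (gt_eqF s0) implybT.
  have q0 : vh x `^ (gamma - 1) != 0 by rewrite gt_eqF// powR_gt0.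
  by field; rewrite q0 lt0r_neq0.
split=> //.
  have c t := is_derive_const t x.
  have := is_derive_add (is_derive_add (is_derive_mul (c (-1)) (is_derive_mul dv dP)) (c (a * (gamma - 1)))) (is_derive_mul (c (a + 1)) dP).
  have -> : (fun y => -1 * (vh y * P y) + a * (gamma - 1) + (a + 1) * P y) = h.
    by apply/funext => y; rewrite /h mulN1r.
  move=> H; apply: (is_derive_eq H); rewrite /k; field; exact: lt0r_neq0.
have := profile_slope_le0 g1 v0 v1 hp x; rewrite -/a sl.
by rewrite pmulr_lle0// invr_gt0.
Qed.

Hypothesis hcond : let a := shock_a gamma vp in
    0 <= (gamma + 1) * vp `^ (gamma + 2)
         + vp `^ gamma * (gamma - 1) * ((gamma + 1) * vp - (a + 1) * gamma) ^+ 2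
         + a * gamma * (gamma ^+ 2 - 1) * (gamma + 2) * vp
         - a * (a + 1) * gamma ^+ 2 * (gamma ^+ 2 - 1).

Lemma bracket_ge0 s : vp <= s -> 0 <= stability_bracket gamma (shock_a gamma vp) s (s `^ gamma).
Proof.
move=> vs; apply: le_trans (stability_bracket_mono g1 (shock_a_gt0 g1 v0 v1) v0 vs).
move: hcond => /=; rewrite /stability_bracket powRD; last by rewrite (gt_eqF v0) implybT.
by rewrite powR_mulrn ?(ltW v0)// [vp `^ gamma * vp ^+ 2]mulrC mulrA.
Qed.

Lemma shock_coefficients_exist : exists s0 q0 d0 B q d b r ds dq db dr,
  shock_coefficients gamma vp vh s0 q0 d0 B q d b r ds dq db dr.
Proof.
have g1' : 1 <= gamma := g1.
have a0 := shock_a_gt0 g1 v0 v1; have D := profile_derivatives.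
have rg := fun x => conj (profile_ge g1 v0 v1 hp x) (profile_le1 g1 v0 v1 hp x).
have br := fun x => bracket_ge0 (proj1 (rg x)).
move: a0 D br; rewrite /=.
have [a aE] : exists a, a = shock_a gamma vp by eexists.
rewrite -aE => a0.
pose P x := vh x `^ gamma.
pose h x := - (vh x * P x) + a * (gamma - 1) + (a + 1) * P x.
pose e x := a * gamma - h x.
pose k x := (a + 1) * gamma - (gamma + 1) * vh x.
move=> D br.
have ds (x : R) : is_derive x 1 vh (vh x * e x / P x) by case: (D x).
have dP (x : R) : is_derive x 1 P (gamma * e x) by case: (D x).
have dh (x : R) : is_derive x 1 h (e x * k x) by case: (D x).
have e0 x : e x <= 0 by case: (D x).
have dk (x : R) : is_derive x 1 k (- (gamma + 1) * (vh x * e x / P x)).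
  have := is_derive_sub (is_derive_const ((a + 1) * gamma) x) (is_derive_mul (is_derive_const (gamma + 1) x) (ds x)).
  by move=> H; apply: (is_derive_eq H); ring.
have de (x : R) : is_derive x 1 e (- (e x * k x)).
  have := is_derive_sub (is_derive_const (a * gamma) x) (dh x).
  by move=> H; apply: (is_derive_eq H); ring.
have s0 x : 0 < vh x by case: hp.
have P0 x : 0 < P x by exact: powR_gt0.
have ag : 0 < a * gamma by rewrite mulr_gt0// (lt_le_trans ltr01).
(* The sign of [e] keeps [h] away from zero; hence [q] is positive and [b], [d] are bounded. *)
have hge x : a * gamma <= h x by rewrite -subr_le0; exact: e0.
have h0 x : 0 < h x by exact: lt_le_trans (hge x).
pose p0 := vp `^ gamma; pose H := a * (gamma - 1) + (a + 1); pose Kk := (a + 1) * gamma + (gamma + 1).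
have p00 : 0 < p0 by exact: powR_gt0.
have Pge x : p0 <= P x.
  apply: ge0_ler_powR; rewrite ?nnegrE ?(ltW v0) ?(ltW (s0 x))//; last by case: (rg x).
  exact: le_trans g1.
have ag2 x : (a * gamma) ^+ 2 <= h x ^+ 2 by rewrite !expr2; apply: ler_pM => //; exact: ltW.
have P2 x : p0 ^+ 2 <= P x ^+ 2 by rewrite !expr2; apply: ler_pM => //; exact: ltW.
have Ple x : P x <= 1.
  rewrite -[leRHS](_ : 1 `^ gamma = 1); last by rewrite powR1.
  apply: ge0_ler_powR; rewrite ?nnegrE ?(ltW (s0 x))//; last by case: (rg x).
  exact: le_trans g1.
have hle x : h x <= H.
  rewrite /h /H; have : 0 <= vh x * P x by rewrite mulr_ge0 ?(ltW (s0 x)) ?(ltW (P0 x)).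
  have : (a + 1) * P x <= (a + 1) * 1 by rewrite ler_wpM2l// addr_ge0// ltW.
  rewrite mulr1; lra.
have H0 : 0 < H by exact: lt_le_trans (h0 0) (hle 0).
have hn x : `|h x| <= H by rewrite gtr0_norm.
have Pn x : `|P x| <= 1 by rewrite gtr0_norm.
have sn x : `|vh x| <= 1 by rewrite gtr0_norm//; case: (rg x).
have en x : `|e x| <= H.
  by rewrite ler0_norm// /e; have := hle x; have := hge x; lra.
have kn x : `|k x| <= Kk.
  rewrite /k /Kk; apply: norm_le_sub; first by rewrite ger0_norm// mulr_ge0//; lra.
  rewrite -[leRHS]mulr1; apply: norm_le_mul => //; by rewrite ger0_norm//; lra.
have gn : `|gamma| <= gamma by rewrite ger0_norm//; lra.
have gn1 : `|gamma + 1| <= gamma + 1 by rewrite ger0_norm//; lra.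
(* [B1] to [B5] bound [q], [d], [r], [dq] and [ds]; [B] is their sum plus 1, and also covers
   [vh <= 1] and [b <= d]. *)
pose B1 := H / (vp * p0); pose B2 := (a * gamma)^-1.
pose B3 := H * (gamma * H + 1 * Kk) / (a * gamma) ^+ 2.
pose B4 := H * (Kk * 1 + (gamma + 1) * H) / (vp * p0 ^+ 2).
pose B5 := 1 * H / p0.
have Kk0 : 0 <= Kk by rewrite /Kk; apply: addr_ge0; [apply: mulr_ge0|]; lra.
have b10 : 0 <= B1 by rewrite divr_ge0 ?mulr_ge0 ?(ltW _).
have b20 : 0 <= B2 by rewrite invr_ge0 ltW.
have b30 : 0 <= B3.
  by rewrite divr_ge0 ?sqr_ge0// mulr_ge0 ?(ltW H0)// addr_ge0// mulr_ge0 ?(ltW H0)//; lra.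
have b40 : 0 <= B4.
  apply: divr_ge0; last by rewrite mulr_ge0 ?sqr_ge0// ltW.
  apply: mulr_ge0; first exact: ltW.
  by apply: addr_ge0; apply: mulr_ge0 => //; [lra|exact: ltW].
have b50 : 0 <= B5 by rewrite divr_ge0 ?(ltW p00)// mul1r ltW.
have [B BE] : exists B, B = 1 + B1 + B2 + B3 + B4 + B5 by eexists.
have g0 : 0 < gamma by exact: lt_le_trans g1.
have nP x : P x != 0 by rewrite gt_eqF.
have nh x : h x != 0 by rewrite gt_eqF.
have ns x : vh x != 0 by rewrite gt_eqF.
have nsP x : vh x * P x != 0 by rewrite mulf_neq0.
have cs := derive_continuous ds; have cP := derive_continuous dP.
have ch := derive_continuous dh; have ce := derive_continuous de; have ck := derive_continuous dk.
pose N x := gamma * h x - P x * k x.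
have cN : continuous N.
  by apply: continuous_sub; apply: continuous_mul => //; exact: continuous_const.
have cN1 : continuous (fun x => (gamma + 1) * h x - P x * k x).
  by apply: continuous_sub; apply: continuous_mul => //; exact: continuous_const.
have ch2 : continuous (fun x => h x ^+ 2) by exact: continuous_mul.
have ch3 : continuous (fun x => h x ^+ 3) by apply: continuous_mul => //; exact: continuous_mul.
have nh2 x : h x ^+ 2 != 0 by rewrite expf_neq0.
have nh3 x : h x ^+ 3 != 0 by rewrite expf_neq0.
pose q x := h x / (vh x * P x).
pose d x := P x / h x.
pose b x := vh x * P x / h x.
pose r x := e x * N x / h x ^+ 2.
pose dq x := e x * (k x * P x - (gamma + 1) * h x) / (vh x * P x ^+ 2).
pose db x := e x * vh x * ((gamma + 1) * h x - P x * k x) / h x ^+ 2.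
pose dr x := e x * (- k x * N x * h x + (gamma + 1) * vh x * e x * h x - 2 * e x * k x * N x) / h x ^+ 3.
have Dq (x : R) : is_derive x 1 q (dq x).
  have Hd := @is_derive_div h (fun y => vh y * P y) x _ _ (nsP x) (dh x) (is_derive_mul (ds x) (dP x)).
  by apply: (is_derive_eq Hd); rewrite /dq; field; rewrite nP ns.
have Dd (x : R) : is_derive x 1 d (r x).
  have Hd := @is_derive_div P h x _ _ (nh x) (dP x) (dh x).
  by apply: (is_derive_eq Hd); rewrite /r /N; field; rewrite nh.
have Db (x : R) : is_derive x 1 b (db x).
  have Hd := @is_derive_div (fun y => vh y * P y) h x _ _ (nh x) (is_derive_mul (ds x) (dP x)) (dh x).
  by apply: (is_derive_eq Hd); rewrite /db; field; rewrite nP nh.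
have Dr (x : R) : is_derive x 1 r (dr x).
  have dN := is_derive_sub (is_derive_mul (is_derive_const gamma x) (dh x)) (is_derive_mul (dP x) (dk x)).
  have Hd := @is_derive_div (fun y => e y * N y) (fun y => h y ^+ 2) x _ _ (nh2 x) (is_derive_mul (de x) dN) (is_derive_mul (dh x) (dh x)).
  apply: (is_derive_eq Hd); rewrite /dr /N; field; by rewrite nP nh.
have cdq : continuous dq.
  apply: continuous_div; last 2 first.
  - apply: continuous_mul => //; apply: continuous_sub; apply: continuous_mul => //; exact: continuous_const.
  - by apply: continuous_mul => //; exact: continuous_mul.
  - by move=> x; rewrite mulf_neq0// expf_neq0.
have cr : continuous r by apply: continuous_div => //; exact: continuous_mul.
have cdb : continuous db.
  by apply: continuous_div => //; apply: continuous_mul => //; exact: continuous_mul.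
have cdr : continuous dr.
  apply: continuous_div => //; apply: continuous_mul => //.
  apply: continuous_sub; first apply: continuous_add.
  - apply: continuous_mul => //; apply: continuous_mul => //.
    by move=> x; apply: cvgN; exact: ck.
  - by do 3! (apply: continuous_mul => //); exact: continuous_const.
  - by do 3! (apply: continuous_mul => //); exact: continuous_const.
have cds : continuous (fun x => vh x * e x / P x).
  by apply: continuous_div => //; exact: continuous_mul.
have Hi0 : 0 < H^-1 by rewrite invr_gt0.
(* Lower bounds: [vh >= vp]; [q = h / (vh * P) >= a * gamma] because [vh * P <= 1];
   [d = P / h >= p0 / H]. *)
exists vp, (a * gamma), (p0 / H), B, q, d, b, r, (fun x => vh x * e x / P x), dq, db, dr.
have dle x : d x <= B.
  apply: (@le_trans _ _ B2); last by rewrite BE; lra.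
  rewrite -[B2]mul1r; have := norm_le_div (Pn x) ag (hge x); apply: le_trans; exact: ler_norm.
have dge x : p0 / H <= d x by rewrite /d ler_pM ?(ltW p00) ?(ltW Hi0)// lef_pV2 ?posrE.
split.
- by split => //; [exact: divr_gt0|rewrite BE; lra].
- move=> x; split.
  + case: (rg x) => -> /= h2; apply: le_trans h2 _; rewrite BE; lra.
  + apply/andP; split.
      rewrite /q ler_pdivlMr ?mulr_gt0//; apply: le_trans (hge x).
      rewrite ger_pMr//; rewrite -[leRHS]mulr1; apply: ler_pM; rewrite ?(ltW (s0 x)) ?(ltW (P0 x))//.
      by case: (rg x).
    apply: (@le_trans _ _ B1); last by rewrite BE; lra.
    apply: le_trans (ler_norm _) _; apply: norm_le_div => //; first exact: mulr_gt0.
    by apply: ler_pM; rewrite ?(ltW v0) ?(ltW p00)//; case: (rg x).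
  + by rewrite dge dle.
  + apply/andP; split; first by rewrite divr_ge0 ?mulr_ge0 ?(ltW _).
    apply: (@le_trans _ _ (d x)) => //; rewrite /b -mulrA ger_pMl ?divr_gt0//; by case: (rg x).
  + apply: (@le_trans _ _ B3); last by rewrite BE; lra.
    apply: norm_le_div; [|by rewrite exprn_gt0|exact: ag2].
    by apply: norm_le_mul => //; apply: norm_le_sub; exact: norm_le_mul.
  + apply: (@le_trans _ _ B4); last by rewrite BE; lra.
    apply: norm_le_div; last 2 first.
    * by rewrite mulr_gt0// exprn_gt0.
    * by apply: ler_pM; [exact: ltW|exact: sqr_ge0|case: (rg x)|exact: P2].
    by apply: norm_le_mul => //; apply: norm_le_sub; exact: norm_le_mul.
  + by rewrite /d /b mulrAC [vh x * _]mulrC.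
  + by rewrite /b /q; field; rewrite nh nP ns.
  (* The only use of the polynomial hypothesis: [e <= 0] times a nonnegative bracket over a positive
     cube. *)
  + have -> : dr x + db x = e x * (a * stability_bracket gamma a (vh x) (P x)) / h x ^+ 3.
      rewrite -bracket_identity -/(h x) -/(e x) -/(k x) /dr /db /N; field; exact: nh.
    rewrite pmulr_lle0 ?invr_gt0 ?exprn_gt0//; apply: mulr_le0_ge0 => //.
    by rewrite mulr_ge0// ltW.
- exact: primitive_C1.
- exact: primitive_C1.
- exact: primitive_C1.
- exact: primitive_C1.
- exact: primitive_C1.
- split => // x; apply: (@le_trans _ _ B5); last by rewrite BE; lra.
  by apply: norm_le_div => //; exact: norm_le_mul.
- exact: cdq.
- move=> x; rewrite /shock_h -aE powRD; last by rewrite (gt_eqF (s0 x)) implybT.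
  have -> : - gamma - 1 = - (gamma + 1) by ring.
  rewrite powRN powRD; last by rewrite (gt_eqF (s0 x)) implybT.
  rewrite powRr1 ?(ltW (s0 x))// /q /h -/(P x) [vh x * P x]mulrC; ring.
Qed.

End Existence.
End Coefficients.

(** * Passage to the whole line *)

Section WholeLine.
Context {R : realType}.
Local Notation mu := (@lebesgue_measure R).
Variables (I : finType) (A : I -> I -> R -> R) (Ka : R).
Variables (S : R -> (I -> R) -> R) (c K : R) (adm : (I -> R -> R) -> Prop).
Implicit Types (W f : I -> R -> R) (a b x y : R).

Definition sol a b W f := forall i,
  primitive_on a b (W i) (fun x => \sum_j A i j x * W j x + f i x).

Definition n2 W x : R := \sum_i W i x ^+ 2.

Lemma n2_ge0 W x : 0 <= n2 W x.
Proof. by apply: sumr_ge0 => i _; exact: sqr_ge0. Qed.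

Lemma sol_sub a b x y W f : a <= x -> y <= b -> sol a b W f -> sol x y W f.
Proof. by move=> ax yb h i; exact: primitive_on_sub (h i). Qed.

Lemma sol_lin a b k W1 W2 f1 f2 : sol a b W1 f1 -> sol a b W2 f2 ->
  sol a b (fun i x => W1 i x + k * W2 i x) (fun i x => f1 i x + k * f2 i x).
Proof.
move=> h1 h2 i; apply: (eq_primitive_on _ _ (primitive_onD (h1 i) (primitive_onZ k (h2 i)))) => // x _.
rewrite mulrDr addrACA; congr (_ + _); rewrite mulr_sumr -big_split/=.
by apply: eq_bigr => j _; ring.
Qed.

Lemma primitive_on_sum a b (F g : I -> R -> R) : (forall i, primitive_on a b (F i) (g i)) ->
  primitive_on a b (fun x => \sum_i F i x) (fun x => \sum_i g i x).
Proof.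
move=> h; elim: (index_enum I) => [|i s IH].
  by apply: (eq_primitive_on _ _ (primitive_on_cst a b 0)) => x _; rewrite big_nil.
by apply: (eq_primitive_on _ _ (primitive_onD (h i) IH)) => x _; rewrite big_cons.
Qed.

Lemma sol_continuous a b W f i : a <= b -> sol a b W f -> {within `[a, b], continuous (W i)}.
Proof. by move=> ab h; exact: primitive_on_continuous (h i). Qed.

Lemma sol_n2_intg a b W f : a <= b -> sol a b W f -> intg (n2 W) a b.
Proof.
move=> ab h; apply: intg_sum => i.
have cW : {within `[a, b], continuous (W i)} by exact: sol_continuous h.
apply: (eq_intg _ (intg_mulr cW (continuous_on_intg cW))) => x _.
by rewrite expr2.
Qed.

(** The interface between the concrete system and the limit argument. [adm] selects the forcings for
    which the energy inequality is available; it contains 0 so that differences of solutions can be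
    treated as homogeneous solutions. *)
Record energy_system : Prop := EnergySystem {
  es_Ka : 0 <= Ka;
  es_A : forall i j x, `|A i j x| <= Ka;
  es_c : 0 < c;
  es_K : 0 <= K;
  es_S : forall x w, `|S x w| <= K * \sum_i w i ^+ 2;
  es_adm : adm (fun _ _ => 0);
  es_energy : forall a b W f, a <= b -> adm f ->
    (forall i, intg (fun x => f i x ^+ 2) a b) -> sol a b W f ->
    c * \int[mu]_(x in `[a, b]) n2 W x <=
    K * \int[mu]_(x in `[a, b]) n2 f x + (S b (W^~ b) - S a (W^~ a)) }.

Hypothesis es : energy_system.

(** The rate in [(|W|^2)' <= Kb |W|^2 + |f|^2]: the matrix contributes [2 |I| Ka], and
    [2 <W, f> <= |W|^2 + |f|^2] contributes 1. *)
Let Kb := 2 * (#|I|%:R * Ka) + 1.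

Lemma sol_growth a b W f : a <= b -> (forall i, intg (fun x => f i x ^+ 2) a b) -> sol a b W f ->
  n2 W b - n2 W a <= \int[mu]_(x in `[a, b]) (Kb * n2 W x + n2 f x).
Proof.
have Ka0 := es_Ka es; have AK := es_A es.
move=> ab f2 h.
have p := primitive_on_sum (fun i => primitive_onM (h i) (h i)).
have [gi E] := p; have {E} := E a b (lexx a) ab (lexx b).
have EW x : \sum_i W i x * W i x = n2 W x by apply: eq_bigr => i _; rewrite expr2.
rewrite !EW => ->.
have Wi := sol_n2_intg ab h.
apply: le_Rint => //.
  by apply: intgD; [exact: intgZ|exact: intg_sum].
move=> x _; rewrite /n2 mulr_sumr -big_split/=.
have AW : \sum_i W i x * \sum_j A i j x * W j x <= #|I|%:R * Ka * n2 W x.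
  apply: (@le_trans _ _ (\sum_i \sum_j Ka * ((W i x ^+ 2 + W j x ^+ 2) / 2))).
    apply: ler_sum => i _; rewrite mulr_sumr; apply: ler_sum => j _.
    apply: le_trans (ler_norm _) _; rewrite mulrCA normrM; apply: ler_pM => //.
    rewrite normrM; have := sqr_ge0 (`|W i x| - `|W j x|); rewrite sqrrB !real_normK ?num_real//.
    lra.
  rewrite le_eqVlt; apply/orP; left; apply/eqP.
  under eq_bigr do rewrite -mulr_sumr.
  rewrite -mulr_sumr -mulrA [RHS]mulrCA; congr (_ * _).
  under eq_bigr do rewrite -mulr_suml big_split/=.
  rewrite -mulr_suml big_split/= sumr_const.
  under eq_bigr do rewrite sumr_const.
  rewrite sumrMnl -/(n2 W x) -[_ *+ _]mulr_natl.
  by transitivity ((#|I|%:R * n2 W x + #|I|%:R * n2 W x) / 2); last field.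
apply: (@le_trans _ _ (2 * (\sum_i W i x * \sum_j A i j x * W j x) + (n2 W x + n2 f x))).
  rewrite mulr_sumr /n2 -!big_split/=; apply: ler_sum => i _.
  by have := sqr_ge0 (W i x - f i x); rewrite sqrrB; lra.
rewrite /Kb big_split/= -mulr_sumr -/(n2 W x) -/(n2 f x).
move: AW; rewrite mulrDl; lra.
Qed.

(** By [sol_growth], [|W(x)|^2 <= |W(y)|^2 + J] for every [y] in [[x - 1, x]]; averaging over this
    interval of length 1 turns an integral bound into a pointwise one. *)
Lemma sol_pointwise x W f : (forall i, intg (fun x => f i x ^+ 2) (x - 1) x) -> sol (x - 1) x W f ->
  n2 W x <= (Kb + 1) * \int[mu]_(t in `[x - 1, x]) n2 W t + \int[mu]_(t in `[x - 1, x]) n2 f t.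
Proof.
have Ka0 := es_Ka es.
move=> f2 h; have x1 : x - 1 <= x by lra.
have Wi := sol_n2_intg x1 h.
have fi : intg (n2 f) (x - 1) x by exact: intg_sum.
have Kb0 : 0 <= Kb by rewrite /Kb addr_ge0// mulr_ge0// mulr_ge0.
pose J := Kb * \int[mu]_(t in `[x - 1, x]) n2 W t + \int[mu]_(t in `[x - 1, x]) n2 f t.
have gi a : x - 1 <= a -> intg (fun t => Kb * n2 W t + n2 f t) a x.
  by move=> ax; apply: (intg_sub ax (lexx x)); apply: intgD => //; exact: intgZ.
have JE : \int[mu]_(t in `[x - 1, x]) (Kb * n2 W t + n2 f t) = J.
  by rewrite RintegralD//; [rewrite RintegralZl|exact: intgZ].
have H y : x - 1 <= y <= x -> n2 W x - J <= n2 W y.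
  move=> /andP[y1 y2].
  have := @sol_growth y x W f y2 (fun i => intg_sub y1 (lexx x) (f2 i)) (sol_sub y1 (lexx x) h).
  have : \int[mu]_(t in `[y, x]) (Kb * n2 W t + n2 f t) <= J.
    rewrite -JE (Rint_split y1 y2 (gi _ (lexx _))) lerDr; apply: Rintegral_ge0 => t _.
    by rewrite addr_ge0 ?n2_ge0// mulr_ge0 ?n2_ge0.
  lra.
have := le_Rint (intg_cst (x - 1) x (n2 W x - J)) Wi H.
rewrite Rint_cst//; have -> : x - (x - 1) = 1 by ring.
rewrite /J mulr1; lra.
Qed.

Lemma sub_Rint (g : R -> R) a b x y : a <= x -> x <= y -> y <= b -> intg g a b ->
  (forall t, 0 <= g t) -> \int[mu]_(t in `[x, y]) g t <= \int[mu]_(t in `[a, b]) g t.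
Proof.
move=> ax xy yb gi g0.
rewrite (Rint_split ax (le_trans xy yb) gi) (Rint_split xy yb (intg_sub ax (lexx b) gi)).
have h1 : 0 <= \int[mu]_(t in `[a, x]) g t by exact: Rintegral_ge0.
have h2 : 0 <= \int[mu]_(t in `[y, b]) g t by exact: Rintegral_ge0.
by rewrite addrCA lerDl addr_ge0.
Qed.

(* Average the energy inequality on [x, y] over [x] in [-N, -m], [y] in [m, N]. *)
Lemma interior_bound m N W f : 0 <= m -> m < N -> adm f ->
  (forall i, intg (fun x => f i x ^+ 2) (- N) N) -> sol (- N) N W f ->
  c * \int[mu]_(x in `[- m, m]) n2 W x * (N - m) <=
  K * \int[mu]_(x in `[- N, N]) n2 f x * (N - m) + K * \int[mu]_(x in `[- N, N]) n2 W x.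
Proof.
have ra1 (X w z n : R) : (X - K * w) * n <= z -> X * n - z <= n * K * w by move=> ?; lra.
have ra2 (z1 z2 z3 z4 z5 n : R) : (c * z5 - K * z4) * n <= K * z1 + K * z2 ->
  K * (z1 + z2) <= K * z3 -> c * z5 * n <= K * z4 * n + K * z3 by move=> ? ?; lra.
have ra3 (z1 z2 z3 z4 s1 s2 w1 w2 : R) : `|s1| <= K * w1 -> `|s2| <= K * w2 ->
  c * z3 <= c * z4 -> K * z1 <= K * z2 -> c * z4 <= K * z1 + (s1 - s2) ->
  c * z3 - K * z2 <= K * w1 + K * w2.
  have := ler_norm s1; have := ler_norm (- s2); rewrite normrN => *; lra.
have c0 := es_c es; have K0 := es_K es; have SK := es_S es; have energy := es_energy es.
move=> m0 mN af f2 h.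
have NN : - N <= N by lra.
have Nm : - N <= - m by lra.
have mm : - m <= m by lra.
have mN' : m <= N by lra.
have Wi := sol_n2_intg NN h.
have fi : intg (n2 f) (- N) N by exact: intg_sum.
have [X XE] : exists X, X = c * \int[mu]_(x in `[- m, m]) n2 W x - K * \int[mu]_(x in `[- N, N]) n2 f x by eexists.
have H x y : - N <= x <= - m -> m <= y <= N -> X <= K * n2 W y + K * n2 W x.
  move=> /andP[x1 x2] /andP[y1 y2].
  have xy : x <= y by lra.
  have L := energy _ _ _ _ xy af (fun i => intg_sub x1 y2 (f2 i)) (sol_sub x1 y2 h).
  have e1 := sub_Rint x2 mm y1 (intg_sub x1 y2 Wi) (n2_ge0 W).
  have e2 := sub_Rint x1 xy y2 fi (n2_ge0 f).
  rewrite XE; apply: ra3 (SK y (W^~ y)) (SK x (W^~ x)) (ler_wpM2l (ltW c0) e1) (ler_wpM2l K0 e2) L.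
have i1 : intg (n2 W) m N by apply: intg_sub Wi; lra.
have i2 : intg (n2 W) (- N) (- m) by apply: intg_sub Wi; lra.
have H1 x : - N <= x <= - m -> (X - K * n2 W x) * (N - m) <= K * \int[mu]_(y in `[m, N]) n2 W y.
  move=> hx; rewrite -Rint_cst// -RintegralZl//.
  apply: le_Rint; [exact: intg_cst|exact: intgZ|] => y hy.
  by have := H x y hx hy; rewrite -lerBlDr.
have H2 : X * (N - m) <= K * \int[mu]_(y in `[m, N]) n2 W y + K * \int[mu]_(y in `[- N, - m]) n2 W y.
  (* Averaging over [y] and then over [x] produces [(N - m)^2] on the left; one factor is divided
     out. *)
  have Nm0 : 0 < N - m by rewrite subr_gt0.
  rewrite -(ler_pM2r Nm0).
  have : (X * (N - m) - K * \int[mu]_(y in `[m, N]) n2 W y) * (- m - - N) <=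
         \int[mu]_(x in `[- N, - m]) ((N - m) * K * n2 W x).
    rewrite -Rint_cst//; apply: le_Rint; [exact: intg_cst|exact: intgZ|].
    by move=> x hx; apply: ra1; exact: H1.
  rewrite RintegralZl//.
  have -> : - m - - N = N - m by ring.
  move: (\int[mu]_(y in `[m, N]) n2 W y) (\int[mu]_(x in `[- N, - m]) n2 W x) => z1 z2 hz.
  by move: hz; rewrite mulrBl lerBlDr mulrDl; congr (_ <= _); ring.
have e : \int[mu]_(y in `[m, N]) n2 W y + \int[mu]_(y in `[- N, - m]) n2 W y <= \int[mu]_(x in `[- N, N]) n2 W x.
  rewrite (Rint_split Nm (le_trans mm mN') Wi) (Rint_split mm mN' (intg_sub Nm (lexx N) Wi)).
  by rewrite addrC lerD2l lerDr; apply: Rintegral_ge0 => t _; exact: n2_ge0.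
rewrite XE in H2; exact: ra2 H2 (ler_wpM2l K0 e).
Qed.

End WholeLine.

(** * Integrals over the line as limits over growing intervals *)

Section LineIntegrals.
Context {R : realType}.
Local Notation mu := (@lebesgue_measure R).
Implicit Types (g : R -> R).

Lemma Rint_le_line g a b : (forall x, 0 <= g x) -> mu.-integrable setT (EFin \o g) ->
  \int[mu]_(x in `[a, b]) g x <= \int[mu]_x g x.
Proof.
move=> g0 gi; have mg := measurable_int _ gi.
have gab : mu.-integrable `[a, b] (EFin \o g) by exact: integrableS gi.
apply: fine_le; [exact: integrable_fin_num|exact: integrable_fin_num|].
by apply: ge0_subset_integral => // x _; rewrite lee_fin.
Qed.

Lemma line_of_bounded g E : (forall x, 0 <= g x) -> locint g ->
  (forall m, 0 <= m -> \int[mu]_(x in `[- m, m]) g x <= E) ->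
  mu.-integrable setT (EFin \o g) /\ \int[mu]_x g x <= E.
Proof.
move=> g0 gi gE.
have mg := locint_measurable gi.
have mgE : measurable_fun setT (EFin \o g) by exact/measurable_EFinP.
pose F n : set R := `[- n%:R, n%:R]%classic.
have FT : setT = \bigcup_n F n.
  apply/seteqP; split=> // x _; exists (Num.bound `|x|) => //=.
  by rewrite /F /= in_itv/= -ler_norml ltW// archi_boundP.
have C : (\int[mu]_(x in F n) (EFin \o g) x)%E @[n --> \oo] --> (\int[mu]_x (EFin \o g) x)%E.
  rewrite [X in (\int[mu]_(x in X) _)%E]FT; apply: ge0_nondecreasing_set_cvg_integral => //.
  - move=> n m nm; apply/subsetPset => x; rewrite /F /= !in_itv/= -!ler_norml => /le_trans; apply.
    by rewrite ler_nat.
  - by move=> n; exact: measurable_itv.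
  - by move=> n; exact: measurable_funTS.
  - by move=> n x _; rewrite lee_fin.
have le : (\int[mu]_x (EFin \o g) x <= E%:E)%E.
  move/cvg_lim: C => <-//; apply: lime_le.
    apply: ereal_nondecreasing_is_cvgn => n m nm.
    apply: ge0_subset_integral => //.
    - exact: measurable_itv.
    - exact: measurable_itv.
    - exact: measurable_funTS.
    - by move=> x _; rewrite lee_fin.
    - by move=> x; rewrite /F /= !in_itv/= -!ler_norml => /le_trans; apply; rewrite ler_nat.
  apply: nearW => n.
  have := gE n%:R (ler0n _ _); rewrite -lee_fin /Rintegral fineK//; by apply: integrable_fin_num => //; exact: gi.
have gT : mu.-integrable setT (EFin \o g).
  apply/integrableP; split=> //; apply: le_lt_trans (ltry E); apply: le_trans le.
  by rewrite le_eqVlt; apply/orP; left; apply/eqP; apply: eq_integral => x _ /=; rewrite ger0_norm.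
by split=> //; rewrite -lee_fin /Rintegral fineK//; exact: integrable_fin_num.
Qed.

End LineIntegrals.

(** * Energy bound and existence on the whole line *)

Section Solve.
Context {R : realType}.
Local Notation mu := (@lebesgue_measure R).
Variables (I : finType) (A : I -> I -> R -> R) (Ka : R).
Variables (S : R -> (I -> R) -> R) (c K : R) (adm : (I -> R -> R) -> Prop).
Implicit Types (W f : I -> R -> R) (a b x y : R).
Hypothesis es : energy_system A Ka S c K adm.

Definition square_integrable f :=
  (forall i a b, intg (fun x => f i x ^+ 2) a b) /\ mu.-integrable setT (EFin \o n2 f).

Lemma n2_locint f : (forall i a b, intg (fun x => f i x ^+ 2) a b) -> locint (n2 f).
Proof. by move=> h a b; apply: intg_sum => i; exact: h. Qed.

(** Divide [interior_bound] by [N - m]: the boundary contribution is at most the total energy of [W]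
    times [K / (N - m)] and vanishes as [N] grows, so that square integrability replaces any decay
    at infinity. *)
Lemma line_bound W f : adm f -> square_integrable f -> square_integrable W ->
  (forall a b, sol A a b W f) ->
  c * \int[mu]_x n2 W x <= K * \int[mu]_x n2 f x.
Proof.
have ra1 (J F Z m n : R) : 0 < n - m -> 0 <= K -> c * J * (n - m) <= K * F * (n - m) + Z ->
   (c * J - K * F) * (n - m) <= Z by move=> ? ? ?; lra.
have c0 := es_c es; have K0 := es_K es.
move=> af [f2 fT] [w2 wT] h.
have fp := n2_ge0 f; have wp := n2_ge0 W.
set F := \int[mu]_x n2 f x; set G := \int[mu]_x n2 W x.
have G0 : 0 <= G by apply: Rintegral_ge0 => x _; exact: wp.
suff H m : 0 <= m -> \int[mu]_(x in `[- m, m]) n2 W x <= K * F / c.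
  rewrite mulrC -ler_pdivlMr//.
  by have [] := line_of_bounded wp (n2_locint w2) H.
move=> m0; rewrite ler_pdivlMr// mulrC leNgt; apply/negP => lt.
set J := \int[mu]_(x in _) _ in lt.
have d0 : 0 < c * J - K * F by rewrite subr_gt0.
have bound N : m < N -> (c * J - K * F) * (N - m) <= K * G.
  move=> mN; apply: ra1 => //; first by rewrite subr_gt0.
  have := @interior_bound _ _ _ _ _ _ _ _ es m N W f m0 mN af (fun i => f2 i _ _) (h _ _).
  move=> /le_trans; apply; apply: lerD; last by rewrite ler_wpM2l// Rint_le_line.
  by rewrite ler_wpM2r ?subr_ge0 ?(ltW mN)// ler_wpM2l// Rint_le_line.
(* Chosen so that [(c * J - K * F) * (N - m) = K * G + 1], against [bound]. *)
pose N := m + (K * G + 1) / (c * J - K * F).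
have KG : 0 <= K * G by exact: mulr_ge0.
have mN : m < N by rewrite /N ltrDl divr_gt0// ltr_wpDl.
have := bound N mN; rewrite /N addrAC subrr add0r mulrC divfK ?gt_eqF//.
by rewrite gerDl ler10.
Qed.

Section Limit.
Variables (f : I -> R -> R).
Hypotheses (af : adm f) (f1 : forall i, locint (f i)) (f2 : square_integrable f).
Hypothesis bvp : forall N, 0 < N -> exists W, [/\ sol A (- N) N W f,
  S N (W^~ N) <= 0 & 0 <= S (- N) (W^~ (- N))].

Let F := \int[mu]_x n2 f x.
Let E := K * F / c.
Let Kb := 2 * (#|I|%:R * Ka) + 1.

Let F0 : 0 <= F. Proof. by apply: Rintegral_ge0 => x _; exact: n2_ge0. Qed.
Let E0 : 0 <= E.
Proof.
by apply: divr_ge0; [apply: mulr_ge0 => //; exact: es_K es|apply: ltW; exact: es_c es].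
Qed.
Let Kb0 : 0 <= Kb.
Proof. by rewrite /Kb addr_ge0// mulr_ge0// mulr_ge0// (es_Ka es). Qed.

(** The signs at the two ends make the boundary term of the energy inequality nonpositive, so the
    bound does not depend on [N]. *)
Lemma bvp_bound N W : 0 < N -> sol A (- N) N W f -> S N (W^~ N) <= 0 -> 0 <= S (- N) (W^~ (- N)) ->
  \int[mu]_(x in `[- N, N]) n2 W x <= E.
Proof.
move=> N0 h SN SmN; have NN : - N <= N by rewrite ge0_cp// ltW.
have := es_energy es NN af (fun i => f2.1 i _ _) h.
have e : \int[mu]_(x in `[- N, N]) n2 f x <= F by apply: Rint_le_line f2.2; exact: n2_ge0.
have c0 := es_c es; have := ler_wpM2l (es_K es) e.
rewrite /E ler_pdivlMr// [X in _ -> _ -> X <= _]mulrC => e1 e2; apply: le_trans e2 _.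
by apply: le_trans e1; rewrite gerDl subr_le0 (le_trans SN).
Qed.

Lemma pointwise_bound W g a b x : square_integrable g -> sol A a b W g -> a <= x - 1 -> x <= b ->
  n2 W x <= (Kb + 1) * \int[mu]_(t in `[a, b]) n2 W t + \int[mu]_(t in `[a, b]) n2 g t.
Proof.
move=> g2 h ax xb; have x1 : x - 1 <= x by rewrite gerDl lerN10.
apply: le_trans (sol_pointwise es (fun i => g2.1 i _ _) (sol_sub ax xb h)) _.
have Wi := sol_n2_intg (le_trans ax (le_trans x1 xb)) h.
apply: lerD; first by apply: ler_wpM2l; [exact: addr_ge0|apply: sub_Rint => //; exact: n2_ge0].
apply: sub_Rint => //; last exact: n2_ge0.
  by have := n2_locint g2.1; apply.
Qed.

Let G := (Kb + 1) * E + F.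

Let G0 : 0 <= G. Proof. by rewrite addr_ge0// mulr_ge0// addr_ge0. Qed.

Lemma bvp_pointwise N W x : 0 < N -> sol A (- N) N W f -> S N (W^~ N) <= 0 -> 0 <= S (- N) (W^~ (- N)) ->
  `|x| + 1 <= N -> n2 W x <= G.
Proof.
move=> N0 h SN SmN xN.
have l1 : x <= `|x| := ler_norm x.
have l2 : - x <= `|x| by rewrite -normrN ler_norm.
have ax : - N <= x - 1 by move: (`|x|) xN l2 => z ? ?; lra.
have xb : x <= N by move: (`|x|) xN l1 => z ? ?; lra.
apply: le_trans (pointwise_bound f2 h ax xb) _.
apply: lerD; last by apply: Rint_le_line f2.2; exact: n2_ge0.
by apply: ler_wpM2l; [exact: addr_ge0|exact: bvp_bound].
Qed.

Lemma square_integrable0 : square_integrable (fun _ _ => 0 : R).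
Proof.
split=> [i a b|]; first by apply: (eq_intg _ (intg_cst a b 0)) => x _; rewrite expr0n.
apply: (@eq_integrable _ _ _ mu _ _ (cst 0%E)) => //; last exact: integrable0.
by move=> x _ /=; rewrite /n2 big1// => i _; rewrite expr0n.
Qed.

Lemma n2_sub_le W1 W2 x : n2 (fun i t => W1 i t + -1 * W2 i t) x <= 2 * n2 W1 x + 2 * n2 W2 x.
Proof.
rewrite /n2 !mulr_sumr -big_split/=; apply: ler_sum => i _.
by have := sqr_ge0 (W1 i x + W2 i x); rewrite !expr2; lra.
Qed.

(* Two solutions of the boundary value problem differ by a homogeneous
   solution, which the interior bound forces to be small away from the ends. *)
Lemma bvp_diff N N' W W' x : 0 < N -> N <= N' ->
  sol A (- N) N W f -> S N (W^~ N) <= 0 -> 0 <= S (- N) (W^~ (- N)) ->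
  sol A (- N') N' W' f -> S N' (W'^~ N') <= 0 -> 0 <= S (- N') (W'^~ (- N')) ->
  `|x| + 1 < N ->
  n2 (fun i t => W i t + -1 * W' i t) x * (N - (`|x| + 1)) <= (Kb + 1) * (K * (4 * E)) / c.
Proof.
move=> N0 NN' h SN SmN h' SN' SmN' xN.
have NN : - N <= N by rewrite ge0_cp// ltW.
have h2 : sol A (- N) N W' f by apply: (sol_sub _ NN' h'); rewrite lerN2.
pose D i t := W i t + -1 * W' i t.
have hD : sol A (- N) N D (fun _ _ => 0).
  have := sol_lin (-1) h h2; have -> // : (fun i t => f i t + -1 * f i t) = (fun _ _ => 0).
  by apply/funext => i; apply/funext => t; rewrite mulN1r subrr.
have z2 := square_integrable0.
have m0 : 0 <= `|x| + 1 by rewrite addr_ge0.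
have := interior_bound es m0 xN (es_adm es) (fun i => z2.1 i _ _) hD.
have -> : \int[mu]_(t in `[- N, N]) n2 (fun (_ : I) (_ : R) => 0 : R) t = 0.
  rewrite (@eq_Rint _ _ (fun=> 0)) ?Rint_cst ?mul0r// => t _.
  by rewrite /n2 big1// => i _; rewrite expr0n.
rewrite mulr0 mul0r add0r.
have NN'2 : - N' <= N' by rewrite ge0_cp// (le_trans _ NN')// ltW.
have N'0 : 0 < N' by exact: lt_le_trans NN'.
(* [|W - W'|^2 <= 2 |W|^2 + 2 |W'|^2], and each of the two energies is at most [E]. *)
have W4 : \int[mu]_(t in `[- N, N]) n2 D t <= 4 * E.
  have Wi := sol_n2_intg NN h; have Wi2 := sol_n2_intg NN h2.
  apply: (@le_trans _ _ (\int[mu]_(t in `[- N, N]) (2 * n2 W t + 2 * n2 W' t))).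
    apply: le_Rint; [exact: (sol_n2_intg NN hD)|by apply: intgD; exact: intgZ|].
    by move=> t _; exact: n2_sub_le.
  rewrite RintegralD ?RintegralZl//; try exact: intgZ.
  have b1 := bvp_bound N0 h SN SmN.
  have b2 : \int[mu]_(t in `[- N, N]) n2 W' t <= E.
    apply: le_trans (bvp_bound N'0 h' SN' SmN'); apply: sub_Rint => //; first by rewrite lerN2.
      exact: sol_n2_intg h'.
    exact: n2_ge0.
  have -> : 4 * E = 2 * E + 2 * E by rewrite -mulrDl; congr (_ * _); rewrite -natrD.
  by apply: lerD; rewrite ler_wpM2l.
move=> /le_trans/(_ (ler_wpM2l (es_K es) W4)) B.
have p : n2 D x <= (Kb + 1) * \int[mu]_(t in `[- (`|x| + 1), `|x| + 1]) n2 D t.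
  have l1 : x <= `|x| := ler_norm x.
  have l2 : - x <= `|x| by rewrite -normrN ler_norm.
  have x1 : - (`|x| + 1) <= x - 1 by move: (`|x|) l2 => z ?; lra.
  have x2 : x <= `|x| + 1 by move: (`|x|) l1 => z ?; lra.
  have hD' : sol A (- (`|x| + 1)) (`|x| + 1) D (fun _ _ => 0).
    by apply: sol_sub hD; [rewrite lerN2 ltW|rewrite ltW].
  have := pointwise_bound z2 hD' x1 x2.
  rewrite [X in _ + X](_ : _ = 0) ?addr0//.
  have xx : - (`|x| + 1) <= `|x| + 1 by rewrite ge0_cp.
  rewrite (@eq_Rint _ _ (fun=> 0)) ?(Rint_cst _ xx) ?mul0r// => t _.
  by rewrite /n2 big1// => i _; rewrite expr0n.
have c0 := es_c es.
rewrite -/D ler_pdivlMr// mulrAC.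
have Nx : 0 <= N - (`|x| + 1) by rewrite subr_ge0 ltW.
apply: (@le_trans _ _ ((Kb + 1) * \int[mu]_(t in `[- (`|x| + 1), `|x| + 1]) n2 D t * c * (N - (`|x| + 1)))).
  by rewrite ler_wpM2r// ler_wpM2r// ltW.
have -> : forall k J n : R, k * J * c * n = k * (c * J * n) by move=> *; ring.
by apply: ler_wpM2l => //; exact: addr_ge0.
Qed.

(** [bvp_diff] makes the solutions a Cauchy sequence at each point, so the full sequence converges
    without a compactness argument. Dominated convergence carries the integral equation to the
    limit. *)
Lemma line_solution : exists W, (forall a b, sol A a b W f) /\ square_integrable W.
Proof.
have c0 := es_c es; have K0 := es_K es.
(* Half-length [n + 1] keeps the interval nondegenerate for [n = 0]. *)
have /choice[Wn HW] : forall n : nat, exists W, [/\ sol A (- n.+1%:R) n.+1%:R W f,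
    S n.+1%:R (W^~ n.+1%:R) <= 0 & 0 <= S (- n.+1%:R) (W^~ (- n.+1%:R))].
  by move=> n; exact: bvp.
pose C := (Kb + 1) * (K * (4 * E)) / c.
have C0 : 0 <= C.
  apply: divr_ge0; last exact: ltW.
  by apply: mulr_ge0; [exact: addr_ge0|apply: mulr_ge0 => //; exact: mulr_ge0].
have large (r : R) : exists n0, forall n, (n0 <= n)%N -> r < n.+1%:R.
  exists (Num.bound `|r|) => n hn; apply: le_lt_trans (ler_norm r) _.
  by apply: lt_le_trans (archi_boundP (normr_ge0 r)) _; rewrite ler_nat (leq_trans hn).
have cvgW i x : cvgn (fun n => Wn n i x).
  apply: cauchy_cvg; apply: cauchy_exP => e e0.
  (* This makes [N - (|x| + 1)] exceed [(C + 1) / e^2], so a squared distance of at least [e^2]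
     would contradict the bound [C] of [bvp_diff]. *)
  have [n0 hn0] := large (`|x| + 1 + (C + 1) / e ^+ 2).
  exists (Wn n0 i x); exists n0 => //= k hk.
  have e20 : 0 < e ^+ 2 by rewrite exprn_gt0.
  have n0x := hn0 n0 (leqnn _).
  have q0 : 0 < (C + 1) / e ^+ 2 by rewrite divr_gt0// ltr_wpDl.
  have xn : `|x| + 1 < n0.+1%:R by apply: lt_trans n0x; rewrite ltrDl.
  have kn : n0.+1%:R <= k.+1%:R :> R by rewrite ler_nat.
  have [a1 a2 a3] := HW n0; have [b1 b2 b3] := HW k.
  have := bvp_diff (ltr0Sn _ n0) kn a1 a2 a3 b1 b2 b3 xn; rewrite -/C.
  set D := n2 _ x => hD.
  have le1 : (Wn n0 i x + -1 * Wn k i x) ^+ 2 <= D.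
    by rewrite /D /n2 (bigD1 i)//= lerDl; apply: sumr_ge0 => j _; exact: sqr_ge0.
  have D0 : 0 <= D by exact: n2_ge0.
  have le2 : D < e ^+ 2.
    rewrite ltNge; apply/negP => De.
    have : C + 1 <= D * (n0.+1%:R - (`|x| + 1)).
      apply: (@le_trans _ _ (e ^+ 2 * ((C + 1) / e ^+ 2))).
        by rewrite mulrCA divff ?mulr1// gt_eqF.
      apply: ler_pM => //; [exact: ltW|exact: ltW|].
      by rewrite lerBrDl ltW.
    by move=> /le_trans/(_ hD); rewrite gerDl ler10.
  rewrite /ball/= -(@ltr_pXn2r _ 2)// ?nnegrE ?(ltW e0)// real_normK ?num_real//.
  by move: le1; rewrite mulN1r => /le_lt_trans; apply.
pose W i x := limn (fun n => Wn n i x).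
have toW i x : Wn n i x @[n --> \oo] --> W i x by exact: cvgW.
(* The pointwise bound is available at [x] once the interval reaches [|x| + 1], hence only from an
   index depending on [M]. *)
have bnd M : exists n0, forall n x, (n0 <= n)%N -> `|x| <= M -> n2 (Wn n) x <= G.
  have [n0 hn0] := large (M + 1); exists n0 => n x hn xM.
  have [a1 a2 a3] := HW n; apply: (bvp_pointwise _ a1 a2 a3) => //.
  by rewrite ltW// (le_lt_trans _ (hn0 n hn))// lerD2r.
have bndi M : exists n0, forall n i x, (n0 <= n)%N -> `|x| <= M -> `|Wn n i x| <= 1 + G.
  have [n0 hn0] := bnd M; exists n0 => n i x hn xM.
  have := hn0 n x hn xM; rewrite /n2 (bigD1 i)//=.
  have : 0 <= \sum_(j | j != i) Wn n j x ^+ 2 by apply: sumr_ge0 => j _; exact: sqr_ge0.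
  have := sqr_ge0 (`|Wn n i x| - 1); rewrite sqrrB1 real_normK ?num_real//.
  have := sqr_ge0 (Wn n i x); move: (Wn n i x ^+ 2) (\sum_(j | _) _) (`|_|) G => w z v g.
  by move=> *; lra.
have abM a b x : a <= x <= b -> `|x| <= `|a| + `|b|.
  move=> /andP[ax xb]; rewrite ler_norml; apply/andP; split.
    apply: le_trans ax; rewrite lerNl; apply: le_trans (ler_norm (- a)) _.
    by rewrite normrN lerDl.
  by apply: le_trans xb _; apply: le_trans (ler_norm b) _; rewrite lerDr.
have solW a b : sol A a b W f.
  have [ba|ab] := ltP b a.
    move=> i; split; first by rewrite /intg set_itv_ge ?bnd_simp -?ltNge//; exact: integrable_set0.
    by move=> x y ax xy yb; move: (le_trans ax (le_trans xy yb)); rewrite leNgt ba.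
  have [n1 hn1] := bndi (`|a| + `|b|); have [n2' hn2] := large (`|a| + `|b|).
  (* After a shift by [n0] every term is a solution on [[a, b]] and obeys the bound there, as
     dominated convergence asks of all indices. *)
  pose n0 := (n1 + n2')%N.
  have subN n : - (n + n0).+1%:R <= a /\ b <= (n + n0).+1%:R.
    have l : `|a| + `|b| < (n + n0).+1%:R by apply: hn2; rewrite /n0 addnA leq_addl.
    split.
      rewrite lerNl; apply: le_trans (ler_norm (- a)) _; rewrite normrN.
      by rewrite ltW// (le_lt_trans _ l)// lerDl.
    by apply: le_trans (ler_norm b) _; rewrite ltW// (le_lt_trans _ l)// lerDr.
  have solN n : sol A a b (Wn (n + n0)%N) f.
    by have [a1 _ _] := HW (n + n0)%N; have [s1 s2] := subN n; exact: sol_sub a1.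
  have toWs i x : Wn (n + n0)%N i x @[n --> \oo] --> W i x.
    by rewrite (cvg_shiftn n0 (fun n => Wn n i x)); exact: toW.
  have nb n i x : a <= x <= b -> `|Wn (n + n0)%N i x| <= 1 + G.
    by move=> /abM; apply: hn1; rewrite /n0 addnCA leq_addr.
  have dom i x y : a <= x -> y <= b ->
      intg (fun t => \sum_j A i j t * W j t + f i t) x y /\
      \int[mu]_(t in `[x, y]) (\sum_j A i j t * Wn (n + n0)%N j t + f i t) @[n --> \oo] -->
      \int[mu]_(t in `[x, y]) (\sum_j A i j t * W j t + f i t).
    move=> ax yb.
    apply: (@Rint_dominated _ _ _ (fun t => #|I|%:R * (Ka * (1 + G)) + `|f i t|)).
    - by move=> n; apply: (intg_sub ax yb); case: (solN n i).
    - by apply: intgD; [exact: intg_cst|apply: intg_norm; exact: f1].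
    - move=> n t /andP[xt ty]; apply: le_trans (ler_normD _ _) _; rewrite lerD2r.
      have tab : a <= t <= b by rewrite (le_trans ax xt) (le_trans ty yb).
      apply: le_trans (ler_norm_sum _ _ _) _.
      apply: (@le_trans _ _ (\sum_(j : I) Ka * (1 + G))).
        by apply: ler_sum => j _; rewrite normrM ler_pM ?nb ?(es_A es).
      by rewrite sumr_const -[_ *+ _]mulr_natl.
    - move=> t _; apply: cvgD; last exact: cvg_cst.
      by apply: cvgn_sum => j; apply: cvgMr; exact: toWs.
  move=> i; split; first by case: (dom i a b (lexx _) (lexx _)).
  move=> x y ax xy yb; have [_ cI] := dom i x y ax yb.
  pose u n := Wn (n + n0)%N i y - Wn (n + n0)%N i x.
  have c1 : u n @[n --> \oo] --> W i y - W i x by apply: cvgB; exact: toWs.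
  have uE : u = fun n => \int[mu]_(t in `[x, y]) (\sum_j A i j t * Wn (n + n0)%N j t + f i t).
    by apply/funext => n; have [_ E1] := solN n i; rewrite /u E1.
  rewrite -uE in cI; move: c1 cI => /cvg_lim <-// /cvg_lim <-//.
exists W; split=> //; split.
  move=> i a b; have [ba|ab] := ltP b a.
    by rewrite /intg set_itv_ge ?bnd_simp -?ltNge//; exact: integrable_set0.
  have cW : {within `[a, b], continuous (W i)} by exact: sol_continuous (solW a b).
  apply: (eq_intg _ (intg_mulr cW (continuous_on_intg cW))) => x _.
  by rewrite expr2.
have W2 i a b : intg (fun x => W i x ^+ 2) a b.
  have [ba|ab] := ltP b a.
    by rewrite /intg set_itv_ge ?bnd_simp -?ltNge//; exact: integrable_set0.
  have cW : {within `[a, b], continuous (W i)} by exact: sol_continuous (solW a b).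
  apply: (eq_intg _ (intg_mulr cW (continuous_on_intg cW))) => x _.
  by rewrite expr2.
suff H m : 0 <= m -> \int[mu]_(t in `[- m, m]) n2 W t <= E.
  by have [] := line_of_bounded (n2_ge0 W) (n2_locint W2) H.
move=> m0; have mm : - m <= m by rewrite ge0_cp.
have [n0 hn0] := bnd m; have [n1 hn1] := large m.
pose k0 := (n0 + n1)%N.
have [_ cI] : intg (n2 W) (- m) m /\
   \int[mu]_(t in `[- m, m]) n2 (Wn (n + k0)%N) t @[n --> \oo] --> \int[mu]_(t in `[- m, m]) n2 W t.
  apply: (@Rint_dominated _ _ _ (fun=> G)).
  - move=> n; have [a1 _ _] := HW (n + k0)%N.
    have l : m <= (n + k0).+1%:R by rewrite ltW// hn1// /k0 addnA leq_addl.
    by apply: sol_n2_intg => //; apply: sol_sub a1 => //; rewrite lerN2.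
  - exact: intg_cst.
  - move=> n t tm; rewrite ger0_norm ?n2_ge0//; apply: hn0; first by rewrite /k0 addnCA leq_addr.
    by rewrite ler_norml.
  - move=> t _; apply: cvgn_sum => j; rewrite /=.
    have h : Wn (n + k0)%N j t @[n --> \oo] --> W j t.
      by rewrite (cvg_shiftn k0 (fun n => Wn n j t)); exact: toW.
    by rewrite expr2; under eq_fun do rewrite expr2; exact: cvgM.
move/cvg_lim: (cI) => <-//; apply: limr_le; first by apply/cvg_ex; eexists; exact: cI.
apply: nearW => n; have [a1 a2 a3] := HW (n + k0)%N.
apply: le_trans (bvp_bound _ a1 a2 a3) => //.
have l : m <= (n + k0).+1%:R by rewrite ltW// hn1// /k0 addnA leq_addl.
apply: sub_Rint => //; first by rewrite lerN2.
  by apply: sol_n2_intg a1; rewrite ge0_cp// ltW.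
exact: n2_ge0.
Qed.

End Limit.
End Solve.

(** * The resolvent system *)

Section Concrete.
Context {R : realType}.
Local Notation mu := (@lebesgue_measure R).
Implicit Types (W f : 'I_6 -> R -> R) (a b c x y : R).

(** The indices are written with [lift], the form in which [big_ord_recl] unfolds a sum. *)
Definition kU1 : 'I_6 := ord0.
Definition kU2 : 'I_6 := lift ord0 ord0.
Definition kV1 : 'I_6 := lift ord0 (lift ord0 ord0).
Definition kV2 : 'I_6 := lift ord0 (lift ord0 (lift ord0 ord0)).
Definition ku1 : 'I_6 := lift ord0 (lift ord0 (lift ord0 (lift ord0 ord0))).
Definition ku2 : 'I_6 := lift ord0 (lift ord0 (lift ord0 (lift ord0 (lift ord0 ord0)))).

Lemma sum6 (F : 'I_6 -> R) :
  \sum_i F i = F kU1 + (F kU2 + (F kV1 + (F kV2 + (F ku1 + F ku2)))).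
Proof. by rewrite !big_ord_recl big_ord0 addr0. Qed.

Lemma forall6 (P : 'I_6 -> Prop) :
  P kU1 -> P kU2 -> P kV1 -> P kV2 -> P ku1 -> P ku2 -> forall i, P i.
Proof.
move=> h0 h1 h2 h3 h4 h5 [[|[|[|[|[|[|//]]]]]] hi].
- by rewrite (_ : Ordinal hi = kU1)//; exact/val_inj.
- by rewrite (_ : Ordinal hi = kU2)//; exact/val_inj.
- by rewrite (_ : Ordinal hi = kV1)//; exact/val_inj.
- by rewrite (_ : Ordinal hi = kV2)//; exact/val_inj.
- by rewrite (_ : Ordinal hi = ku1)//; exact/val_inj.
- by rewrite (_ : Ordinal hi = ku2)//; exact/val_inj.
Qed.

Definition vec6 T (x0 x1 x2 x3 x4 x5 : T) (i : 'I_6) : T :=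
  nth x0 [:: x0; x1; x2; x3; x4; x5] i.

Lemma n2E W x : n2 W x = ip (W kU1 x) (W kU2 x) (W kU1 x) (W kU2 x)
  + ip (W kV1 x) (W kV2 x) (W kV1 x) (W kV2 x) + ip (W ku1 x) (W ku2 x) (W ku1 x) (W ku2 x).
Proof. by rewrite /n2 sum6 /ip; ring. Qed.

Lemma primitive_on_ip a b (x1 x2 y1 y2 dx1 dx2 dy1 dy2 : R -> R) :
  primitive_on a b x1 dx1 -> primitive_on a b x2 dx2 ->
  primitive_on a b y1 dy1 -> primitive_on a b y2 dy2 ->
  primitive_on a b (fun t => ip (x1 t) (x2 t) (y1 t) (y2 t))
    (fun t => ip (dx1 t) (dx2 t) (y1 t) (y2 t) + ip (x1 t) (x2 t) (dy1 t) (dy2 t)).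
Proof.
move=> h1 h2 k1 k2; apply: (eq_primitive_on _ _ (primitive_onD (primitive_onM h1 k1) (primitive_onM h2 k2))) => t _ //.
by rewrite /ip; ring.
Qed.

(** * The six real equations and their boundary value problems *)

Section System.
Variables (gamma vp : R) (s : R -> R) (s0 q0 d0 B : R) (q d b r ds dq db dr : R -> R).
Hypothesis sc : shock_coefficients gamma vp s s0 q0 d0 B q d b r ds dq db dr.
Variables (al be : R).

(* Coordinates: real and imaginary parts of [U = z / lambda], [V = (u - v) / lambda] and [u]. *)
Definition coef (i j : 'I_6) x : R :=
  vec6 (vec6 0 0 0 0 1 0)
       (vec6 0 0 0 0 0 1)
       (vec6 0 0 (- al) be 1 0)
       (vec6 0 0 (- be) (- al) 0 1)
       (vec6 (s x * al) (- (s x * be)) (s x * q x * al) (- (s x * q x * be)) (s x * (1 - q x)) 0)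
       (vec6 (s x * be) (s x * al) (s x * q x * be) (s x * q x * al) 0 (s x * (1 - q x))) i j.

(** The equation for [u'] is the definition of [U] solved for [u'], so it carries no data. *)
Definition adm f : Prop := f ku1 = (fun _ => 0) /\ f ku2 = (fun _ => 0).

Definition rhs W f : 'I_6 -> R -> R :=
  vec6 (fun x => W ku1 x + f kU1 x)
       (fun x => W ku2 x + f kU2 x)
       (fun x => W ku1 x - (al * W kV1 x - be * W kV2 x) + f kV1 x)
       (fun x => W ku2 x - (al * W kV2 x + be * W kV1 x) + f kV2 x)
       (fun x => s x * (W ku1 x + (al * (W kU1 x + q x * W kV1 x) - be * (W kU2 x + q x * W kV2 x) - q x * W ku1 x)))
       (fun x => s x * (W ku2 x + (al * (W kU2 x + q x * W kV2 x) + be * (W kU1 x + q x * W kV1 x) - q x * W ku2 x))).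

Lemma rhsE W f : adm f -> forall i x, \sum_j coef i j x * W j x + f i x = rhs W f i x.
Proof.
move=> [f4 f5]; apply: forall6 => x; rewrite sum6 /coef /rhs /vec6 /= ?f4 ?f5; ring.
Qed.

Lemma sol_rhs a c W f : adm f ->
  sol coef a c W f <-> forall i, primitive_on a c (W i) (rhs W f i).
Proof.
move=> af; split=> h i; apply: (eq_primitive_on _ _ (h i)) => // x _; first exact: rhsE.
by rewrite rhsE.
Qed.

Definition Sval (M : R) x (w : 'I_6 -> R) : R :=
  Sform M al be (q x) (d x) (b x) (r x) (w kU1) (w kU2) (w kV1) (w kV2) (w ku1) (w ku2).

Lemma Sval_primitive M a c W f : adm f -> sol coef a c W f ->
  primitive_on a c (fun x => Sval M x (W^~ x))
   (fun x => DSform M al be (q x) (d x) (b x) (r x) (dq x) (r x) (db x) (dr x)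
     (W kU1 x) (W kU2 x) (W kV1 x) (W kV2 x) (W ku1 x) (W ku2 x)
     (rhs W f kU1 x) (rhs W f kU2 x) (rhs W f kV1 x) (rhs W f kV2 x) (rhs W f ku1 x) (rhs W f ku2 x)).
Proof.
move=> af /(sol_rhs _ _ _ af) h.
move: (h kU1) (h kU2) (h kV1) (h kV2) (h ku1) (h ku2).
move: (rhs W f kU1) (rhs W f kU2) (rhs W f kV1) (rhs W f kV2) (rhs W f ku1) (rhs W f ku2).
rewrite /Sval; move: (W kU1) (W kU2) (W kV1) (W kV2) (W ku1) (W ku2) => U1 U2 V1 V2 u1 u2 dU1 dU2 dV1 dV2 du1 du2.
move=> h1 h2 h3 h4 h5 h6.
have pq := sc_q sc a c; have pd := sc_d sc a c; have pb := sc_b sc a c; have pr := sc_r sc a c.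
(* [pA], [pB] and [pC] are the groups of [Sform] with weights [M ^+ 3], [M] and [1], differentiated
   by the product rule for primitives. *)
have p1 := primitive_onM pd (primitive_on_ip h5 h6 h1 h2).
have p2 := primitive_on_ip h3 h4 h1 h2.
have p3 := primitive_onZ (- 2^-1) (primitive_on_ip h3 h4 h3 h4).
have p4 := primitive_onZ (- 2^-1) (primitive_onM (primitive_onD pr pb) (primitive_on_ip h1 h2 h1 h2)).
have pA := primitive_onZ (M ^+ 3) (primitive_onD (primitive_onD (primitive_onD p1 p2) p3) p4).
have e1 := primitive_onD h1 (primitive_onM pq h3).
have e2 := primitive_onD h2 (primitive_onM pq h4).
have x1 := primitive_onD (primitive_onD (primitive_onZ al e1) (primitive_onZ (- be) e2)) (primitive_onZ (-1) (primitive_onM pq h5)).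
have x2 := primitive_onD (primitive_onD (primitive_onZ al e2) (primitive_onZ be e1)) (primitive_onZ (-1) (primitive_onM pq h6)).
have pB := primitive_onZ M (primitive_on_ip h5 h6 x1 x2).
have l1 := primitive_onD (primitive_onZ al h1) (primitive_onZ (- be) h2).
have l2 := primitive_onD (primitive_onZ al h2) (primitive_onZ be h1).
have pC := primitive_on_ip l1 l2 h3 h4.
apply: (eq_primitive_on _ _ (primitive_onD (primitive_onD pA pB) pC)) => t _.
  by rewrite /Sform /ip; field.
by rewrite /DSform /ip; field.
Qed.

Lemma coef_continuous i j : continuous (coef i j).
Proof.
have cs : continuous s by exact: primitive_continuous (sc_s sc).
have cq : continuous q by exact: primitive_continuous (sc_q sc).
have csq : continuous (fun x => s x * q x) by exact: continuous_mul.
have k (t : R) : continuous (fun _ : R => t) by exact: continuous_const.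
have ng (g : R -> R) : continuous g -> continuous (fun x => - g x).
  by move=> cg x; apply: cvgN; exact: cg.
have ks (t : R) : continuous (fun x => s x * t) by exact: continuous_mul.
have ksq (t : R) : continuous (fun x => s x * q x * t) by exact: continuous_mul.
have k1 : continuous (fun x => s x * (1 - q x)).
  by apply: continuous_mul => //; exact: continuous_sub.
by move: i j; apply: forall6; apply: forall6; rewrite /coef /vec6 /=;
  first [exact: k|exact: k1|exact: ks|exact: ksq|apply: ng; exact: ks|apply: ng; exact: ksq].
Qed.

Lemma coef_bounded : exists Ka, 0 <= Ka /\ forall i j x, `|coef i j x| <= Ka.
Proof.
have [s00 q00 d00 B1] := sc_pos sc.
have B0 : 0 <= B by exact: le_trans B1.
pose Ka := (1 + `|al| + `|be|) * (1 + B) * (1 + B).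
have L : 1 + `|al| + `|be| <= Ka.
  have a0 : 0 <= 1 + `|al| + `|be| by rewrite !addr_ge0.
  by rewrite /Ka -mulrA ler_peMr// -[leLHS]mulr1; apply: ler_pM => //; rewrite lerDl.
have a0 := normr_ge0 al; have b0 := normr_ge0 be.
have Ka0 : 0 <= Ka by apply: le_trans L; rewrite !addr_ge0.
exists Ka; split => //.
have sB x : `|s x| <= B.
  by have [/andP[h1 h2] _ _ _ _ _ _ _ _] := sc_bounds sc x; rewrite ger0_norm// (le_trans _ h1)// ltW.
have qB x : `|q x| <= B.
  by have [_ /andP[h1 h2] _ _ _ _ _ _ _] := sc_bounds sc x; rewrite ger0_norm// (le_trans _ h1)// ltW.
have K1 : 1 <= Ka by apply: le_trans L; rewrite -addrA lerDl addr_ge0.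
have Kal : `|al| <= Ka by apply: le_trans L; rewrite addrAC lerDr addr_ge0.
have Kbe : `|be| <= Ka by apply: le_trans L; rewrite lerDr addr_ge0.
have gen (g t : R) : `|g| <= (1 + B) * (1 + B) -> `|t| <= 1 + `|al| + `|be| -> `|g * t| <= Ka.
  by move=> h1 h2; rewrite mulrC /Ka -mulrA; exact: norm_le_mul.
have g1 x : `|s x| <= (1 + B) * (1 + B).
  apply: le_trans (sB x) _; rewrite -[leLHS]mul1r; apply: ler_pM => //; first by rewrite lerDl.
  by rewrite lerDr.
have g2 x : `|s x * q x| <= (1 + B) * (1 + B).
  by apply: norm_le_mul; [apply: le_trans (sB x) _|apply: le_trans (qB x) _]; rewrite lerDr.
have g3 x : `|s x * (1 - q x)| <= (1 + B) * (1 + B).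
  apply: norm_le_mul; first by apply: le_trans (sB x) _; rewrite lerDr.
  by apply: le_trans (ler_normB _ _) _; rewrite normr1 lerD2l.
have tal : `|al| <= 1 + `|al| + `|be| by rewrite addrAC lerDr addr_ge0.
have tbe : `|be| <= 1 + `|al| + `|be| by rewrite lerDr addr_ge0.
have t1 : `|1 : R| <= 1 + `|al| + `|be| by rewrite normr1 -addrA lerDl addr_ge0.
have gen1 (g : R) : `|g| <= (1 + B) * (1 + B) -> `|g| <= Ka.
  by move=> h; rewrite -[g]mulr1; exact: gen.
by apply: forall6; apply: forall6 => x; rewrite /coef /vec6 /= ?normrN ?normr0 ?normr1 //;
  first [exact: gen1|apply: gen => //].
Qed.

Hypotheses (al0 : 0 <= al) (lam0 : 0 < al ^+ 2 + be ^+ 2).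

Lemma concrete_energy : exists M kap c K Ka, [/\
  energy_system coef Ka (Sval M) c K adm,
  forall x w, w kU1 = 0 -> w kU2 = 0 -> Sval M x w <= 0 &
  forall x w, w kV1 = 0 -> w kV2 = 0 -> w ku1 = kap * w kU1 -> w ku2 = kap * w kU2 ->
    w kU1 ^+ 2 + w kU2 ^+ 2 <= Sval M x w].
Proof.
have [s00 q00 d00 B1] := sc_pos sc.
have [M [kap [c [K [c0 K0 H]]]]] := lyapunov_form s00 q00 d00 B1 al0 lam0.
have [Ka [Ka0 HKa]] := coef_bounded.
exists M, kap, c, K, Ka; split.
- split => //.
  + exact: ltW.
  + move=> x w; have [_ h _ _] := H _ _ _ _ _ _ _ _ (sc_bounds sc x).
    apply: le_trans (h _ _ _ _ _ _) _.
    by rewrite le_eqVlt; apply/orP; left; apply/eqP; rewrite sum6 /ip; ring.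
  + move=> a e W f ae af f2 h.
    have pS := Sval_primitive M af h.
    have [Di E] := pS; rewrite (E a e (lexx _) ae (lexx _)).
    have Wi := sol_n2_intg ae h.
    have fi : intg (n2 f) a e by exact: intg_sum.
    rewrite -lerBlDl -!RintegralZl// -RintegralB//; try exact: intgZ.
    apply: le_Rint => //.
      apply: (eq_intg _ (intgD (intgZ c Wi) (intgZ (- K) fi))) => x _; by rewrite mulNr.
    move=> x _; have [h1 _ _ _] := H _ _ _ _ _ _ _ _ (sc_bounds sc x).
    case: af => f4 f5; rewrite !n2E f4 f5.
    have -> : ip 0 0 0 0 = 0 :> R by rewrite /ip mulr0 addr0.
    by rewrite addr0; apply: h1.
- move=> x w w0 w1; have [_ _ h _] := H _ _ _ _ _ _ _ _ (sc_bounds sc x).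
  by rewrite /Sval w0 w1; exact: h.
- move=> x w w2 w3 w4 w5; have [_ _ _ h] := H _ _ _ _ _ _ _ _ (sc_bounds sc x).
  by rewrite /Sval w2 w3 w4 w5 !expr2; exact: h.
Qed.

Lemma adm_lin k f1 f2 : adm f1 -> adm f2 -> adm (fun i x => f1 i x + k * f2 i x).
Proof.
by move=> [a1 a2] [b1 b2]; split; apply/funext => x; rewrite ?a1 ?b1 ?a2 ?b2 mulr0 addr0.
Qed.

Lemma kernel2 (m11 m12 m21 m22 : R) : m11 * m22 - m12 * m21 = 0 ->
  exists x y, [/\ 0 < x ^+ 2 + y ^+ 2, x * m11 + y * m12 = 0 & x * m21 + y * m22 = 0].
Proof.
move=> dt.
have pos (z w : R) : z != 0 \/ w != 0 -> 0 < z ^+ 2 + w ^+ 2.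
  move=> [h|h]; first by rewrite ltr_pwDl ?sqr_ge0// exprn_even_gt0.
  by rewrite ltr_wpDl ?sqr_ge0// exprn_even_gt0.
have [h|] := boolP ((m11 != 0) || (m12 != 0)).
  exists (- m12), m11; split; [|ring|by rewrite -dt; ring].
  by rewrite sqrrN; apply: pos; move/orP: h => []; [right|left].
rewrite negb_or !negbK => /andP[/eqP e11 /eqP e12].
have [h|] := boolP ((m21 != 0) || (m22 != 0)).
  exists (- m22), m21; split; [|by rewrite e11 e12; ring|ring].
  by rewrite sqrrN; apply: pos; move/orP: h => []; [right|left].
rewrite negb_or !negbK => /andP[/eqP e21 /eqP e22].
exists 1, 0; split; [|by rewrite e11 e12; ring|by rewrite e21 e22; ring].
by rewrite expr1n expr0n addr0.
Qed.

(** Shooting from [-N]. The left conditions [V = 0], [u = kap U] leave two real parameters [x] and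
    [y], carried by the homogeneous solutions [H1] and [H2]; [U(N) = 0] is two real equations for
    them. [P] starts from zero, so every [mix x y P] satisfies the left conditions. *)
Lemma concrete_bvp M kap c K Ka : energy_system coef Ka (Sval M) c K adm ->
  (forall x w, w kU1 = 0 -> w kU2 = 0 -> Sval M x w <= 0) ->
  (forall x w, w kV1 = 0 -> w kV2 = 0 -> w ku1 = kap * w kU1 -> w ku2 = kap * w kU2 ->
    w kU1 ^+ 2 + w kU2 ^+ 2 <= Sval M x w) ->
  forall f, adm f -> (forall i, locint (f i)) ->
  forall N, 0 < N -> exists W, [/\ sol coef (- N) N W f,
    Sval M N (W^~ N) <= 0 & 0 <= Sval M (- N) (W^~ (- N))].
Proof.
move=> es SR SL f af fi N N0.
have NN : - N <= N by rewrite ge0_cp// ltW.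
have cc (i j : 'I_6) : {within `[- N, N], continuous (coef i j)}.
  by apply: continuous_subspaceT; exact: coef_continuous.
have ivp w0 g : (forall i, intg (g i) (- N) N) ->
    exists W, (forall i, W i (- N) = w0 i) /\ sol coef (- N) N W g.
  by move=> gi; exact: (linear_ivp w0 NN (es_Ka es) cc (fun i j x _ => es_A es i j x) gi).
have z2 (i : 'I_6) : intg (fun _ : R => 0 : R) (- N) N by exact: intg_cst.
have [P [P0 Ps]] := ivp (fun _ => 0) f (fun i => fi i _ _).
have [H1 [H10 H1s]] := ivp (vec6 1 0 0 0 kap 0) (fun _ _ => 0) z2.
have [H2 [H20 H2s]] := ivp (vec6 0 1 0 0 0 kap) (fun _ _ => 0) z2.
pose mix (x y : R) (P : 'I_6 -> R -> R) := fun i t => (P i t + x * H1 i t) + y * H2 i t.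
have mixs x y Q g : sol coef (- N) N Q g -> sol coef (- N) N (mix x y Q) g.
  move=> Qs; have := sol_lin y (sol_lin x Qs H1s) H2s.
  have -> // : (fun i t => g i t + x * 0 + y * 0) = g.
  by apply/funext => i; apply/funext => t; rewrite !mulr0 !addr0.
have left x y Q : (forall i, Q i (- N) = 0) -> x ^+ 2 + y ^+ 2 <= Sval M (- N) ((mix x y Q)^~ (- N)).
  move=> Q0.
  have E : forall i, mix x y Q i (- N) = vec6 x y 0 0 (kap * x) (kap * y) i.
    by apply: forall6; rewrite /mix Q0 H10 H20 /vec6 /=; ring.
  have := SL (- N) ((mix x y Q)^~ (- N)); rewrite /= !E /vec6 /=.
  by apply.
(* A null vector [(x, y)] would give a homogeneous solution with [U(N) = 0], and the energy
   inequality would force [x^2 + y^2 <= S(-N) <= S(N) <= 0]. *)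
have det0 : H1 kU1 N * H2 kU2 N - H2 kU1 N * H1 kU2 N != 0.
  apply/negP => /eqP /kernel2 [x [y [xy0 e1 e2]]].
  have zs : sol coef (- N) N (fun _ _ => 0) (fun _ _ => 0).
    move=> i; apply: (eq_primitive_on _ _ (primitive_on_cst (- N) N 0)) => // t _.
    by rewrite big1 ?addr0// => j _; rewrite mulr0.
  have Ds := mixs x y _ _ zs.
  have sq (i : 'I_6) : intg (fun _ : R => (0 : R) ^+ 2) (- N) N by exact: intg_cst.
  have := es_energy es NN (es_adm es) sq Ds.
  have R0 := SR N ((mix x y (fun _ _ => 0))^~ N).
  have {}R0 : Sval M N ((mix x y (fun _ _ => 0))^~ N) <= 0.
    by apply: R0; rewrite /mix add0r.
  have L0 := left x y (fun _ _ => 0) (fun _ => erefl).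
  have e0 : \int[mu]_(t in `[- N, N]) n2 (fun (_ : 'I_6) (_ : R) => 0 : R) t = 0.
    rewrite (@eq_Rint _ _ (fun=> 0)) ?(Rint_cst _ NN) ?mul0r// => t _.
    by rewrite /n2 big1// => i _; rewrite expr0n.
  have I0 : 0 <= c * \int[mu]_(t in `[- N, N]) n2 (mix x y (fun _ _ => 0)) t.
    by apply: mulr_ge0; [exact: ltW (es_c es)|apply: Rintegral_ge0 => t _; exact: n2_ge0].
  rewrite e0 mulr0 add0r => /(le_trans I0); rewrite subr_ge0 => h.
  by have := lt_le_trans xy0 (le_trans L0 (le_trans h R0)); rewrite ltxx.
set D := _ - _ in det0.
(* Cramer's rule for [U(N) = 0]. *)
pose x := (H2 kU1 N * P kU2 N - P kU1 N * H2 kU2 N) / D.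
pose y := (P kU1 N * H1 kU2 N - H1 kU1 N * P kU2 N) / D.
exists (mix x y P); split.
- exact: mixs.
- by apply: SR; rewrite /mix /x /y /D; field; exact: det0.
- by apply: le_trans (left x y P P0); rewrite addr_ge0 ?sqr_ge0.
Qed.

End System.
End Concrete.

(** * Square integrable functions and multiplication by bounded coefficients *)

Section SquareIntegrable.
Local Open Scope complex_scope.
Context {R : realType}.
Local Notation mu := (@lebesgue_measure R).
Local Notation Re := (@complex.Re R).
Local Notation Im := (@complex.Im R).
Implicit Types (f g h F G : R -> R) (k : R).

Lemma Lfun2_dominated f h : measurable_fun setT f -> mu.-integrable setT (EFin \o h) ->
  (forall x, f x ^+ 2 <= h x) -> f \in Lfun mu 2%:E.
Proof.
move=> mf hi fh; apply/Lfun2P; split=> //.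
apply: (le_integrable _ _ _ hi) => //.
  by apply/measurable_EFinP; exact: measurable_funX.
move=> x _ /=; rewrite lee_fin ger0_norm ?sqr_ge0//.
by apply: le_trans (fh x) _; exact: ler_norm.
Qed.

Lemma Lfun2_sqr f : f \in Lfun mu 2%:E -> mu.-integrable setT (EFin \o (fun x => f x ^+ 2)).
Proof. by move=> /Lfun2P[]. Qed.

Lemma Lfun2_measurable f : f \in Lfun mu 2%:E -> measurable_fun setT f.
Proof. by move=> /Lfun2P[]. Qed.

Lemma integrable_add f g : mu.-integrable setT (EFin \o f) -> mu.-integrable setT (EFin \o g) ->
  mu.-integrable setT (EFin \o (fun x => f x + g x)).
Proof.
move=> fi gi; apply: (@eq_integrable _ _ _ mu _ _ ((EFin \o f) \+ (EFin \o g))%E) => //.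
exact: integrableD.
Qed.

Lemma integrable_scale k f : mu.-integrable setT (EFin \o f) ->
  mu.-integrable setT (EFin \o (fun x => k * f x)).
Proof.
move=> fi; apply: (@eq_integrable _ _ _ mu _ _ (fun x => k%:E * (EFin \o f) x)%E) => //.
exact: integrableZl.
Qed.

Lemma Lfun2D f g : f \in Lfun mu 2%:E -> g \in Lfun mu 2%:E ->
  (fun x => f x + g x) \in Lfun mu 2%:E.
Proof.
move=> lf lg; apply: (@Lfun2_dominated _ (fun x => 2 * f x ^+ 2 + 2 * g x ^+ 2)).
- by apply: measurable_funD; exact: Lfun2_measurable.
- by apply: integrable_add; apply: integrable_scale; exact: Lfun2_sqr.
- by move=> x; have := sqr_ge0 (f x - g x); rewrite !expr2; lra.
Qed.

Lemma Lfun2M k f g : measurable_fun setT f -> (forall x, `|f x| <= k) -> g \in Lfun mu 2%:E ->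
  (fun x => f x * g x) \in Lfun mu 2%:E.
Proof.
move=> mf fk lg; apply: (@Lfun2_dominated _ (fun x => k ^+ 2 * g x ^+ 2)).
- by apply: measurable_funM => //; exact: Lfun2_measurable.
- by apply: integrable_scale; exact: Lfun2_sqr.
- move=> x; rewrite exprMn ler_wpM2r ?sqr_ge0//.
  by rewrite -[f x ^+ 2]real_normK ?num_real// lerXn2r ?nnegrE// (le_trans _ (fk x)).
Qed.

Lemma Lfun2Z k f : f \in Lfun mu 2%:E -> (fun x => k * f x) \in Lfun mu 2%:E.
Proof. by move=> lf; apply: (@Lfun2M `|k| (fun=> k)). Qed.

Lemma Lfun2_ae f g : measurable_fun setT g -> {ae mu, forall x, f x = g x} ->
  f \in Lfun mu 2%:E -> g \in Lfun mu 2%:E.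
Proof.
move=> mg fg /Lfun2P[mf fi]; apply/Lfun2P; split=> //.
have mf2 : measurable_fun setT (EFin \o (fun x => f x ^+ 2)) by apply/measurable_EFinP; exact: measurable_funX.
have mg2 : measurable_fun setT (EFin \o (fun x => g x ^+ 2)) by apply/measurable_EFinP; exact: measurable_funX.
apply/integrableP; split=> //; move/integrableP: fi => [_]; congr (_ < _)%E.
apply: ae_eq_integral => //; [exact: measurableT_comp|exact: measurableT_comp|].
by apply: filterS fg => [|x /= -> _]; first exact: (ae_filter_ringOfSetsType mu).
Qed.

(** [F] is the continuous representative of an [H^1] function with derivative [f]. *)
Definition sobolev F f := [/\ primitive F f, F \in Lfun mu 2%:E & f \in Lfun mu 2%:E].

Definition multiplier (C D : R -> R) : Prop := [/\ primitive C D, continuous D,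
  exists M : R, forall x, `|C x| <= M & exists M : R, forall x, `|D x| <= M].

Lemma sobolevD F G f g : sobolev F f -> sobolev G g ->
  sobolev (fun x => F x + G x) (fun x => f x + g x).
Proof.
by move=> [h1 h2 h3] [k1 k2 k3]; split; [exact: primitiveD|exact: Lfun2D|exact: Lfun2D].
Qed.

Lemma sobolevZ k F f : sobolev F f -> sobolev (fun x => k * F x) (fun x => k * f x).
Proof. by move=> [h1 h2 h3]; split; [exact: primitiveZ|exact: Lfun2Z|exact: Lfun2Z]. Qed.

Lemma continuous_measurable F : continuous F -> measurable_fun setT F.
Proof. by move=> cF; apply: locint_measurable; exact: continuous_locint. Qed.

Lemma sobolevM C D F f : multiplier C D -> sobolev F f ->
  sobolev (fun x => C x * F x) (fun x => D x * F x + C x * f x).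
Proof.
move=> [pC cD [M HM] [N HN]] [pF lF lf].
have mC : measurable_fun setT C by apply: continuous_measurable; exact: primitive_continuous pC.
split; first exact: primitiveM.
- exact: Lfun2M HM lF.
- by apply: Lfun2D; [apply: Lfun2M HN lF; exact: continuous_measurable|exact: Lfun2M HM lf].
Qed.

Lemma multiplierM C D C' D' : multiplier C D -> multiplier C' D' ->
  multiplier (fun x => C x * C' x) (fun x => D x * C' x + C x * D' x).
Proof.
move=> [pC cD [M HM] [N HN]] [pC' cD' [M' HM'] [N' HN']].
have cC := primitive_continuous pC; have cC' := primitive_continuous pC'.
split; first exact: primitiveM.
- by apply: continuous_add; exact: continuous_mul.
- by exists (M * M') => x; exact: norm_le_mul.
- exists (N * M' + M * N') => x; apply: le_trans (ler_normD _ _) _.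
  by apply: lerD; exact: norm_le_mul.
Qed.

Definition mkC f g : R -> R[i] := fun x => f x +i* g x.

Lemma sobolev_wderiv (p : R -> R[i]) F1 F2 f1 f2 : L2 p ->
  {ae mu, forall x, p x = mkC F1 F2 x} -> sobolev F1 f1 -> sobolev F2 f2 ->
  H1 p /\ {ae mu, forall x, wderiv p x = mkC f1 f2 x}.
Proof.
move=> lp pF [h1 h2 h3] [k1 k2 k3].
exact: (@cprimitive_wderiv _ _ (mkC f1 f2) (mkC F1 F2)).
Qed.

Lemma H1_sobolev (p : R -> R[i]) : H1 p -> exists F1 F2,
  [/\ {ae mu, forall x, p x = mkC F1 F2 x}, sobolev F1 (Re \o wderiv p) &
      sobolev F2 (Im \o wderiv p)].
Proof.
move=> hp; have [P [[p1 p2] aP]] := H1_cprimitive hp; have [[l1 l2] _] := wderivP hp.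
have [a1 a2] := complex_ae aP; have [[lp1 lp2] _] := hp.
exists (Re \o P), (Im \o P); split.
- by apply: filterS aP => [|x ->]; [exact: (ae_filter_ringOfSetsType mu)|rewrite /mkC/=; case: (P x)].
- split=> //; apply: Lfun2_ae a1 lp1; apply: continuous_measurable; exact: primitive_continuous p1.
- split=> //; apply: Lfun2_ae a2 lp2; apply: continuous_measurable; exact: primitive_continuous p2.
Qed.

Lemma square_integrableP (I : finType) (W : I -> R -> R) :
  (forall i, measurable_fun setT (W i)) ->
  square_integrable W <-> forall i, W i \in Lfun mu 2%:E.
Proof.
move=> mW; split=> [[_ h] i|h].
  apply: (Lfun2_dominated (mW i) h) => x.
  by rewrite /n2 (bigD1 i)//= lerDl; apply: sumr_ge0 => j _; exact: sqr_ge0.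
split=> [i a b|].
  by apply: integrableS (Lfun2_sqr (h i)).
rewrite /n2; elim: (index_enum I) => [|i s IH].
  apply: (@eq_integrable _ _ _ mu _ _ (cst 0%E)) => //; last exact: integrable0.
  by move=> x _ /=; rewrite big_nil.
apply: (@eq_integrable _ _ _ mu _ _ (EFin \o (fun x => W i x ^+ 2 + \sum_(i <- s) W i x ^+ 2))) => //.
  by move=> x _ /=; rewrite big_cons.
by apply: integrable_add => //; exact: Lfun2_sqr.
Qed.

End SquareIntegrable.

(** * Equivalence of the resolvent equation and the first-order system *)

Section Resolvent.
Local Open Scope complex_scope.
Context {R : realType}.
Local Notation mu := (@lebesgue_measure R).
Local Notation Re := (@complex.Re R).
Local Notation Im := (@complex.Im R).

Lemma ReM (a b : R[i]) : Re (a * b) = Re a * Re b - Im a * Im b.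
Proof. by case: a b => [? ?] [? ?]. Qed.
Lemma ImM (a b : R[i]) : Im (a * b) = Re a * Im b + Im a * Re b.
Proof. by case: a b => [? ?] [? ?] /=; ring. Qed.
Lemma ReD (a b : R[i]) : Re (a + b) = Re a + Re b.
Proof. by case: a b => [? ?] [? ?]. Qed.
Lemma ImD (a b : R[i]) : Im (a + b) = Im a + Im b.
Proof. by case: a b => [? ?] [? ?]. Qed.
Lemma ReN (a : R[i]) : Re (- a) = - Re a.
Proof. by case: a. Qed.
Lemma ImN (a : R[i]) : Im (- a) = - Im a.
Proof. by case: a. Qed.
Lemma Re_real_div (a : R[i]) (t : R) : Re (a / t%:C) = Re a / t.
Proof. by rewrite -fmorphV ReM /= mulr0 subr0. Qed.
Lemma Im_real_div (a : R[i]) (t : R) : Im (a / t%:C) = Im a / t.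
Proof. by rewrite -fmorphV ImM /= mulr0 add0r. Qed.
Lemma complexP (a b : R[i]) : Re a = Re b -> Im a = Im b -> a = b.
Proof. by case: a b => [? ?] [? ?] /= -> ->. Qed.

Variables (gamma vp : R) (vh : R -> R) (s0 q0 d0 B : R) (q d b r ds dq db dr : R -> R).
Hypothesis sc : shock_coefficients gamma vp vh s0 q0 d0 B q d b r ds dq db dr.
Variable lam : R[i].
Let al := Re lam.
Let be := Im lam.
Let m := al ^+ 2 + be ^+ 2.
Hypothesis m0 : 0 < m.

Let T := linop gamma vp vh.

Let mq : multiplier q dq.
Proof.
split; [exact: sc_q sc|exact: sc_dq sc| |]; exists B => x; last by case: (sc_bounds sc x).
case: (sc_bounds sc x) => _ /andP[h1 h2] _ _ _ _ _ _ _.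
have [_ q00 _ _] := sc_pos sc.
by rewrite ger0_norm// (le_trans _ h1)// ltW.
Qed.

Let md : multiplier d r.
Proof.
split; [exact: sc_d sc|exact: primitive_continuous (sc_r sc)| |]; exists B => x; last by case: (sc_bounds sc x).
case: (sc_bounds sc x) => _ _ /andP[h1 h2] _ _ _ _ _ _.
have [_ _ d00 _] := sc_pos sc.
by rewrite ger0_norm// (le_trans _ h1)// ltW.
Qed.

Let ms : multiplier vh ds.
Proof.
have [cds hds] := sc_ds sc.
split; [exact: sc_s sc|exact: cds| |by exists B]; exists B => x.
case: (sc_bounds sc x) => /andP[h1 h2] _ _ _ _ _ _ _ _.
have [s00 _ _ _] := sc_pos sc.
by rewrite ger0_norm// (le_trans _ h1)// ltW.
Qed.

Let sdq x : vh x * (d x * q x) = 1.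
Proof. by case: (sc_bounds sc x) => _ _ _ _ _ _ e1 e2 _; rewrite mulrA [vh x * _]mulrC e1. Qed.

Let s_neq0 x : vh x != 0.
Proof. by apply/negP => /eqP h; have := sdq x; rewrite h mul0r => /eqP; rewrite eq_sym oner_eq0. Qed.

(** [(- F_2 / lambda, - F_1 / lambda, 0)], with [m = |lambda|^2]. *)
Definition forcing (F : cpair R) : 'I_6 -> R -> R :=
  vec6 (fun x => - ((al * Re (F.2 x) + be * Im (F.2 x)) / m))
       (fun x => - ((al * Im (F.2 x) - be * Re (F.2 x)) / m))
       (fun x => - ((al * Re (F.1 x) + be * Im (F.1 x)) / m))
       (fun x => - ((al * Im (F.1 x) - be * Re (F.1 x)) / m))
       (fun _ => 0) (fun _ => 0).

(** The first component is [u - lambda V], which inverts [V = (u - v) / lambda]. *)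
Definition recover (W : 'I_6 -> R -> R) : cpair R :=
  (mkC (fun x => W ku1 x - (al * W kV1 x - be * W kV2 x))
       (fun x => W ku2 x - (al * W kV2 x + be * W kV1 x)),
   mkC (W ku1) (W ku2)).

Lemma adm_forcing F : adm (forcing F).
Proof. by []. Qed.

Lemma forcing_Lfun F : L2pair F -> forall i, forcing F i \in Lfun mu 2%:E.
Proof.
move=> [[l1 l2] [l3 l4]].
have z : (fun _ : R => 0 : R) \in Lfun mu 2%:E.
  by have := Lfun2Z 0 l1; under eq_fun do rewrite mul0r.
have lc (k1 k2 : R) (f g : R -> R) : f \in Lfun mu 2%:E -> g \in Lfun mu 2%:E ->
   (fun x => - ((k1 * f x + k2 * g x) / m)) \in Lfun mu 2%:E.
  move=> lf lg; have := Lfun2Z (- m^-1) (Lfun2D (Lfun2Z k1 lf) (Lfun2Z k2 lg)).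
  by under eq_fun do rewrite mulNr mulrC.
apply: forall6; rewrite /forcing /vec6 /= //.
- exact: (lc al be _ _ l3 l4).
- by have := lc al (- be) _ _ l4 l3; under eq_fun do rewrite mulNr.
- exact: (lc al be _ _ l1 l2).
- by have := lc al (- be) _ _ l2 l1; under eq_fun do rewrite mulNr.
Qed.

Let qE x : shock_h gamma (shock_a gamma vp) (vh x) * vh x `^ (- gamma - 1) = q x.
Proof. by rewrite (sc_qE sc). Qed.

Lemma ae_imp (P Q : R -> Prop) : (forall x, P x -> Q x) ->
  {ae mu, forall x, P x} -> {ae mu, forall x, Q x}.
Proof. by move=> PQ; apply: filterS => //; exact: (ae_filter_ringOfSetsType mu). Qed.

Lemma ae_and (P Q : R -> Prop) : {ae mu, forall x, P x} -> {ae mu, forall x, Q x} ->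
  {ae mu, forall x, P x /\ Q x}.
Proof. by move=> p q'; apply: (filterS2 (ae_filter_ringOfSetsType mu) _ p q'). Qed.

Lemma L2_mkC f g : f \in Lfun mu 2%:E -> g \in Lfun mu 2%:E -> L2 (mkC f g).
Proof. by []. Qed.

Lemma L2_qmul (p : R -> R[i]) : L2 p -> L2 (fun y => (q y)%:C * p y).
Proof.
move=> [h1 h2]; have [pq cq [M HM] _] := mq.
have mq' : measurable_fun setT q by apply: continuous_measurable; exact: primitive_continuous pq.
split.
- rewrite (_ : _ \o _ = fun x => q x * Re (p x)); first exact: Lfun2M HM h1.
  by apply/funext => x /=; rewrite ReM /= mul0r subr0.
- rewrite (_ : _ \o _ = fun x => q x * Im (p x)); first exact: Lfun2M HM h2.
  by apply/funext => x /=; rewrite ImM /= mul0r addr0.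
Qed.

Lemma L2_sdiv (p : R -> R[i]) : L2 p -> L2 (fun y => p y / (vh y)%:C).
Proof.
move=> [h1 h2]; have [pe ce [M HM] _] := multiplierM md mq.
have me : measurable_fun setT (fun x => d x * q x) by apply: continuous_measurable; exact: primitive_continuous pe.
(* [vh * d * q = b * q = 1], so division by the profile is multiplication by the bounded function
   [d * q]. *)
have E x : (vh x)^-1 = d x * q x by rewrite -[RHS]mul1r -(mulVf (s_neq0 x)) -mulrA sdq mulr1.
split.
- rewrite (_ : _ \o _ = fun x => d x * q x * Re (p x)); first exact: Lfun2M HM h1.
  by apply/funext => x; rewrite -[LHS]/(Re (p x / (vh x)%:C)) Re_real_div E mulrC.
- rewrite (_ : _ \o _ = fun x => d x * q x * Im (p x)); first exact: Lfun2M HM h2.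
  by apply/funext => x; rewrite -[LHS]/(Im (p x / (vh x)%:C)) Im_real_div E mulrC.
Qed.

Lemma wderiv_qmul (p : R -> R[i]) F1 F2 f1 f2 : L2 p ->
  {ae mu, forall x, p x = mkC F1 F2 x} -> sobolev F1 f1 -> sobolev F2 f2 ->
  H1 (fun y => (q y)%:C * p y) /\
  {ae mu, forall x, wderiv (fun y => (q y)%:C * p y) x =
     mkC (fun x => dq x * F1 x + q x * f1 x) (fun x => dq x * F2 x + q x * f2 x) x}.
Proof.
move=> lp pF S1 S2; apply: sobolev_wderiv; [exact: L2_qmul| |exact: sobolevM mq S1|exact: sobolevM mq S2].
apply: ae_imp pF => x ->; rewrite /mkC; apply: complexP; first by rewrite ReM /= mul0r subr0.
by rewrite ImM /= mul0r addr0.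
Qed.

Lemma rhs_Lfun (W f : 'I_6 -> R -> R) : (forall i, W i \in Lfun mu 2%:E) ->
  (forall i, f i \in Lfun mu 2%:E) -> forall i, rhs vh q al be W f i \in Lfun mu 2%:E.
Proof.
move=> lW lf; have [pq cq [M HM] _] := mq; have [ps cs [N HN] _] := ms.
have mq' : measurable_fun setT q by apply: continuous_measurable; exact: primitive_continuous pq.
have ms' : measurable_fun setT vh by apply: continuous_measurable; exact: primitive_continuous ps.
have lq i : (fun x => q x * W i x) \in Lfun mu 2%:E by exact: Lfun2M HM (lW i).
have sub (f1 f2 : R -> R) : f1 \in Lfun mu 2%:E -> f2 \in Lfun mu 2%:E ->
  (fun x => f1 x - f2 x) \in Lfun mu 2%:E.
  by move=> h1 h2; have := Lfun2D h1 (Lfun2Z (-1) h2); under eq_fun do rewrite mulN1r.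
apply: forall6; rewrite /rhs /vec6 /=.
- exact: Lfun2D.
- exact: Lfun2D.
- by apply: Lfun2D => //; apply: (sub) => //; apply: (sub); exact: Lfun2Z.
- by apply: Lfun2D => //; apply: (sub) => //; apply: Lfun2D; exact: Lfun2Z.
- apply: (Lfun2M ms' HN); apply: Lfun2D => //; apply: (sub) => //.
  by apply: (sub); apply: Lfun2Z; exact: Lfun2D.
- apply: (Lfun2M ms' HN); apply: Lfun2D => //; apply: (sub) => //.
  by apply: Lfun2D; apply: Lfun2Z; exact: Lfun2D.
Qed.

(** The first row of the resolvent equation turns into the equation for [V'], the second into the
    one for [U']. Both hold almost everywhere, which is all that a primitive requires. *)
Lemma linop_dom_solution (w : cpair R) : linop_dom w ->
  L2pair (shifted T lam w) /\
  exists W, [/\ forall x y, sol (coef vh q al be) x y W (forcing (shifted T lam w)),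
     (forall i, W i \in Lfun mu 2%:E) & L2eq w (recover W)].
Proof.
move=> [hv [hu hdu]]; case: w hv hu hdu => v u /= hv hu hdu.
have [v1 [v2 [av Sv1 Sv2]]] := H1_sobolev hv.
have [u1 [u2 [au Su1 Su2]]] := H1_sobolev hu.
have [y1 [y2 [ay Sy1 Sy2]]] := H1_sobolev hdu.
have lv : L2 v by case: hv.
have lu : L2 u by case: hu.
have ldu : L2 (wderiv u) by case: hdu.
have ldv : L2 (wderiv v) by case: (wderivP hv).
have [hq aq] := wderiv_qmul lv av Sv1 Sv2.
have [e [de [me Ee se]]] : exists e de : R -> R, [/\ multiplier e de,
    forall x, (vh x)^-1 = e x & forall x, vh x * e x = 1].
  exists (fun x => d x * q x), (fun x => r x * q x + d x * dq x); split; [exact: multiplierM md mq| |exact: sdq].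
  by move=> x; rewrite -[RHS]mul1r -(mulVf (s_neq0 x)) -mulrA sdq mulr1.
have [hy ar] : H1 (fun y => wderiv u y / (vh y)%:C) /\
  {ae mu, forall x, wderiv (fun y => wderiv u y / (vh y)%:C) x =
     mkC (fun x => de x * y1 x + e x * (Re \o wderiv (wderiv u)) x)
         (fun x => de x * y2 x + e x * (Im \o wderiv (wderiv u)) x) x}.
  apply: sobolev_wderiv; [exact: L2_sdiv| |exact: sobolevM me Sy1|exact: sobolevM me Sy2].
  apply: ae_imp ay => x ->; rewrite /mkC; apply: complexP.
    by rewrite Re_real_div Ee mulrC.
  by rewrite Im_real_div Ee mulrC.
have [F FE] : exists F, F = shifted T lam (v, u) by eexists.
rewrite -FE.
have FE1 x : F.1 x = lam * v x - (wderiv u x - wderiv v x) by rewrite FE.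
have qE' : (fun y => (shock_h gamma (shock_a gamma vp) (vh y) * vh y `^ (- gamma - 1))%:C * v y) =
   (fun y => (q y)%:C * v y) by apply/funext => y; rewrite qE.
have FE2 x : F.2 x = lam * u x - (- wderiv u x + wderiv (fun y => (q y)%:C * v y) x
   + wderiv (fun y => wderiv u y / (vh y)%:C) x).
  by rewrite FE /shifted /T /linop /= qE'.
have [lq _] := wderivP hq; have [lr _] := wderivP hy.
have LFun : L2pair F.
  have [lv1 lv2] := lv; have [lu1 lu2] := lu; have [ldu1 ldu2] := ldu; have [ldv1 ldv2] := ldv.
  have [lq1 lq2] := lq; have [lr1 lr2] := lr.
  split; split.
  - rewrite (_ : _ \o _ = fun x => (al * (Re \o v) x + (- be) * (Im \o v) x) +
        ((-1) * (Re \o wderiv u) x + (Re \o wderiv v) x)).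
      exact: Lfun2D (Lfun2D (Lfun2Z _ lv1) (Lfun2Z _ lv2)) (Lfun2D (Lfun2Z _ ldu1) ldv1).
    apply/funext => x; rewrite -[LHS]/(Re (F.1 x)) FE1 !(ReD, ReN, ReM) /=.
    rewrite -/al -/be; ring.
  - rewrite (_ : _ \o _ = fun x => (al * (Im \o v) x + be * (Re \o v) x) +
        ((-1) * (Im \o wderiv u) x + (Im \o wderiv v) x)).
      exact: Lfun2D (Lfun2D (Lfun2Z _ lv2) (Lfun2Z _ lv1)) (Lfun2D (Lfun2Z _ ldu2) ldv2).
    apply/funext => x; rewrite -[LHS]/(Im (F.1 x)) FE1 !(ImD, ImN, ImM) /=.
    rewrite -/al -/be; ring.
  - rewrite (_ : _ \o _ = fun x => (al * (Re \o u) x + (- be) * (Im \o u) x) +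
        ((Re \o wderiv u) x + ((-1) * (Re \o wderiv (fun y => (q y)%:C * v y)) x
         + (-1) * (Re \o wderiv (fun y => wderiv u y / (vh y)%:C)) x))).
      exact: Lfun2D (Lfun2D (Lfun2Z _ lu1) (Lfun2Z _ lu2)) (Lfun2D ldu1 (Lfun2D (Lfun2Z _ lq1) (Lfun2Z _ lr1))).
    apply/funext => x; rewrite -[LHS]/(Re (F.2 x)) FE2 !(ReD, ReN) ReM /=.
    rewrite -/al -/be; ring.
  - rewrite (_ : _ \o _ = fun x => (al * (Im \o u) x + be * (Re \o u) x) +
        ((Im \o wderiv u) x + ((-1) * (Im \o wderiv (fun y => (q y)%:C * v y)) x
         + (-1) * (Im \o wderiv (fun y => wderiv u y / (vh y)%:C)) x))).
      exact: Lfun2D (Lfun2D (Lfun2Z _ lu2) (Lfun2Z _ lu1)) (Lfun2D ldu2 (Lfun2D (Lfun2Z _ lq2) (Lfun2Z _ lr2))).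
    apply/funext => x; rewrite -[LHS]/(Im (F.2 x)) FE2 !(ImD, ImN) ImM /=.
    rewrite -/al -/be; ring.
split=> //.
(* [Sz1] and [Sz2] treat [lambda U = u' / s + q v - u], each summand of which has an H^1
   representative. Division by [lambda] is multiplication by its conjugate and by [1 / m]. *)
have Sz1 := sobolevD (sobolevD (sobolevM me Sy1) (sobolevM mq Sv1)) (sobolevZ (-1) Su1).
have Sz2 := sobolevD (sobolevD (sobolevM me Sy2) (sobolevM mq Sv2)) (sobolevZ (-1) Su2).
have SU1 := sobolevZ m^-1 (sobolevD (sobolevZ al Sz1) (sobolevZ be Sz2)).
have SU2 := sobolevZ m^-1 (sobolevD (sobolevZ al Sz2) (sobolevZ (- be) Sz1)).
have Sw1 := sobolevD Su1 (sobolevZ (-1) Sv1).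
have Sw2 := sobolevD Su2 (sobolevZ (-1) Sv2).
have SV1 := sobolevZ m^-1 (sobolevD (sobolevZ al Sw1) (sobolevZ be Sw2)).
have SV2 := sobolevZ m^-1 (sobolevD (sobolevZ al Sw2) (sobolevZ (- be) Sw1)).
move: SU1 SU2 SV1 SV2.
set U1 := (X in sobolev X _); set dU1 := (X in sobolev U1 X) => SU1.
set U2 := (X in sobolev X _); set dU2 := (X in sobolev U2 X) => SU2.
set V1 := (X in sobolev X _); set dV1 := (X in sobolev V1 X) => SV1.
set V2 := (X in sobolev X _); set dV2 := (X in sobolev V2 X) => SV2.
pose W := vec6 U1 U2 V1 V2 u1 u2.
have lW : forall i, W i \in Lfun mu 2%:E.
  by apply: forall6; rewrite /W /vec6 /=; [case: SU1|case: SU2|case: SV1|case: SV2|case: Su1|case: Su2].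
have lf := forcing_Lfun LFun.
have mn0 : al ^+ 2 + be ^+ 2 != 0 by rewrite gt_eqF.
have lrhs := rhs_Lfun lW lf.
have aall := ae_and (ae_and av au) (ae_and ay (ae_and aq ar)).
have prim (i : 'I_6) (D : R -> R) : sobolev (W i) D -> {ae mu, forall x, D x = rhs vh q al be W (forcing F) i x} ->
  forall x y, primitive_on x y (W i) (rhs vh q al be W (forcing F) i).
  move=> [p _ _] a x y; exact: (primitive_ae (Lfun2_locint (lrhs i)) a p).
exists W; split => //.
- move=> x y; apply/(sol_rhs vh q al be _ _ _ (adm_forcing _)); move: x y.
  suff H : forall i x y, primitive_on x y (W i) (rhs vh q al be W (forcing F) i) by move=> x y i; exact: H.
  apply: forall6.
  + apply: (prim kU1 dU1 SU1); apply: ae_imp aall => x [[ev eu] [ey [eq er]]].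
    rewrite /rhs /forcing /W /vec6 /= !(FE2 x) eu ey eq er /mkC !(ReD, ReN, ReM, ImD, ImN, ImM) /=.
    by rewrite /dU1 /= ey /= -/al -/be /m; field.
  + apply: (prim kU2 dU2 SU2); apply: ae_imp aall => x [[ev eu] [ey [eq er]]].
    rewrite /rhs /forcing /W /vec6 /= !(FE2 x) eu ey eq er /mkC !(ReD, ReN, ReM, ImD, ImN, ImM) /=.
    by rewrite /dU2 /= ey /= -/al -/be /m; field.
  + apply: (prim kV1 dV1 SV1); apply: ae_imp aall => x [[ev eu] [ey [eq er]]].
    rewrite /rhs /forcing /W /vec6 /= !(FE1 x) ev ey /mkC !(ReD, ReN, ReM, ImD, ImN, ImM) /=.
    by rewrite /dV1 /V1 /V2 /= ey /= -/al -/be /m; field.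
  + apply: (prim kV2 dV2 SV2); apply: ae_imp aall => x [[ev eu] [ey [eq er]]].
    rewrite /rhs /forcing /W /vec6 /= !(FE1 x) ev ey /mkC !(ReD, ReN, ReM, ImD, ImN, ImM) /=.
    by rewrite /dV2 /V1 /V2 /= ey /= -/al -/be /m; field.
  + apply: (prim ku1 _ Su1); apply: ae_imp aall => x [[ev eu] [ey [eq er]]].
    rewrite /rhs /W /vec6 /= ey /= /U1 /U2 /V1 /V2 -[LHS]mul1r -[X in X * y1 x = _](se x) /m; field; exact: mn0.
  + apply: (prim ku2 _ Su2); apply: ae_imp aall => x [[ev eu] [ey [eq er]]].
    rewrite /rhs /W /vec6 /= ey /= /U1 /U2 /V1 /V2 -[LHS]mul1r -[X in X * y2 x = _](se x) /m; field; exact: mn0.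
- split; apply: ae_imp aall => x [[ev eu] [ey [eq er]]].
    rewrite /= ev /recover /W /vec6 /mkC /= /V1 /V2 /m; congr (_ +i* _); field; exact: mn0.
  by rewrite /= eu.
Qed.

Lemma ae_all (P : R -> Prop) : (forall x, P x) -> {ae mu, forall x, P x}.
Proof.
move=> h; exists set0; split; [exact: measurable0|exact: measure0|].
by move=> x /= /(_ (h x)).
Qed.

(** The second derivative of [u] is gained from the system: [u' = s X] with [X = lambda U + u - q v]
    in H^1, so [u] is in H^2, and the viscous term [(u' / s)'] is just [X']. *)
Lemma solution_linop_dom (F : cpair R) (W : 'I_6 -> R -> R) : L2pair F ->
  (forall x y, sol (coef vh q al be) x y W (forcing F)) -> (forall i, W i \in Lfun mu 2%:E) ->
  linop_dom (recover W) /\ L2eq (shifted T lam (recover W)) F.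
Proof.
move=> lF hW lW.
have [g gE] : exists g, g = rhs vh q al be W (forcing F) by eexists.
have lg : forall i, g i \in Lfun mu 2%:E by rewrite gE; exact: rhs_Lfun lW (forcing_Lfun lF).
have S i : sobolev (W i) (g i).
  split=> //; move=> x y; rewrite gE.
  by have /(sol_rhs vh q al be _ _ _ (adm_forcing _)) := hW x y; exact.
have Sv1 := sobolevD (S ku1) (sobolevZ (-1) (sobolevD (sobolevZ al (S kV1)) (sobolevZ (- be) (S kV2)))).
have Sv2 := sobolevD (S ku2) (sobolevZ (-1) (sobolevD (sobolevZ al (S kV2)) (sobolevZ be (S kV1)))).
have SX1 := sobolevD (sobolevD (sobolevD (sobolevZ al (S kU1)) (sobolevZ (- be) (S kU2))) (S ku1)) (sobolevZ (-1) (sobolevM mq Sv1)).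
have SX2 := sobolevD (sobolevD (sobolevD (sobolevZ al (S kU2)) (sobolevZ be (S kU1))) (S ku2)) (sobolevZ (-1) (sobolevM mq Sv2)).
have Sy1 := sobolevM ms SX1; have Sy2 := sobolevM ms SX2.
move: Sv1 Sv2 SX1 SX2 Sy1 Sy2.
set v1 := (X in sobolev X _ -> _); set dv1 := (X in sobolev v1 X -> _) => Sv1.
set v2 := (X in sobolev X _ -> _); set dv2 := (X in sobolev v2 X -> _) => Sv2.
set X1 := (X in sobolev X _ -> _); set dX1 := (X in sobolev X1 X -> _) => SX1.
set X2 := (X in sobolev X _ -> _); set dX2 := (X in sobolev X2 X -> _) => SX2.
move=> Sy1 Sy2.
have vE x : (recover W).1 x = mkC v1 v2 x by rewrite /recover /mkC /v1 /v2 /=; congr (_ +i* _); ring.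
have uE x : (recover W).2 x = mkC (W ku1) (W ku2) x by [].
move: vE uE; case: (recover W) => v u /= vE uE.
have vE' : v = mkC v1 v2 by apply/funext.
have uE' : u = mkC (W ku1) (W ku2) by apply/funext.
have lv : L2 v by rewrite vE'; case: Sv1 => _ ? _; case: Sv2 => _ ? _; exact: L2_mkC.
have lu : L2 u by rewrite uE'; exact: L2_mkC.
have [hv av] := sobolev_wderiv lv (ae_all vE) Sv1 Sv2.
have [hu au] := sobolev_wderiv lu (ae_all uE) (S ku1) (S ku2).
have [ldu _] := wderivP hu.
have y1E x : g ku1 x = vh x * X1 x.
  by rewrite gE /rhs /vec6 /= /X1 /v1; ring.
have y2E x : g ku2 x = vh x * X2 x.
  by rewrite gE /rhs /vec6 /= /X2 /v2; ring.
have ay : {ae mu, forall x, wderiv u x = mkC (fun x => vh x * X1 x) (fun x => vh x * X2 x) x}.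
  by apply: ae_imp au => x ->; rewrite /mkC y1E y2E.
have [hdu _] := sobolev_wderiv ldu ay Sy1 Sy2.
have [_ aq] := wderiv_qmul lv (ae_all vE) Sv1 Sv2.
have [_ ar] : H1 (fun y => wderiv u y / (vh y)%:C) /\
  {ae mu, forall x, wderiv (fun y => wderiv u y / (vh y)%:C) x = mkC dX1 dX2 x}.
  apply: (sobolev_wderiv (L2_sdiv ldu) _ SX1 SX2).
  apply: ae_imp au => x ->; rewrite /mkC y1E y2E; apply: complexP.
    by rewrite Re_real_div mulrC mulKf.
  by rewrite Im_real_div mulrC mulKf.
split; first by [].
have qE' : (fun y => (shock_h gamma (shock_a gamma vp) (vh y) * vh y `^ (- gamma - 1))%:C * v y) =
   (fun y => (q y)%:C * v y) by apply/funext => y; rewrite qE.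
have mn0 : al ^+ 2 + be ^+ 2 != 0 by rewrite gt_eqF.
have aall := ae_and (ae_and av au) (ae_and aq ar).
split; apply: ae_imp aall => x [[ev eu] [eq er]].
  rewrite /= ev eu vE /mkC; apply: complexP; rewrite !(ReD, ReN, ReM, ImD, ImN, ImM) /=.
    rewrite /dv1 /v1 /v2 gE /rhs /forcing /vec6 /= -/al -/be /m; field; exact: mn0.
  rewrite /dv2 /v1 /v2 gE /rhs /forcing /vec6 /= -/al -/be /m.
  move: (complex.Re (F.1 x)) (complex.Im (F.1 x)) (vh x) (W ku1 x) (W ku2 x) (W kV1 x) (W kV2 x) (W kU1 x) (W kU2 x) (q x) mn0.
  by move: al be => a b0 *; field.
rewrite /= qE' eu eq er uE /mkC; apply: complexP; rewrite !(ReD, ReN, ReM, ImD, ImN, ImM) /=.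
  rewrite /dX1 /dv1 /v1 gE /rhs /forcing /vec6 /= -/al -/be /m.
  move: (complex.Re (F.2 x)) (complex.Im (F.2 x)) (vh x) (W ku1 x) (W ku2 x) (W kV1 x) (W kV2 x) (W kU1 x) (W kU2 x) (q x) (dq x) (complex.Re (F.1 x)) (complex.Im (F.1 x)) mn0.
  by move: al be => a b0 *; field.
rewrite /dX2 /dv2 /v2 gE /rhs /forcing /vec6 /= -/al -/be /m.
  move: (complex.Re (F.2 x)) (complex.Im (F.2 x)) (vh x) (W ku1 x) (W ku2 x) (W kV1 x) (W kV2 x) (W kU1 x) (W kU2 x) (q x) (dq x) (complex.Re (F.1 x)) (complex.Im (F.1 x)) mn0.
  by move: al be => a b0 *; field.
Qed.

End Resolvent.

(** * The closed right half-plane without 0 in the resolvent set *)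

Section Stability.
Local Open Scope complex_scope.
Context {R : realType}.
Local Notation mu := (@lebesgue_measure R).
Local Notation Re := (@complex.Re R).
Local Notation Im := (@complex.Im R).
Implicit Types (w z F : cpair R) (W f : 'I_6 -> R -> R) (lam : R[i]).

Lemma Rintegral_ae (g h : R -> R) : measurable_fun setT g -> measurable_fun setT h ->
  {ae mu, forall x, g x = h x} -> \int[mu]_x g x = \int[mu]_x h x.
Proof.
move=> mg mh gh; rewrite /Rintegral; congr fine; apply: ae_eq_integral => //.
- exact/measurable_EFinP.
- exact/measurable_EFinP.
- by apply: ae_imp gh => x /= -> _.
Qed.

Lemma Rintegral_eq0_ae (g : R -> R) : mu.-integrable setT (EFin \o g) -> (forall x, 0 <= g x) ->
  \int[mu]_x g x <= 0 -> {ae mu, forall x, g x = 0}.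
Proof.
move=> gi g0 gI.
have mg : measurable_fun setT (EFin \o g) by case/integrableP: gi.
have I0 : (\int[mu]_(x in setT) `|(EFin \o g) x| = 0)%E.
  have fi : (\int[mu]_(x in setT) `|(EFin \o g) x| \is a fin_num)%E.
    apply: integrable_fin_num => //; exact: integrable_abse.
  have E : (\int[mu]_(x in setT) `|(EFin \o g) x| = \int[mu]_x (EFin \o g) x)%E.
    by apply: eq_integral => x _ /=; rewrite ger0_norm.
  rewrite E in fi *; rewrite -(fineK fi); congr EFin; apply/eqP; rewrite eq_le.
  rewrite [X in X && _]gI /= fine_ge0//; apply: integral_ge0 => x _; by rewrite lee_fin.
have h : ae_eq mu setT (EFin \o g) (cst 0%E) by apply/(ae_eq_integral_abs _ _ _).1.
by apply: ae_imp h => x /(_ I) [].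
Qed.

Lemma sqr_normc (y : R[i]) : ComplexField.Normc.normc y ^+ 2 = Re y ^+ 2 + Im y ^+ 2.
Proof. by case: y => a b; rewrite /= sqr_sqrtr// addr_ge0 ?sqr_ge0. Qed.

Definition pair_sqr w (x : R) : R :=
  Re (w.1 x) ^+ 2 + Im (w.1 x) ^+ 2 + (Re (w.2 x) ^+ 2 + Im (w.2 x) ^+ 2).

Lemma L2normE w : L2norm w = Num.sqrt (\int[mu]_x pair_sqr w x).
Proof. by rewrite /L2norm; under eq_Rintegral do rewrite !sqr_normc. Qed.

Lemma pair_sqr_integrable w : L2pair w -> mu.-integrable setT (EFin \o pair_sqr w).
Proof.
move=> [[h1 h2] [h3 h4]].
by apply: integrable_add; apply: integrable_add; exact: Lfun2_sqr.
Qed.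

Lemma n2_forcing lam F x : 0 < Re lam ^+ 2 + Im lam ^+ 2 ->
  n2 (forcing lam F) x = (Re lam ^+ 2 + Im lam ^+ 2)^-1 * pair_sqr F x.
Proof.
move=> m0; rewrite /n2 sum6 /forcing /vec6 /pair_sqr /=.
by move: (Re lam) (Im lam) m0 => a b /gt_eqF/negbT n0; field.
Qed.

Lemma pair_sqr_recover lam W x :
  pair_sqr (recover lam W) x <= (3 + 2 * (Re lam ^+ 2 + Im lam ^+ 2)) * n2 W x.
Proof.
rewrite /n2 sum6 /pair_sqr /recover /mkC /=.
move: (Re lam) (Im lam) (W kU1 x) (W kU2 x) (W kV1 x) (W kV2 x) (W ku1 x) (W ku2 x).
move=> a b U1 U2 V1 V2 u1 u2; rewrite -subr_ge0.
(* With [v = u - lambda V], the parallelogram law gives [|v|^2 = 2 |u|^2 + 2 |lambda V|^2 - |u +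
   lambda V|^2]; the remainder is a sum of nonnegative terms. *)
rewrite (_ : _ - _ = (3 + 2 * (a ^+ 2 + b ^+ 2)) * (U1 ^+ 2 + U2 ^+ 2) + 3 * (V1 ^+ 2 + V2 ^+ 2)
  + 2 * (a ^+ 2 + b ^+ 2) * (u1 ^+ 2 + u2 ^+ 2)
  + (u1 + (a * V1 - b * V2)) ^+ 2 + (u2 + (a * V2 + b * V1)) ^+ 2); last by ring.
by do ?[exact: sqr_ge0|exact: ler0n|apply: addr_ge0|apply: mulr_ge0].
Qed.

Lemma recover_L2pair lam W : (forall i, W i \in Lfun mu 2%:E) -> L2pair (recover lam W).
Proof.
have sub k1 k2 g1 g2 g3 : g1 \in Lfun mu 2%:E -> g2 \in Lfun mu 2%:E -> g3 \in Lfun mu 2%:E ->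
  (fun x => g1 x - (k1 * g2 x + k2 * g3 x)) \in Lfun mu 2%:E.
  move=> h1 h2 h3; have := Lfun2D h1 (Lfun2Z (-1) (Lfun2D (Lfun2Z k1 h2) (Lfun2Z k2 h3))).
  by under eq_fun do rewrite mulN1r.
move=> lW; split; split => /=; [|exact: (sub (Re lam) (Im lam) _ _ _ (lW ku2) (lW kV2) (lW kV1))|exact: lW|exact: lW].
have := sub (Re lam) (- Im lam) _ _ _ (lW ku1) (lW kV1) (lW kV2).
by under eq_fun do rewrite mulNr.
Qed.

Lemma linop_dom_L2pair w : linop_dom w -> L2pair w.
Proof. by move=> [[h _] [[k _] _]]. Qed.

Lemma pair_sqr_measurable w : L2pair w -> measurable_fun setT (pair_sqr w).
Proof. by move=> /pair_sqr_integrable/integrableP[/measurable_EFinP]. Qed.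

Lemma L2_square_integrable W : (forall i, W i \in Lfun mu 2%:E) -> square_integrable W.
Proof. by move=> h; apply/square_integrableP => // i; exact: Lfun2_measurable. Qed.

Lemma resolvent_halfplane (gamma vp : R) (vh : R -> R) (s0 q0 d0 B : R) (q d b r ds dq db dr : R -> R) lam :
  shock_coefficients gamma vp vh s0 q0 d0 B q d b r ds dq db dr ->
  0 <= Re lam -> lam <> 0 -> in_resolvent_set linop_dom (linop gamma vp vh) lam.
Proof.
move=> sc al0 ln0.
have m0 : 0 < Re lam ^+ 2 + Im lam ^+ 2.
  rewrite lt_neqAle eq_sym addr_ge0 ?sqr_ge0// andbT paddr_eq0 ?sqr_ge0// !sqrf_eq0.
  by apply/negP => /andP[/eqP h1 /eqP h2]; apply: ln0; apply: complexP.
have [M [kap [c [K [Ka [es SR SL]]]]]] := concrete_energy sc al0 m0.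
have bvp := concrete_bvp sc es SR SL.
have c0 := es_c es; have K0 := es_K es.
have bound W F : L2pair F -> (forall i, W i \in Lfun mu 2%:E) ->
  (forall x y, sol (coef vh q (Re lam) (Im lam)) x y W (forcing lam F)) ->
  c * \int[mu]_x n2 W x <= K * \int[mu]_x n2 (forcing lam F) x.
  move=> lF lW h; apply: (line_bound es) => //; apply: L2_square_integrable => //.
  exact: forcing_Lfun.
split.
- move=> w z dw dz [e1 e2].
  have [lFw [W [hW lW eW]]] := linop_dom_solution sc m0 dw.
  have [lFz [Z [hZ lZ eZ]]] := linop_dom_solution sc m0 dz.
  move: (shifted _ _ w) (shifted _ _ z) => F G in e1 e2 lFw lFz hW hZ *.
  pose D := fun i x => W i x + -1 * Z i x.
  have lD i : D i \in Lfun mu 2%:E by exact: Lfun2D (lW i) (Lfun2Z (-1) (lZ i)).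
  pose g := fun i x => forcing lam F i x + -1 * forcing lam G i x.
  have lg i : g i \in Lfun mu 2%:E.
    by apply: Lfun2D; [|apply: Lfun2Z]; exact: forcing_Lfun.
  have hD x y : sol (coef vh q (Re lam) (Im lam)) x y D g by exact: sol_lin.
  have ag : adm g by apply: adm_lin; exact: adm_forcing.
  have sg := L2_square_integrable lg; have sD := L2_square_integrable lD.
  have := line_bound es ag sg sD hD.
  (* The two images agree only almost everywhere, so the forcing [g] of the difference is a null
     function rather than zero. *)
  have -> : \int[mu]_x n2 g x = \int[mu]_x (fun=> 0) x.
    apply: Rintegral_ae => //; first by have /integrableP[/measurable_EFinP] := sg.2.
    apply: ae_imp (ae_and e1 e2) => x [h1 h2].
    by rewrite /n2 sum6 /g /forcing /vec6 /= h1 h2; ring.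
  rewrite Rintegral_cst// mul0r mulr0 pmulr_rle0// => I0.
  have D0 := Rintegral_eq0_ae sD.2 (n2_ge0 D) I0.
  have WZ : {ae mu, forall x, forall i, W i x = Z i x}.
    apply: ae_imp D0 => x n0 i.
    have : D i x ^+ 2 = 0.
      apply/eqP; rewrite eq_le sqr_ge0 andbT -n0 /n2 (bigD1 i)//= lerDl.
      by apply: sumr_ge0 => j _; exact: sqr_ge0.
    by move/eqP; rewrite sqrf_eq0 /D mulN1r subr_eq0 => /eqP.
  have [w1 w2] := eW; have [z1 z2] := eZ.
  split.
    apply: ae_imp (ae_and WZ (ae_and w1 z1)) => x [h [-> ->]].
    by rewrite /recover /mkC /= !h.
  apply: ae_imp (ae_and WZ (ae_and w2 z2)) => x [h [-> ->]].
  by rewrite /recover /mkC /= !h.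
- move=> F lF.
  have lf : forall i, forcing lam F i \in Lfun mu 2%:E by exact: forcing_Lfun.
  have [W [hW sW]] := line_solution es (adm_forcing _ _) (fun i => Lfun2_locint (lf i))
    (L2_square_integrable lf) (bvp _ (adm_forcing _ _) (fun i => Lfun2_locint (lf i))).
  have mW i : measurable_fun setT (W i).
    apply: continuous_measurable; apply: (primitive_continuous (f := rhs vh q (Re lam) (Im lam) W (forcing lam F) i)) => x y.
    by have /(sol_rhs vh q _ _ _ _ _ (adm_forcing _ _)) := hW x y; exact.
  have lW : forall i, W i \in Lfun mu 2%:E by apply/square_integrableP.
  by exists (recover lam W); exact (solution_linop_dom sc m0 lF hW lW).
(* The factors come from [pair_sqr_recover], from the energy bound on the line and from
   [n2_forcing], in this order. *)
- exists (Num.sqrt ((3 + 2 * (Re lam ^+ 2 + Im lam ^+ 2)) * (K / c * (Re lam ^+ 2 + Im lam ^+ 2)^-1))).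
  move=> w dw; have [lF [W [hW lW [e1 e2]]]] := linop_dom_solution sc m0 dw.
  move: (shifted _ _ w) => F in lF hW *.
  have mm0 : 0 <= (Re lam ^+ 2 + Im lam ^+ 2)^-1 by rewrite invr_ge0 ltW.
  have C0 : 0 <= 3 + 2 * (Re lam ^+ 2 + Im lam ^+ 2) by rewrite addr_ge0// mulr_ge0// ltW.
  rewrite !L2normE -sqrtrM; last first.
    by apply: mulr_ge0 => //; apply: mulr_ge0 => //; apply: divr_ge0 => //; exact: ltW.
  apply: ler_wsqrtr.
  have lR := recover_L2pair lam lW.
  have -> : \int[mu]_x pair_sqr w x = \int[mu]_x pair_sqr (recover lam W) x.
    apply: Rintegral_ae; [apply: pair_sqr_measurable; exact: linop_dom_L2pair|exact: pair_sqr_measurable|].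
    by apply: ae_imp (ae_and e1 e2) => x [h1 h2]; rewrite /pair_sqr h1 h2.
  have [sW1 sW] := L2_square_integrable lW.
  apply: (@le_trans _ _ ((3 + 2 * (Re lam ^+ 2 + Im lam ^+ 2)) * \int[mu]_x n2 W x)).
    rewrite -RintegralZl//; apply: le_Rintegral => //; first exact: pair_sqr_integrable.
      exact: integrable_scale.
    by move=> x _; exact: pair_sqr_recover.
  rewrite -[leRHS]mulrA; apply: ler_wpM2l => //.
  have := bound W F lF lW hW.
  under [X in _ <= K * X -> _]eq_Rintegral do rewrite n2_forcing//.
  rewrite RintegralZl//; last exact: pair_sqr_integrable.
  by move=> h; rewrite -[leRHS]mulrA [leRHS]mulrAC ler_pdivlMr// mulrC.
Qed.

End Stability.

Theorem mainTheorem3 (R : realType) (gamma vp : R) (vh : R -> R)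
  (hgamma : 1 <= gamma) (hvp0 : 0 < vp) (hvp1 : vp < 1)
  (hprofile : shock_profile gamma vp vh)
  (hcond : let a := shock_a gamma vp in
    0 <= (gamma + 1) * vp `^ (gamma + 2)
         + vp `^ gamma * (gamma - 1) * ((gamma + 1) * vp - (a + 1) * gamma) ^+ 2
         + a * gamma * (gamma ^+ 2 - 1) * (gamma + 2) * vp
         - a * (a + 1) * gamma ^+ 2 * (gamma ^+ 2 - 1)) :
  spectrally_stable gamma vp vh.
Proof.
have sc := shock_coefficients_exist hgamma hvp0 hvp1 hprofile hcond.
move: sc => [s0 [q0 [d0 [B [q [d [b [r [ds [dq [db [dr sc]]]]]]]]]]]].
move=> lam spec [re0 ne0]; apply: spec; exact: resolvent_halfplane sc re0 ne0.
Qed.
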